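(* Let $\Gamma$ be fixed data, let $\mathbf s=(e_1,\dots,e_n)$ be a seed, let $\mathcal A_{prin}\subset\overline{\mathcal A}{}^{\mathbf s}_{prin}$ be the associated partial compactification and $\pi:\overline{\mathcal A}{}^{\mathbf s}_{prin}\to\mathbb A^n_{X_1,\dots,X_n}$ the map with $X_i=z^{(0,e_i)}$. Then the central fibre $\pi^{-1}(0)\subset\overline{\mathcal A}{}^{\mathbf s}_{prin}$ is the algebraic torus $T_{N^\circ,\mathbf s}$ (a copy of $T_{N^\circ}$).
   Context: $\Bbbk$ is a field of characteristic $0$; $[a]_+=\max(a,0)$; for a lattice $L$ with dual $L^*$, $T_L=\operatorname{Spec}\Bbbk[L^*]$ with characters $z^\ell$, $\ell\in L^*$. FIXED DATA $\Gamma$: a lattice $N$ of rank $n$ with a skew-symmetric form $\{\cdot,\cdot\}:N\times N\to\mathbb Q$; a saturated sublattice $N_{uf}\subseteq N$; $I=\{1,\dots,n\}\supseteq I_{uf}$ with $|I_{uf}|=\operatorname{rank}N_{uf}$; positive integers $d_i$ ($i\in I$) with gcd $1$; a finite-index sublattice $N^\circ\subseteq N$ with $\{N_{uf},N^\circ\}\subseteq\mathbb Z$ and $\{N,N_{uf}\cap N^\circ\}\subseteq\mathbb Z$. $M=\operatorname{Hom}(N,\mathbb Z)\subseteq M^\circ=\operatorname{Hom}(N^\circ,\mathbb Z)$. A seed is a basis $\mathbf s=(e_i)_{i\in I}$ of $N$ with $(e_i)_{i\in I_{uf}}$ a basis of $N_{uf}$ and $(d_ie_i)_{i\in I}$ a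 basis of $N^\circ$; $f_i=d_i^{-1}e_i^*$ (a basis of $M^\circ$); $\epsilon_{ij}=\{e_i,e_j\}d_j$; $v_i=\{e_i,\cdot\}\in M^\circ$ for $i\in I_{uf}$, assumed non-zero. Mutation at $k\in I_{uf}$: $\mu_k(\mathbf s)=(e_i')$, $e_k'=-e_k$, $e_i'=e_i+[\epsilon_{ik}]_+e_k$ for $i\neq k$. Let $\tilde N=N\oplus M^\circ$ with form $\{(n_1,m_1),(n_2,m_2)\}=\{n_1,n_2\}+\langle n_1,m_2\rangle-\langle n_2,m_1\rangle$, $\tilde N^\circ=N^\circ\oplus M$, $\tilde M^\circ=M^\circ\oplus N$. Let $\mathfrak T$ be the rooted tree with $|I_{uf}|$ outgoing edges, labelled by $I_{uf}$, at each vertex; attach $\mathbf s$ to the root and to every vertex $w$ the seed $\mathbf s_w$ obtained by mutating along the path from the root. $\mathcal A_{prin}=\bigcup_wT_{\tilde N^\circ,w}$ is obtained by gluing tori along the largest open subsets on which the (compositions of the) birational maps $\mu_k:T_{\tilde N^\circ,w}\dashrightarrow T_{\tilde N^\circ,w'}$ ($w\to w'$ an edge labelled $k$), $\mu_k^*z^{(m,n)}=z^{(m,n)}(1+z^{(v_k,e_k)})^{-\langle d_ke_k,m\rangle}$ with $e_k,v_k$ from $\mathbf s_w$, are isomorphisms. PARTIAL COMPACTIFICATION. Let $\tilde{\mathbf s}=((e_1,0),\dots,(e_n,0),(0,f_1),\dots,(0,f_n))$, a basis of $\tilde N$, and mutate it along paths in $\mathfrak T$ by $\tilde e_k'=-\tilde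 e_k$, $\tilde e_i'=\tilde e_i+[\{\tilde e_i,\tilde e_k\}d_k]_+\tilde e_k$ ($1\le i\le 2n$, $i\ne k$), obtaining bases $\tilde{\mathbf s}_w$. Let $\Sigma^{\mathbf s}_w\subset\tilde N^\circ_{\mathbb R}$ be the cone generated by the last $n$ vectors of $\tilde{\mathbf s}_w$, and $\mathrm{TV}(\Sigma^{\mathbf s}_w)\supset T_{\tilde N^\circ,w}$ the corresponding affine toric variety. $\overline{\mathcal A}{}^{\mathbf s}_{prin}$ is obtained by gluing the $\mathrm{TV}(\Sigma^{\mathbf s}_w)$ via the same birational maps along the largest open subsets on which they are isomorphisms. The functions $X_i=z^{(0,e_i)}$ ($e_i$ from the fixed initial seed $\mathbf s$) are regular on it and define $\pi$. *)

(* Defs.v *)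
From mathcomp Require Import all_boot all_order all_algebra fraction.
From mathcomp Require Import mpoly.
From mathcomp Require Import boolp classical_sets functions.

Set Implicit Arguments.
Unset Strict Implicit.
Unset Printing Implicit Defensive.

Import Order.TTheory GRing.Theory Num.Theory.

Local Open Scope classical_set_scope.
Local Open Scope quotient_scope.
Local Open Scope ring_scope.

(** * Integral schemes over a field [k]

   An integral scheme is recorded by its points, its open sets, its function
   field and its local rings, the latter as subrings of the function field.
   The sections of the structure sheaf over a nonempty open set [U] are the
   rational functions lying in all the local rings at points of [U]. *)

Record ischeme (k : fieldType) := IScheme {
  funfield : fieldType;
  const : k -> funfield;
  pt : Type;
  isopen : set (set pt);
  stalk : pt -> set funfield }.

Section Schemes.
Variable k : fieldType.
Implicit Types X Z : ischeme k.

Definition sections X (U : set (pt X)) : set (funfield X) :=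
  [set h | forall x, U x -> stalk x h].

Definition unit_at X (x : pt X) : set (funfield X) :=
  [set h | [/\ stalk x h, h != 0 & stalk x h^-1]].

Definition max_ideal_at X (x : pt X) : set (funfield X) :=
  [set h | stalk x h /\ ~ unit_at x h].

(* Only the values of [comap z] on the local ring at [ptmap z] matter.  The map
   [comap] may depend on [z] because a morphism need not be dominant: a closed
   immersion induces no map of function fields. *)
Record smap Z X := SMap {
  ptmap : pt Z -> pt X;
  comap : pt Z -> funfield X -> funfield Z }.

Definition local_hom_at Z X (f : smap Z X) (z : pt Z) : Prop :=
  let O := stalk (ptmap f z) in let c := comap f z in
  [/\ forall h, O h -> stalk z (c h),
      forall g h, O g -> O h -> c (g + h) = c g + c h,
      forall g h, O g -> O h -> c (g * h) = c g * c h,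
      forall a, c (const X a) = const Z a &
      forall h, max_ideal_at (ptmap f z) h -> max_ideal_at z (c h)].

Definition is_morphism Z X (f : smap Z X) : Prop :=
  [/\ forall U, isopen U -> isopen (ptmap f @^-1` U),
      forall z, local_hom_at f z &
      forall U, isopen U -> forall h, sections U h ->
        exists g, forall z, U (ptmap f z) -> comap f z h = g].

(* [f] is a closed immersion and the stalks of its ideal sheaf are the
   [J x]. *)
Definition closed_immersion Z X (f : smap Z X)
    (J : forall x : pt X, set (funfield X)) : Prop :=
  [/\ is_morphism f,
      injective (ptmap f),
      isopen (~` range (ptmap f)),
      forall V, isopen V -> exists2 U, isopen U & V = ptmap f @^-1` U &
      forall z,
        (forall g, stalk z g ->
           exists2 h, stalk (ptmap f z) h & comap f z h = g) /\
        (forall h, stalk (ptmap f z) h ->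
           (comap f z h = 0 <-> J (ptmap f z) h))].

(** Regular functions [g_1, ..., g_n] on [X] are the same thing as a morphism
   [X -> A^n = Spec k[X_1, ..., X_n]]; it pulls a polynomial [P] back to
   [P(g_1, ..., g_n)]. *)

Section MapToAffineSpace.
Variables (X : ischeme k) (n : nat) (g : 'I_n -> funfield X).

Definition pull_poly (P : {mpoly k[n]}) : funfield X := mmap (@const k X) g P.

(* the image of [x], as a prime ideal of the polynomial ring *)
Definition image_point (x : pt X) : set {mpoly k[n]} :=
  [set P | max_ideal_at x (pull_poly P)].

Definition origin : set {mpoly k[n]} := [set P | P.@[fun=> 0] = 0].

(* the ideal of the local ring at [x] generated by the pullback of [y] *)
Definition extended_ideal (y : set {mpoly k[n]}) (x : pt X) :
    set (funfield X) :=
  [set h | exists s : seq ({mpoly k[n]} * funfield X),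
     (forall p, p \in s -> y p.1 /\ stalk x p.2) /\
     h = \sum_(p <- s) pull_poly p.1 * p.2].

(* The functions [g] are regular, and [i : Z -> X] identifies [Z] with the
   scheme-theoretic fibre over the [k]-rational point [y] of the morphism
   [X -> A^n] they define, i.e. with the closed subscheme whose ideal sheaf is
   generated by the pullback of the maximal ideal [y]. *)
Definition is_fibre (y : set {mpoly k[n]}) Z (i : smap Z X) : Prop :=
  [/\ forall j, sections setT (g j),
      range (ptmap i) = [set x | image_point x = y] &
      closed_immersion i (extended_ideal y)].

End MapToAffineSpace.
End Schemes.

(** * Affine integral schemes and birational glueing *)

Section Spec.
Variables (k K : fieldType) (c : k -> K).

Definition is_prime (A p : set K) : Prop :=
  [/\ [/\ p `<=` A, p 0 & ~ p 1],
      forall a b, p a -> p b -> p (a + b),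
      forall a b, A a -> p b -> p (a * b) &
      forall a b, A a -> A b -> p (a * b) -> p a \/ p b].

Record spec (A : set K) := Spec { ideal : set K; idealP : is_prime A ideal }.

Definition zopen (A : set K) : set (set (spec A)) :=
  [set U | exists E : set K, E `<=` A /\
     U = [set p : spec A | exists2 a, E a & ~ ideal p a]].

Definition local_ring (A : set K) (p : spec A) : set K :=
  [set h | exists a b, [/\ A a, A b, ~ ideal p b & h = a / b]].

(* [A] is a subring of [K] with fraction field [K]. *)
Definition Spec_scheme (A : set K) : ischeme k :=
  IScheme c (@zopen A) (@local_ring A).

(** The affine charts [Spec (A w)] all have function field [K], and
   [theta w : K -> K] is the pullback along a birational map from a fixed
   reference model to the chart [w].  The birational map from the chart [w] to
   the chart [w'] is then the one for which [theta w (f^* h) = theta w' h]. *)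

Variables (W : Type) (A : W -> set K) (theta : W -> K -> K).

Definition chart_point := {w : W & spec (A w)}.

Definition chart_stalk (x : chart_point) : set K :=
  theta (projT1 x) @` local_ring (projT2 x).

(* [f] restricts to an isomorphism from the open subset [U] of the chart [w]
   onto the open subset [V] of the chart [w'], and this isomorphism induces the
   given identification of function fields. *)
Definition birational_iso (w w' : W) (U : set (spec (A w)))
    (V : set (spec (A w'))) (f : spec (A w) -> spec (A w')) : Prop :=
  [/\ zopen U, zopen V, set_bij U V f,
      forall O, O `<=` U -> (zopen O <-> zopen (f @` O)) &
      forall p, U p -> chart_stalk (existT _ w p) = chart_stalk (existT _ w' (f p))].

(* [x] lies in the largest open subset on which the birational map is an
   isomorphism onto an open subset, and is mapped to [y]. *)
Definition glued (x y : chart_point) : Prop :=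
  exists U V f, [/\ @birational_iso (projT1 x) (projT1 y) U V f,
                    U (projT2 x) & f (projT2 x) = projT2 y].

Definition glued_point := {C : set chart_point | exists x, C = glued x}.

Definition glued_scheme : ischeme k :=
  @IScheme k K c glued_point
    [set U | forall w, zopen [set p : spec (A w) |
       exists2 C, U C & sval C (existT _ w p)]]
    (fun C => [set h | exists2 x, sval C x & chart_stalk x h]).

End Spec.

(** * Laurent polynomials *)

Section Laurent.
Variables (k : fieldType) (r : nat).

Definition ratfun : fieldType := {fraction {mpoly k[r]}}.

Definition rconst (a : k) : ratfun := tofrac a%:MP_[r].

Definition lmonom (a : 'rV[int]_r) : ratfun :=
  \prod_(i < r) (tofrac ('X_i : {mpoly k[r]}) : ratfun) ^ a 0 i.

(* the [k]-algebra of a submonoid [S] of [Z^r], inside the Laurent polynomial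
   ring [k[Z^r]] *)
Definition monoid_alg (S : set 'rV[int]_r) : set ratfun :=
  [set h | exists s : seq (k * 'rV[int]_r),
     (forall p, p \in s -> S p.2) /\
     h = \sum_(p <- s) rconst p.1 * lmonom p.2].

(* the [k]-linear field endomorphism with ['X_i |-> u i] *)
Definition ratfun_subst (u : 'I_r -> ratfun) (h : ratfun) : ratfun :=
  mmap rconst u \n_(repr h) / mmap rconst u \d_(repr h).

End Laurent.

(** * Fixed data

   The lattice [N] lives in [N_Q = Q^n] (row vectors) and the dual space [M_Q]
   consists of column vectors. *)

Definition pairing (n : nat) (x : 'rV[rat]_n) (m : 'cV[rat]_n) : rat :=
  (x *m m) 0 0.

(* [b] restricted to [J] is a Z-basis of [L] *)
Definition lattice_basis (V : zmodType) (I : finType) (L : set V)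
    (J : {set I}) (b : I -> V) : Prop :=
  (forall x, L x <-> exists c : I -> int, x = \sum_(i in J) b i *~ c i) /\
  (forall c : I -> int, \sum_(i in J) b i *~ c i = 0 ->
     forall i, i \in J -> c i = 0).

Record fixed_data (n : nat) := FixedData {
  latN : set 'rV[rat]_n;
  latN_rank : exists b : 'I_n -> 'rV[rat]_n, lattice_basis latN [set: 'I_n]%SET b;
  gram : 'M[rat]_n;
  nform (x y : 'rV[rat]_n) : rat := (x *m gram *m y^T) 0 0;
  form_skew : forall x y, nform x y = - nform y x;
  uf : {set 'I_n};
  latNuf : set 'rV[rat]_n;
  latNuf_sub : latNuf `<=` latN;
  latNuf_rank : exists b : 'I_#|uf| -> 'rV[rat]_n,
    lattice_basis latNuf [set: 'I_#|uf|]%SET b;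
  latNuf_saturated : forall x (a : nat), latN x -> (0 < a)%N ->
    latNuf (x *+ a) -> latNuf x;
  dmul : 'I_n -> nat;
  dmul_gt0 : forall i, (0 < dmul i)%N;
  dmul_gcd : \big[gcdn/0%N]_i dmul i = 1%N;
  latNo : set 'rV[rat]_n;
  latNo_sub : latNo `<=` latN;
  latNo0 : latNo 0;
  latNoB : forall x y, latNo x -> latNo y -> latNo (x - y);
  latNo_index : exists s : seq 'rV[rat]_n, forall x, latN x ->
    exists2 y, y \in s & latNo (x - y);
  form_int_uf : forall x y, latNuf x -> latNo y -> nform x y \is a Num.int;
  form_int : forall x y, latN x -> latNuf y -> latNo y -> nform x y \is a Num.int }.

Section Cluster.
Variables (n : nat) (G : fixed_data n).

Local Notation NQ := 'rV[rat]_n.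
Local Notation MQ := 'cV[rat]_n.

Definition d (i : 'I_n) : rat := (dmul G i)%:R.

(* M° = Hom(N°, Z), as N° has finite index in N *)
Definition latMo : set MQ :=
  [set m | forall x, latNo G x -> pairing x m \is a Num.int].

Definition is_seed (e : 'I_n -> NQ) : Prop :=
  [/\ lattice_basis (latN G) [set: 'I_n]%SET e,
      lattice_basis (latNuf G) (uf G) e &
      lattice_basis (latNo G) [set: 'I_n]%SET (fun i => d i *: e i)].

Definition pos_part (a : rat) : rat := Num.max a 0.

Definition eps (e : 'I_n -> NQ) (i j : 'I_n) : rat := nform G (e i) (e j) * d j.

Definition mutate (e : 'I_n -> NQ) (j : 'I_n) : 'I_n -> NQ := fun i =>
  if i == j then - e j else e i + pos_part (eps e i j) *: e j.

(* v_i = {e_i, .} *)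
Definition vvec (e : 'I_n -> NQ) (i : 'I_n) : MQ := (e i *m gram G)^T.

Definition dual_basis (e : 'I_n -> NQ) (i : 'I_n) : MQ :=
  col i (invmx (\matrix_j e j)).

Definition fvec (e : 'I_n -> NQ) (i : 'I_n) : MQ := (d i)^-1 *: dual_basis e i.

(* N~_Q = N_Q + M_Q, which contains both N~ = N + M° and N~° = N° + M *)
Definition tform (u v : NQ * MQ) : rat :=
  nform G u.1 v.1 + pairing u.1 v.2 - pairing v.1 u.2.

(* the pairing of N~° with its dual M~° = M° + N *)
Definition tpairing (u : NQ * MQ) (l : MQ * NQ) : rat :=
  pairing u.1 l.1 + pairing l.2 u.2.

Definition tlatMo : set (MQ * NQ) := [set l | latMo l.1 /\ latN G l.2].

(* [inl i] and [inr i] are the indices i and n + i *)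
Definition tseed (e : 'I_n -> NQ) (i : 'I_n + 'I_n) : NQ * MQ :=
  match i with inl j => (e j, 0) | inr j => (0, fvec e j) end.

Definition tmutate (te : 'I_n + 'I_n -> NQ * MQ) (j : 'I_n) :
    'I_n + 'I_n -> NQ * MQ := fun i =>
  if i == inl j then - te (inl j)
  else te i + pos_part (tform (te i) (te (inl j)) * d j) *: te (inl j).

(* The vertices of the rooted tree are the words in the unfrozen indices, read
   along the path from the root. *)
Definition vertex := seq {j : 'I_n | j \in uf G}.
Definition path_of (w : vertex) : seq 'I_n := [seq val j | j <- w].

Definition tseed_at (e : 'I_n -> NQ) (w : vertex) : 'I_n + 'I_n -> NQ * MQ :=
  foldl tmutate (tseed e) (path_of w).

Definition sigma (e : 'I_n -> NQ) (w : vertex) : set (NQ * MQ) :=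
  [set u | exists c : 'I_n -> rat, (forall i, 0 <= c i) /\
     u = \sum_i c i *: tseed_at e w (inr i)].

Definition dual_cone (S : set (NQ * MQ)) : set (MQ * NQ) :=
  [set l | forall u, S u -> 0 <= tpairing u l].

(** In what follows [e0] is the initial seed.  Characters are written in the
   basis ((f_i, 0))_i, ((0, e_i))_i of M~° given by [e0].  The coordinates of
   lattice vectors are integers, so that [Num.floor] is only a cast. *)

Section Charts.
Variables (k : fieldType) (e0 : 'I_n -> NQ).

Definition coordMo (m : MQ) : 'rV[int]_n :=
  \row_i Num.floor (pairing (d i *: e0 i) m).

Definition coordN (x : NQ) : 'rV[int]_n :=
  \row_i Num.floor (pairing x (dual_basis e0 i)).

Definition tcoord (l : MQ * NQ) : 'rV[int]_(n + n) :=
  row_mx (coordMo l.1) (coordN l.2).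

Definition tbasis (i : 'I_(n + n)) : MQ * NQ :=
  match fintype.split i with inl j => (fvec e0 j, 0) | inr j => (0, e0 j) end.

(* T_{N°} = Spec k[M°] *)
Definition torus : ischeme k :=
  Spec_scheme (@rconst k n) (monoid_alg (k := k) (coordMo @` latMo)).

Definition character (l : MQ * NQ) : ratfun k (n + n) := lmonom k (tcoord l).

(* the coordinate ring k[Sigma_w^dual /\ M~°] of TV(Sigma_w) *)
Definition toric_ring (w : vertex) : set (ratfun k (n + n)) :=
  monoid_alg (k := k) (tcoord @` (tlatMo `&` dual_cone (sigma e0 w))).

Definition mu_character (e : 'I_n -> NQ) (j : 'I_n) (l : MQ * NQ) :
    ratfun k (n + n) :=
  character l *
  (1 + character (vvec e j, e j)) ^ (- Num.floor (pairing (d j *: e j) l.1)).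

(* mu_j^*; both sides of mu_j^* z^l = mu_character e j l are multiplicative in
   l, so that the formula need only be imposed on a basis *)
Definition mu_pull (e : 'I_n -> NQ) (j : 'I_n) :
    ratfun k (n + n) -> ratfun k (n + n) :=
  ratfun_subst (fun i => mu_character e j (tbasis i)).

(* the pullback along the composite of the mutations on a path starting at a
   vertex with seed [e] *)
Fixpoint path_pull (e : 'I_n -> NQ) (s : seq 'I_n) :
    ratfun k (n + n) -> ratfun k (n + n) :=
  if s is j :: s' then mu_pull e j \o path_pull (mutate e j) s' else id.

Definition Aprin_bar : ischeme k :=
  glued_scheme (@rconst k (n + n)) toric_ring
    (fun w => path_pull e0 (path_of w)).

Definition Xfun (i : 'I_n) : funfield Aprin_bar := character (0, e0 i).

End Charts.
End Cluster.

(* Main.v *)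
(* Let a point of the chart at [w'], reached from the chart at [w] by the mutation
   in direction [l], satisfy X_1 = ... = X_n = 0.  By sign coherence the c-vector
   of [l] is nonzero with entries of one sign, so that, for that sign, z^(+-v_l) is
   the product of some X_j and a regular function.  Hence 1 + z^(+-v_l) does not
   vanish at the point, and the mutation is an isomorphism where 1 + z^(+-v_l) is
   invertible.  By induction every point of the central fibre lies in the chart of
   the root, whose central fibre is Spec k[M°].

   Sign coherence is obtained from a quantum scattering diagram.  In the completed
   quantum torus there is a unique series with quantum dilogarithms on the
   coordinate axes and no other initial wall; its factorization with respect to a
   total group preorder describes the diagram at the point given by the preorder.
   Mutation at [i] strips the dilogarithm of [i] from the left or from the right and
   reflects the [i]-th exponents of what remains, and this is the series of the
   mutated exchange matrix.  By induction on the length of a word, the hyperplanes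
   orthogonal to its c-vectors bound a chamber without walls and contain a
   nontrivial wall along each facet.  The exponents on such a wall are nonnegative
   and, at a generic point of the facet, proportional to the c-vector. *)

Require Import Defs.
From HB Require Import structures.
From mathcomp Require Import all_boot all_order all_algebra fraction zify ring lra.
From mathcomp Require Import mpoly.
From mathcomp Require Import boolp classical_sets functions.

Set Implicit Arguments.
Unset Strict Implicit.
Unset Printing Implicit Defensive.

Import Order.TTheory GRing.Theory Num.Theory.
Local Open Scope classical_set_scope.
Local Open Scope quotient_scope.
Local Open Scope ring_scope.

(** * Quantum power series *)

(** The obstacle in sign coherence is that the series lives at the initial seed: a mutation of the
    initial seed acts on it, whereas a letter appended to the word happens at the far end. Words are
    therefore peeled from the front, and the c-vectors of [i :: w] have to be compared with those of
    [w] for the mutated matrix. That comparison ([cvec_cons]) itself uses the chambers of the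
    shorter words for both matrices, so a single induction on the length treats all matrices at
    once. The quantum torus makes the wall elements ordinary series in an associative algebra
    instead of automorphisms: a wall is read off from a factorization, and moving a dilogarithm past
    a series multiplies each line in direction [i] by an explicit palindromic polynomial. The
    palindrome is why reflecting exponents is compatible with stripping the dilogarithm from either
    side. The choice [q = 2] keeps coefficients rational and the denominators [2^(2db) - 1] nonzero.
    Points are total preorders because a generic point of a facet has to be annihilated only by
    multiples of one vector; a lexicographic order does this without real coefficients. *)

Section Exponents.
Variable J : finType.
Local Notation E := {ffun J -> nat}.
Implicit Types (a b n : E).

Definition wdeg n : nat := (\sum_j n j)%N.

Arguments wdeg n%_R.

Lemma wdegD a b : wdeg (a + b) = (wdeg a + wdeg b)%N.
Proof. by rewrite /wdeg -big_split; apply: eq_bigr => j _; rewrite ffunE. Qed.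

Lemma wdeg0 : wdeg (0 : E) = 0%N.
Proof. by rewrite /wdeg big1 // => j _; rewrite ffunE. Qed.

Lemma wdeg_eq0 n : (wdeg n == 0%N) = (n == 0).
Proof.
apply/idP/eqP => [|->]; last by rewrite wdeg0.
rewrite /wdeg sum_nat_eq0 => /forallP n0; apply/ffunP => j; rewrite ffunE.
exact/eqP/(implyP (n0 j)).
Qed.

Lemma leq_wdeg n j : (n j <= wdeg n)%N.
Proof. by rewrite /wdeg (bigD1 j) //= leq_addr. Qed.

Lemma ltn_wdegl a b : b != 0 -> (wdeg a < wdeg (a + b))%N.
Proof. by rewrite -wdeg_eq0 wdegD; lia. Qed.

Lemma ltn_wdegr a b : a != 0 -> (wdeg b < wdeg (a + b))%N.
Proof. by rewrite -wdeg_eq0 wdegD; lia. Qed.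

Lemma expo_addr_eq0 (a b : E) : (a + b == 0) = (a == 0) && (b == 0).
Proof. by rewrite -!wdeg_eq0 wdegD addn_eq0. Qed.

(** Every coordinate gets the same bound, the total degree, so that the box is a finite function
    type; the filter in [decs] removes the excess. *)
Definition expo_box n : seq E :=
  [seq [ffun j => val (f j)] | f : {ffun J -> 'I_(wdeg n).+1}].

Definition decs n : seq (E * E) :=
  [seq p <- [seq (a, b) | a <- expo_box n, b <- expo_box n] | p.1 + p.2 == n].

Lemma decs_uniq n : uniq (decs n).
Proof.
have u : uniq (expo_box n).
  rewrite map_inj_uniq ?enum_uniq // => f g /ffunP h; apply/ffunP => j.
  by apply: val_inj; move: (h j); rewrite !ffunE.
by rewrite filter_uniq // allpairs_uniq // => -[a b] [c d] _ _ [-> ->].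
Qed.

Lemma mem_expo_box n a : (forall j, (a j <= n j)%N) -> a \in expo_box n.
Proof.
move=> le; apply/mapP; exists [ffun j => inord (a j)]; first by rewrite mem_enum.
apply/ffunP => j; rewrite !ffunE /= inordK // ltnS.
exact: leq_trans (le j) (leq_wdeg _ _).
Qed.

Lemma mem_decs n p : (p \in decs n) = (p.1 + p.2 == n).
Proof.
rewrite mem_filter; case: eqP => //= <-; case: p => a b /=.
by apply/allpairsP; exists (a, b); split => //=; apply: mem_expo_box => j;
   rewrite ffunE ?leq_addr ?leq_addl.
Qed.

Lemma big_decs_perm (R : nmodType) n (F : E * E -> R) (s : seq (E * E)) :
  uniq s -> (forall p, (p \in s) = (p.1 + p.2 == n)) ->
  \sum_(p <- decs n) F p = \sum_(p <- s) F p.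
Proof.
move=> us ms; apply: perm_big; apply: uniq_perm; rewrite ?decs_uniq // => p.
by rewrite mem_decs ms.
Qed.

(** Both sides run over the triples of sum [n]; written as duplicate-free lists of triples they are
    permutations of each other. *)
Lemma decs_assoc (R : nmodType) n (F : E -> E -> E -> R) :
  \sum_(p <- decs n) \sum_(q <- decs p.2) F p.1 q.1 q.2 =
  \sum_(p <- decs n) \sum_(q <- decs p.1) F q.1 q.2 p.2.
Proof.
pose G (x : E * E * E) := F x.1.1 x.1.2 x.2.
transitivity (\sum_(x <- [seq (p.1, q.1, q.2) | p <- decs n, q <- decs p.2]) G x).
  by rewrite big_allpairs_dep.
transitivity (\sum_(x <- [seq (q.1, q.2, p.2) | p <- decs n, q <- decs p.1]) G x);
  last by rewrite big_allpairs_dep.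
apply: perm_big; apply: uniq_perm.
- apply: allpairs_uniq_dep => [|p _|u v hu hv]; try exact: decs_uniq.
  have key (w : {_ : E * E & (E * E)%type}) : w \in [seq @Tagged _ p (fun=> (E * E)%type) q | p <- decs n, q <- decs p.2] ->
    tagged w \in decs (tag w).2 by case/allpairsPdep => x [y [_ hy ->]]. 
  move/key: hu; move/key: hv; case: u v => [[a m] [b c]] [[a' m'] [b' c']] /=.
  by rewrite !mem_decs /= => /eqP <- /eqP <- [-> -> ->].
- apply: allpairs_uniq_dep => [|p _|u v hu hv]; try exact: decs_uniq.
  have key (w : {_ : E * E & (E * E)%type}) : w \in [seq @Tagged _ p (fun=> (E * E)%type) q | p <- decs n, q <- decs p.1] ->
    tagged w \in decs (tag w).1 by case/allpairsPdep => x [y [_ hy ->]]. 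
  move/key: hu; move/key: hv; case: u v => [[m a] [b c]] [[m' a'] [b' c']] /=.
  by rewrite !mem_decs /= => /eqP <- /eqP <- [-> -> ->].
move=> [[a b] c]; apply/allpairsPdep/allpairsPdep => -[[p1 p2] [[q1 q2]]];
  rewrite !mem_decs /= => -[/eqP hp /eqP hq [-> -> ->]].
  by exists (p1 + q1, q2), (p1, q1); rewrite !mem_decs /= -addrA hq hp !eqxx.
by exists (q1, q2 + p2), (q2, p2); rewrite !mem_decs /= addrA hq hp !eqxx.
Qed.

Lemma decs_single (R : nmodType) n (F : E * E -> R) (p : E * E) :
  p.1 + p.2 = n -> (forall q, q.1 + q.2 = n -> q != p -> F q = 0) ->
  \sum_(q <- decs n) F q = F p.
Proof.
move=> hp h; rewrite (bigD1_seq p) ?decs_uniq ?mem_decs ?hp //=.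
by rewrite big_seq_cond big1 ?addr0 // => q /andP[]; rewrite mem_decs => /eqP ? /h; apply.
Qed.

(** Power series over [N^J] whose monomials multiply as in a quantum torus with
   [q = 2], a number that is not a root of unity. *)

Definition bil (om : J -> J -> int) (a b : E) : int :=
  \sum_i \sum_j (a i)%:Z * om i j * (b j)%:Z.

(** For a skew form, exchanging two monomials costs [tw om a b / tw om b a = 4 ^ bil om a b]; this
    is the source of the [4^d] in the equation of the dilogarithm. *)
Definition tw om a b : rat := 2%:R ^ bil om a b.

Definition qser (om : J -> J -> int) : Type := E -> rat.

Section Ring.
Variable om : J -> J -> int.

Lemma bilDl a b c : bil om (a + b) c = bil om a c + bil om b c.
Proof.
rewrite /bil -big_split; apply: eq_bigr => i _; rewrite -big_split.
by apply: eq_bigr => j _ /=; rewrite ffunE PoszD; ring.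
Qed.

Lemma bilDr a b c : bil om c (a + b) = bil om c a + bil om c b.
Proof.
rewrite /bil -big_split; apply: eq_bigr => i _; rewrite -big_split.
by apply: eq_bigr => j _ /=; rewrite ffunE PoszD; ring.
Qed.

Lemma bil0l a : bil om 0 a = 0.
Proof. by rewrite /bil big1 // => i _; rewrite big1 // => j _; rewrite ffunE !mul0r. Qed.

Lemma bil0r a : bil om a 0 = 0.
Proof. by rewrite /bil big1 // => i _; rewrite big1 // => j _; rewrite ffunE !mulr0. Qed.

Lemma twDl a b c : tw om (a + b) c = tw om a c * tw om b c.
Proof. by rewrite /tw bilDl expfzDr. Qed.

Lemma twDr a b c : tw om c (a + b) = tw om c a * tw om c b.
Proof. by rewrite /tw bilDr expfzDr. Qed.

Lemma tw0l a : tw om 0 a = 1.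
Proof. by rewrite /tw bil0l expr0z. Qed.

Lemma tw0r a : tw om a 0 = 1.
Proof. by rewrite /tw bil0r expr0z. Qed.

HB.instance Definition _ := GRing.Zmodule.copy (qser om) (E -> rat).

Lemma qaddE (f g : qser om) n : (f + g) n = f n + g n. Proof. by []. Qed.
Lemma qoppE (f : qser om) n : (- f) n = - f n. Proof. by []. Qed.

Definition qone : qser om := fun n => (n == 0)%:R.
Definition qmul (f g : qser om) : qser om :=
  fun n => \sum_(p <- decs n) tw om p.1 p.2 * f p.1 * g p.2.

Lemma qmulA : associative qmul.
Proof.
move=> f g h; apply/funext => n; rewrite /qmul.
under eq_bigr => p _ do rewrite mulr_sumr.
pose F a b c := tw om a (b + c) * tw om b c * f a * g b * h c.
transitivity (\sum_(p <- decs n) \sum_(q <- decs p.2) F p.1 q.1 q.2).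
  apply: eq_bigr => p _; rewrite big_seq [RHS]big_seq; apply: eq_bigr => q.
  by rewrite mem_decs /F => /eqP ->; ring.
rewrite decs_assoc; apply: eq_bigr => p _; rewrite mulr_sumr mulr_suml.
rewrite big_seq [RHS]big_seq; apply: eq_bigr => q; rewrite mem_decs /F => /eqP <-.
by rewrite twDl twDr; ring.
Qed.

Lemma qmul1l : left_id qone qmul.
Proof.
move=> f; apply/funext => n; rewrite /qmul (@decs_single _ _ _ (0, n)) /= ?add0r //.
  by rewrite /qone eqxx tw0l !mul1r.
move=> [a b] /= hn; rewrite xpair_eqE /qone; case: eqP => [a0|_ _]; last by rewrite mulr0 mul0r.
by move: hn; rewrite a0 add0r => ->; rewrite eqxx.
Qed.

Lemma qmul1r : right_id qone qmul.
Proof.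
move=> f; apply/funext => n; rewrite /qmul (@decs_single _ _ _ (n, 0)) /= ?addr0 //.
  by rewrite /qone eqxx tw0r mulr1 mul1r.
move=> [a b] /= hn; rewrite xpair_eqE /qone andbC; case: eqP => [b0|_ _]; last by rewrite mulr0.
by move: hn; rewrite b0 addr0 => ->; rewrite eqxx.
Qed.

Lemma qmulDl : left_distributive qmul +%R.
Proof.
move=> f g h; apply/funext => n; rewrite /qmul -[RHS]big_split; apply: eq_bigr => p _ /=.
by rewrite qaddE; ring.
Qed.

Lemma qmulDr : right_distributive qmul +%R.
Proof.
move=> f g h; apply/funext => n; rewrite /qmul -[RHS]big_split; apply: eq_bigr => p _ /=.
by rewrite qaddE; ring.
Qed.

Lemma qone_neq0 : qone != 0.
Proof. by apply/eqP => /(congr1 (fun f : qser om => f 0)) /eqP; rewrite /qone eqxx oner_eq0. Qed.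

HB.instance Definition _ := GRing.Zmodule_isNzRing.Build (qser om)
  qmulA qmul1l qmul1r qmulDl qmulDr qone_neq0.

Lemma qmulE (f g : qser om) n :
  (f * g) n = \sum_(p <- decs n) tw om p.1 p.2 * f p.1 * g p.2.
Proof. by []. Qed.

Lemma qoneE n : (1 : qser om) n = (n == 0)%:R. Proof. by []. Qed.

End Ring.
End Exponents.

(** * Inverses, factorizations and logarithmic derivatives of series *)

Section SeriesTheory.
Variables (J : finType) (om : J -> J -> int).
Local Notation E := {ffun J -> nat}.
Local Notation ser := (qser om).
Implicit Types (a b n : E) (f g h u v w : ser) (P Q : pred E).

Definition supp f P := forall n, f n != 0 -> P n.

Definition submonoid P := P 0 /\ forall a b, P a -> P b -> P (a + b).

Lemma supp_sub f P Q : (forall n, P n -> Q n) -> supp f P -> supp f Q.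
Proof. by move=> h s n /s /h. Qed.

Lemma suppMg f g P Q (R : pred E) : (forall a b, P a -> Q b -> R (a + b)) ->
  supp f P -> supp g Q -> supp (f * g) R.
Proof.
move=> PQ sf sg n; apply: contraNT => nR; rewrite qmulE big_seq big1 // => p.
rewrite mem_decs => /eqP hp; have [->|/sf fP] := eqVneq (f p.1) 0; first by rewrite mulr0 mul0r.
have [->|/sg gP] := eqVneq (g p.2) 0; first by rewrite mulr0.
by case/negP: nR; rewrite -hp; apply: PQ.
Qed.

Lemma suppM f g P : submonoid P -> supp f P -> supp g P -> supp (f * g) P.
Proof. by case=> _ PD; apply: suppMg. Qed.

(** The part of the coefficient of a product that only sees strictly smaller total degrees on both
    sides. All equations between series are solved by recursion on [wdeg] with this as the known
    term. *)
Definition pmul f g n : rat :=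
  \sum_(p <- decs n | (p.1 != 0) && (p.2 != 0)) tw om p.1 p.2 * f p.1 * g p.2.

Lemma qmul_at0 f g : (f * g) 0 = f 0 * g 0.
Proof.
rewrite qmulE (@decs_single _ _ _ _ (0, 0)) /= ?addr0 //.
  by rewrite tw0l mul1r.
by move=> [a b] /= /eqP; rewrite expo_addr_eq0 => /andP[/eqP -> /eqP ->]; rewrite eqxx.
Qed.

Lemma qmul_proper f g n : n != 0 ->
  (f * g) n = f n * g 0 + f 0 * g n + pmul f g n.
Proof.
move=> n0; rewrite qmulE (bigID (fun p : E * E => (p.1 != 0) && (p.2 != 0))) /= addrC; congr (_ + _).
rewrite -big_filter (perm_big [:: (n, 0); (0, n)]) /=.
  by rewrite big_cons big_seq1 tw0l tw0r !mul1r.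
apply: uniq_perm => [||[a b]].
- by apply: filter_uniq; apply: decs_uniq.
- by rewrite /= inE andbT; apply/eqP => -[/eqP]; rewrite (negPf n0).
rewrite mem_filter mem_decs !inE !xpair_eqE /= negb_and !negbK.
apply/idP/idP => [/andP[/orP[]/eqP -> /eqP]|/orP[]/andP[/eqP -> /eqP ->]].
- by rewrite add0r => ->; rewrite !eqxx orbT.
- by rewrite addr0 => ->; rewrite !eqxx.
- by rewrite addr0 !eqxx orbT.
by rewrite add0r !eqxx.
Qed.

Lemma pmul_ext f f' g g' n :
  (forall a, (wdeg a < wdeg n)%N -> f a = f' a) ->
  (forall a, (wdeg a < wdeg n)%N -> g a = g' a) -> pmul f g n = pmul f' g' n.
Proof.
move=> ef eg; rewrite /pmul big_seq_cond [RHS]big_seq_cond; apply: eq_bigr => -[a b] /=.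
rewrite mem_decs => /andP[/eqP /= hn /andP[a0 b0]].
by rewrite ef ?eg // -hn ?ltn_wdegl ?ltn_wdegr.
Qed.

Lemma pmul_eq0 f g n :
  (forall a b, a + b = n -> a != 0 -> b != 0 -> f a != 0 -> g b != 0 -> False) ->
  pmul f g n = 0.
Proof.
move=> h; rewrite /pmul big_seq_cond big1 // => -[a b] /=.
rewrite mem_decs => /andP[/eqP /= hn /andP[a0 b0]].
have [->|f0] := eqVneq (f a) 0; first by rewrite mulr0 mul0r.
have [->|g0] := eqVneq (g b) 0; first by rewrite mulr0.
by case: (h _ _ hn a0 b0 f0 g0).
Qed.

(** Contraction for the degree filtration. Iterating from 0 makes the coefficients of degree [m]
    stable after [m + 1] steps, which is what [qfix] reads off. *)
Definition contractive (Phi : ser -> ser) := forall f g n,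
  (forall a, (wdeg a < wdeg n)%N -> f a = g a) -> Phi f n = Phi g n.

Definition qfix (Phi : ser -> ser) : ser := fun n => iter (wdeg n).+1 Phi 0 n.

Lemma qfixE Phi : contractive Phi -> qfix Phi = Phi (qfix Phi).
Proof.
move=> cP.
have step k n : (wdeg n < k)%N -> iter k Phi 0 n = iter k.+1 Phi 0 n.
  elim: k n => // k IH n hn; rewrite -[LHS]/(Phi (iter k Phi 0) n).
  rewrite -[RHS]/(Phi (iter k.+1 Phi 0) n); apply: cP => a ha.
  by apply: IH; lia.
have stab k n : (wdeg n < k)%N -> iter k Phi 0 n = qfix Phi n.
  elim: k => // k IH; rewrite ltnS leq_eqVlt => /orP[/eqP <- //|hk].
  by rewrite -step // IH.
apply/funext => n; rewrite {1}/qfix iterS; apply: cP => a ha; exact: stab.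
Qed.

Lemma qfix_supp Phi Q : contractive Phi ->
  (forall f n, (forall a, (wdeg a < wdeg n)%N -> f a != 0 -> Q a) -> Phi f n != 0 -> Q n) ->
  supp (qfix Phi) Q.
Proof.
move=> cP h n; have [k] := ubnP (wdeg n); elim: k n => // k IH n hn.
rewrite qfixE //; apply: h => a ha; apply: IH; lia.
Qed.

(** Solves [f * g = 1] degree by degree for a series with [f 0 = 1], where the unknown [g n] enters
    with factor 1. *)
Definition qinv f : ser :=
  qfix (fun g n => if n == 0 then 1 else - (f n + pmul f g n)).

Lemma qinv_contractive f :
  contractive (fun g n => if n == 0 then 1 else - (f n + pmul f g n)).
Proof. by move=> g g' n e; case: eqP => // _; rewrite (@pmul_ext f f g g' n). Qed.

Lemma qinvE f n : qinv f n = if n == 0 then 1 else - (f n + pmul f (qinv f) n).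
Proof. by rewrite {1}/qinv qfixE //; apply: qinv_contractive. Qed.

Lemma qinv_at0 f : qinv f 0 = 1.
Proof. by rewrite qinvE eqxx. Qed.

Lemma qmulV f : f 0 = 1 -> f * qinv f = 1.
Proof.
move=> f0; apply/funext => n; rewrite qoneE; have [->|n0] := eqVneq n 0.
  by rewrite qmul_at0 f0 qinv_at0 mulr1.
by rewrite qmul_proper // f0 qinv_at0 mulr1 mul1r [qinv f n]qinvE (negPf n0) /=; ring.
Qed.

Lemma qmulVr f : f 0 = 1 -> qinv f * f = 1.
Proof.
move=> f0; have e := qmulV f0; have e' := qmulV (qinv_at0 f).
have ef : f = qinv (qinv f) by rewrite -[LHS]mulr1 -e' mulrA e mul1r.
by rewrite [X in _ * X]ef e'.
Qed.

Lemma qinv_supp f P : submonoid P -> supp f P -> supp (qinv f) P.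
Proof.
move=> [P0 PD] sf; apply: qfix_supp; first exact: qinv_contractive.
move=> g n hg /=; case: (n =P 0) => [-> //|_]; rewrite oppr_eq0; apply: contraNT => nP.
have -> : f n = 0 by apply/eqP; apply: contraNT nP => /sf.
rewrite add0r pmul_eq0 // => a b hn a0 b0 /sf fa /hg gb.
by case/negP: nP; rewrite -hn; apply: PD => //; apply: gb; rewrite -hn ltn_wdegr.
Qed.

Lemma qmulI f g h : f 0 = 1 -> f * g = f * h -> g = h.
Proof. by move=> f0 e; rewrite -[g]mul1r -(qmulVr f0) -mulrA e mulrA qmulVr // mul1r. Qed.

Definition orz P : pred E := fun n => (n == 0) || P n.

(* The unknown [h] of the fixpoint equation holds the coefficients of [v] on [P]
   and those of [w] off [P]. *)
Definition fac_v P h : ser := fun n => if n == 0 then 1 else if P n then h n else 0.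
Definition fac_w P h : ser := fun n => if n == 0 then 1 else if P n then 0 else h n.
Definition fac_step P f h : ser :=
  fun n => if n == 0 then 0 else f n - pmul (fac_v P h) (fac_w P h) n.
Definition fac P f : ser := qfix (fac_step P f).

Lemma fac_step_ext P f g h k n : f n = g n ->
  (forall a, (wdeg a < wdeg n)%N -> h a = k a) -> fac_step P f h n = fac_step P g k n.
Proof.
move=> fg e; rewrite /fac_step fg; case: eqP => // _; congr (_ - _).
by apply: pmul_ext => a ha; rewrite /fac_v /fac_w e.
Qed.

Lemma facE P f : fac P f = fac_step P f (fac P f).
Proof. by apply: qfixE => h k n; apply: fac_step_ext. Qed.

Lemma fac_ext P f g m : (forall a, (wdeg a < m)%N -> f a = g a) ->
  forall a, (wdeg a < m)%N -> fac P f a = fac P g a.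
Proof.
move=> fg a; have [k] := ubnP (wdeg a); elim: k a => // k IH a hk ha.
rewrite facE [in RHS]facE; apply: fac_step_ext => [|b hb]; first exact: fg.
apply: IH; lia.
Qed.

(** In degree [n] the equation reads [f n = v n + w n + pmul v w n]; the remainder
    [f n - pmul v w n] is given to [v] or to [w] according to [P n]. Existence thus holds for an
    arbitrary predicate [P]; submonoids enter in uniqueness. The recursion only adds exponents, so
    it stays inside [Q]. *)
Lemma qfactor f P Q (v := fac_v P (fac P f)) (w := fac_w P (fac P f)) :
  f 0 = 1 -> submonoid Q -> supp f Q ->
  [/\ f = v * w, v 0 = 1, w 0 = 1,
    supp v (predI (orz P) Q) & supp w (predI (orz (predC P)) Q)].
Proof.
move=> f0 [Q0 QD] sf.
have hQ : supp (fac P f) Q.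
  apply: qfix_supp => [h k n|h n hg]; first exact: fac_step_ext.
  rewrite /fac_step; case: (n =P 0) => [-> //|_].
  apply: contraNT => nP; have -> : f n = 0 by apply/eqP; apply: contraNT nP => /sf.
  rewrite sub0r oppr_eq0 pmul_eq0 // => a b hn a0 b0.
  rewrite /fac_v /fac_w (negPf a0) (negPf b0); case: (P a); rewrite ?eqxx //.
  case: (P b); rewrite ?eqxx // => ga gb; case/negP: nP; rewrite -hn; apply: QD.
    by apply: hg ga; rewrite -hn ltn_wdegl.
  by apply: hg gb; rewrite -hn ltn_wdegr.
split.
- apply/funext => n; have [->|n0] := eqVneq n 0.
    by rewrite qmul_at0 /v /w /fac_v /fac_w eqxx mulr1.
  rewrite qmul_proper // {1 2}/v {1 2}/w /fac_v /fac_w (negPf n0) eqxx.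
  have := congr1 (fun h : ser => h n) (facE P f); rewrite /fac_step (negPf n0).
  by rewrite -/v -/w; case: (P n) => ->; ring.
- by rewrite /v /fac_v eqxx.
- by rewrite /w /fac_w eqxx.
- move=> n; rewrite /v /fac_v /= /orz; case: (n =P 0) => [-> //|_] /=.
  by case: (P n); rewrite ?eqxx // => /hQ.
- move=> n; rewrite /w /fac_w /= /orz; case: (n =P 0) => [-> //|_] /=.
  by case: (P n); rewrite ?eqxx //= => /hQ.
Qed.

(** The series [v'^-1 v = w' w^-1] is supported on both submonoids, hence only at 0. *)
Lemma qfactor_uniq P Q v w v' w' :
  submonoid P -> submonoid Q -> (forall n, P n -> Q n -> n = 0) ->
  v 0 = 1 -> w 0 = 1 -> v' 0 = 1 -> w' 0 = 1 ->
  supp v P -> supp v' P -> supp w Q -> supp w' Q -> v * w = v' * w' -> v = v'.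
Proof.
move=> mP mQ PQ v0 w0 v'0 w'0 sv sv' sw sw' e.
have e1 : qinv v' * v = w' * qinv w.
  apply: (qmulI v'0); rewrite !mulrA qmulV // mul1r -e -mulrA qmulV // mulr1 //.
have h1 : qinv v' * v = 1.
  apply/funext => n; rewrite qoneE; have [->|n0] := eqVneq n 0.
    by rewrite qmul_at0 qinv_at0 v0 mulr1.
  apply/eqP; apply: contraNT n0 => hn; apply/eqP/PQ.
    exact: (suppM mP (qinv_supp mP sv') sv hn).
  by rewrite e1 in hn; apply: (suppM mQ sw' (qinv_supp mQ sw) hn).
by rewrite -[v]mul1r -(qmulV v'0) -mulrA h1 mulr1.
Qed.

(** In a minimal degree outside [Q] the product contributes only [v n + w n], and as [P] and [R]
    meet only in 0 these two terms cannot cancel. *)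
Lemma factor_supp v w P (R : pred E) Q : v 0 = 1 -> w 0 = 1 -> submonoid Q ->
  (forall n, P n -> R n -> n = 0) -> supp v P -> supp w R -> supp (v * w) Q ->
  supp v Q /\ supp w Q.
Proof.
move=> v0 w0 [Q0 QD] PR sv sw svw.
suff h n : (v n != 0) || (w n != 0) -> Q n.
  by split=> n h'; apply: h; rewrite h' ?orbT.
have [k] := ubnP (wdeg n); elim: k n => // k IH n hk; apply: contraLR => nQ.
have n0 : n != 0 by apply: contraNneq nQ => ->.
have := svw n; rewrite qmul_proper // v0 w0 mulr1 mul1r pmul_eq0 => [|a b e a0 b0 va wb].
  rewrite addr0 negb_or !negbK => h.
  have e : v n + w n == 0 by apply: contraNT nQ.
  have [vn|vn] := eqVneq (v n) 0; first by rewrite vn add0r in e.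
  have [wn|/sw Rn] := eqVneq (w n) 0; first by rewrite wn addr0 (negPf vn) in e.
  by rewrite (PR n (sv n vn) Rn) eqxx in n0.
case/negP: nQ; rewrite -e; apply: QD; apply: IH; rewrite ?va ?wb ?orbT //.
  by have := ltn_wdegl a b0; rewrite e; lia.
by have := ltn_wdegr b a0; rewrite e; lia.
Qed.

Section LogDerivative.
Implicit Type l : E -> rat.

Definition qder l f : ser := fun n => l n * f n.

Lemma qderM l f g : {morph l : a b / a + b} ->
  qder l (f * g) = qder l f * g + f * qder l g.
Proof.
move=> lD; apply/funext => n; rewrite qaddE /qder !qmulE mulr_sumr -big_split /=.
rewrite big_seq [RHS]big_seq; apply: eq_bigr => -[a b]; rewrite mem_decs /= => /eqP <-.
by rewrite lD; ring.
Qed.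

Lemma qder_supp l f P : supp f P -> supp (qder l f) P.
Proof. by move=> sf n; rewrite mulf_eq0 negb_or => /andP[_ /sf]. Qed.

Definition lam l f n : rat := (qinv f * qder l f) n.

Lemma morph0E l : {morph l : a b / a + b} -> l 0 = 0.
Proof. by move=> lD; have /eqP := lD 0 0; rewrite addr0 -subr_eq0 opprD addrA subrr sub0r oppr_eq0 => /eqP. Qed.

Lemma lamE l f n : {morph l : a b / a + b} -> n != 0 ->
  lam l f n = l n * f n + pmul (qinv f) (qder l f) n.
Proof. by move=> lD n0; rewrite /lam qmul_proper // {1 2}/qder morph0E // qinv_at0; ring. Qed.

(** The top coefficient [f n] enters [lam l f n] linearly with slope [l n], so an equation
    [lam l f n = 0] determines [f n] from smaller degrees. *)
Lemma lam_ext l f g n : {morph l : a b / a + b} -> n != 0 ->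
  (forall a, (wdeg a < wdeg n)%N -> f a = g a) ->
  lam l f n - l n * f n = lam l g n - l n * g n.
Proof.
move=> lD n0 e; rewrite !lamE // [RHS]addrAC [LHS]addrAC !subrr !add0r.
apply: pmul_ext => a ha; last by rewrite /qder e.
have [k] := ubnP (wdeg a); elim: k a ha => // k IH a ha hk; rewrite !qinvE.
case: eqP => // _; rewrite e //; congr (- (_ + _)); apply: pmul_ext => b hb.
  by apply: e; apply: ltn_trans ha.
by apply: IH; [apply: ltn_trans ha | lia].
Qed.

Definition ge0 n : pred E := fun a => 0 <= bil om a n.

Lemma ge0_submonoid n : submonoid (ge0 n).
Proof. by split; rewrite /ge0 ?bil0l // => a b ha hb; rewrite bilDl addr_ge0. Qed.

Hypothesis skew : forall a b, bil om a b = - bil om b a.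

Lemma bil_diag a : bil om a a = 0.
Proof. by have := skew a a; lia. Qed.

(* The coefficients at [n] of [f * g] and [g * f] only involve pairs of
   monomials orthogonal to [y^n], hence commuting with each other. *)
Lemma qtrace n f g : supp f (ge0 n) -> supp g (ge0 n) -> (f * g) n = (g * f) n.
Proof.
move=> sf sg; rewrite !qmulE.
rewrite [RHS](@big_decs_perm _ _ _ _ [seq (p.2, p.1) | p <- decs n]).
- rewrite big_map big_seq [RHS]big_seq; apply: eq_bigr => -[a b]; rewrite mem_decs /= => /eqP hn.
  have [->|fa] := eqVneq (f a) 0; first by rewrite !mulr0 mul0r.
  have [->|gb] := eqVneq (g b) 0; first by rewrite !mulr0 mul0r.
  have := sf a fa; have := sg b gb; rewrite /ge0 -hn !bilDr !bil_diag.
  have := skew a b; rewrite /tw => ab h1 h2.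
  have -> : bil om a b = 0 by lia.
  have -> : bil om b a = 0 by lia.
  by rewrite expr0z; ring.
- by rewrite map_inj_uniq ?decs_uniq // => -[a b] [c d] /= [-> ->].
move=> [a b] /=; apply/mapP/eqP => [[[c d]]|hn].
  by rewrite mem_decs /= => /eqP <- [-> ->]; rewrite addrC.
by exists (b, a); rewrite ?mem_decs //= addrC hn.
Qed.

(** From [(f g)^-1 D(f g) = g^-1 (f^-1 D f) g + g^-1 D g]: by [qtrace] the conjugation by [g] does
    not change the coefficient at [n]. *)
Lemma lamM l n f g : {morph l : a b / a + b} -> f 0 = 1 -> g 0 = 1 ->
  supp f (ge0 n) -> supp g (ge0 n) -> lam l (f * g) n = lam l f n + lam l g n.
Proof.
move=> lD f0 g0 sf sg; have mG := ge0_submonoid n; rewrite /lam.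
have -> : qinv (f * g) = qinv g * qinv f.
  have fg0 : (f * g) 0 = 1 by rewrite qmul_at0 f0 g0 mulr1.
  apply: (qmulI fg0); rewrite qmulV // mulrA -[f * g * _]mulrA qmulV // mulr1 qmulV //.
rewrite qderM // mulrDr qaddE; congr (_ + _); last by rewrite -!mulrA (mulrA _ f) qmulVr // mul1r.
rewrite -!mulrA qtrace; first by rewrite -!mulrA qmulV // mulr1.
  exact: qinv_supp.
by apply: suppM => //; [apply: qinv_supp | apply: suppM => //; apply: qder_supp].
Qed.

(** The derivations of [l1] and [l2] commute, so the two sides differ by the coefficient at [n] of a
    commutator, which [qtrace] kills. Vanishing of a wall component can then be tested with any
    degree function nonzero at [n]; this matters since reflecting exponents does not preserve the
    total degree. *)
Lemma lam_indep l1 l2 n f : {morph l1 : a b / a + b} -> {morph l2 : a b / a + b} ->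
  f 0 = 1 -> supp f (ge0 n) -> l1 n * lam l2 f n = l2 n * lam l1 f n.
Proof.
move=> l1D l2D f0 sf; have mG := ge0_submonoid n.
have dV l : {morph l : a b / a + b} -> qder l (qinv f) = - (qinv f * qder l f * qinv f).
  move=> lD; have := qderM (qinv f) f lD; rewrite qmulVr //.
  have -> : qder l 1 = 0.
    apply/funext => a; rewrite /qder qoneE; case: eqP => [->|]; by rewrite ?mulr0 // morph0E // mul0r.
  move=> /esym/eqP; rewrite addr_eq0 => /eqP e.
  by rewrite -[LHS]mulr1 -(qmulV f0) mulrA e mulNr.
have key l l' : {morph l : a b / a + b} -> {morph l' : a b / a + b} ->
  l n * lam l' f n = (qinv f * qder l (qder l' f)) n - (qinv f * qder l f * (qinv f * qder l' f)) n.
  move=> lD l'D; rewrite -[LHS]/(qder l (qinv f * qder l' f) n) qderM // dV // qaddE addrC.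
  by congr (_ + _); rewrite mulNr qoppE !mulrA.
have dC : qder l1 (qder l2 f) = qder l2 (qder l1 f).
  by apply/funext => a; rewrite /qder; ring.
rewrite !key // dC; congr (_ - _).
by apply: qtrace; apply: suppM => //; (exact: qinv_supp || exact: qder_supp).
Qed.

End LogDerivative.
End SeriesTheory.

(** * Consistent series *)

(* Coefficients of the quantum dilogarithm, the solution of
   [Phi (4^d y) = (1 + 2^d y) Phi y]. *)
Fixpoint qdilog (d b : nat) : rat :=
  if b is b'.+1 then 2%:R ^ d%:Z * qdilog d b' / (2%:R ^ (2 * d * b)%N%:Z - 1) else 1.
Arguments qdilog : simpl never.

Section Good.
Variables (J : finType) (d : J -> nat).
Local Notation E := {ffun J -> nat}.
Implicit Types (a b n : E) (N : J -> J -> int).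

Definition axis (i : J) (b : nat) : E := [ffun j => if j == i then b else 0%N].

Definition on_axis n := (n == 0) || [exists i, n == axis i (n i)].

Definition omega N : J -> J -> int := fun k j => (d k)%:Z * N k j.

Definition skewsym N := forall k j, omega N k j = - omega N j k.

Definition wdegQ n : rat := (wdeg n)%:R.

Lemma wdegQD : {morph wdegQ : a b / a + b}.
Proof. by move=> a b; rewrite /wdegQ wdegD natrD. Qed.

Lemma bil_skew N : skewsym N -> forall a b, bil (omega N) a b = - bil (omega N) b a.
Proof.
move=> sN a b; rewrite /bil exchange_big -sumrN; apply: eq_bigr => j _ /=.
by rewrite -sumrN; apply: eq_bigr => i _; rewrite sN; ring.
Qed.

Definition negpair N n : pred E := fun a => bil (omega N) a n < 0.

Lemma lt0_submonoid N n : submonoid (orz (negpair N n)).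
Proof.
split=> [|a b]; rewrite /orz ?eqxx // /negpair => /orP[/eqP ->|ha]; first by rewrite add0r.
move=> /orP[/eqP ->|hb]; first by rewrite addr0 ha orbT.
by rewrite bilDl; apply/orP; right; lia.
Qed.

(* The axes carry quantum dilogarithms and there is no other initial wall: for [n]
   off the axes, factor [th] at the point [bil _ n]; the component of the wall
   through that point in degree [n], read off by a logarithmic derivative, is
   zero. *)
Definition good N (th : qser (omega N)) :=
  [/\ th 0 = 1, forall i (m : nat), th (axis i m) = qdilog (d i) m &
    forall n, ~~ on_axis n -> forall v w, th = v * w -> v 0 = 1 -> w 0 = 1 ->
      supp v (ge0 (omega N) n) -> supp w (orz (negpair N n)) -> lam wdegQ v n = 0].

Lemma axisE n i : n = axis i (n i) -> on_axis n.
Proof. by move=> h; rewrite /on_axis; apply/orP; right; apply/existsP; exists i; rewrite {1}h. Qed.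

Lemma axis_neq0 i (b : nat) : (axis i b == 0) = (b == 0%N).
Proof.
apply/eqP/eqP => [/ffunP /(_ i)|->]; first by rewrite !ffunE eqxx.
by apply/ffunP => j; rewrite !ffunE if_same.
Qed.

Lemma axis_inj i j (b c : nat) : axis i b = axis j c -> b != 0%N -> i = j /\ b = c.
Proof.
move=> /ffunP h b0; have := h i; rewrite !ffunE eqxx; case: eqP => [<- ->//|_ hb].
by rewrite hb eqxx in b0.
Qed.

(** Off the axes the coefficient at [n] is corrected by [lam / wdegQ n]. The logarithmic derivative
    of the factor at [n] depends on that coefficient with slope [wdegQ n], so the corrected value
    depends on smaller degrees only, and at the fixed point the correction is zero. *)
Lemma good_exists N : skewsym N -> exists th : qser (omega N), good th.
Proof.
move=> sN; pose sk := bil_skew sN.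
pose ax n : rat := if [pick i | n == axis i (n i)] is Some i then qdilog (d i) (n i) else 1.
pose vf (th : qser (omega N)) n := fac_v (ge0 (omega N) n) (fac (ge0 (omega N) n) th).
pose Phi (th : qser (omega N)) : qser (omega N) := fun n =>
  if on_axis n then ax n else th n - lam wdegQ (vf th n) n / wdegQ n.
have nn n : ge0 (omega N) n n by rewrite /ge0 (bil_diag sk).
have wn n : n != 0 -> wdegQ n != 0 by rewrite /wdegQ pnatr_eq0 wdeg_eq0.
have cP : contractive Phi.
  move=> f g n fg; rewrite /Phi; case: ifP => // /negbT; rewrite negb_or => /andP[n0 _].
  have fe := fac_ext (ge0 (omega N) n) fg.
  have ve a : (wdeg a < wdeg n)%N -> vf f n a = vf g n a by move=> ha; rewrite /vf /fac_v fe.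
  have vn h : vf h n n = h n - pmul (vf h n) (fac_w (ge0 (omega N) n) (fac (ge0 (omega N) n) h)) n.
    rewrite {1}/vf {1}/fac_v (negPf n0) nn.
    by rewrite -[in LHS](congr1 (fun k : qser _ => k n) (esym (facE _ _))) /fac_step (negPf n0).
  have := @lam_ext _ _ wdegQ (vf f n) (vf g n) n wdegQD n0 ve.
  rewrite !vn; set p1 := pmul _ _ _; set p2 := pmul _ _ _.
  have -> : p1 = p2 by apply: pmul_ext => // a ha; rewrite /fac_w fe.
  have := wn _ n0; set W := wdegQ n; set L1 := lam _ _ _; set L2 := lam _ _ _ => W0 e.
  have -> : L1 = L2 + W * (f n - g n) by lra.
  by field.
pose th := qfix Phi.
have thE n : th n = Phi th n by rewrite {1}/th qfixE.
have th0 : th 0 = 1.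
  rewrite thE /Phi /on_axis eqxx /= /ax; case: pickP => // i _; rewrite ffunE //.
exists th; split=> // [i b|n nax v w e v0 w0 sv sw].
  rewrite thE /Phi (@axisE _ i) ?ffunE ?eqxx // /ax; case: pickP => [j|/(_ i)]; last first.
    by rewrite ffunE !eqxx.
  have [->|b0] := eqVneq b 0%N.
    rewrite ffunE if_same //=; by case: (_ == _).
  by move=> /eqP /axis_inj -/(_ b0)[<- <-].
have n0 : n != 0 by move: nax; rewrite negb_or => /andP[].
have [e' v'0 w'0 sv' sw'] := @qfactor _ _ th (ge0 (omega N) n) predT th0 (conj isT (fun _ _ _ _ => isT)) (fun _ _ => isT).
have -> : v = vf th n.
  have mG := ge0_submonoid (omega N) n; have mL := lt0_submonoid N n.
  apply: (qfactor_uniq mG mL _ v0 w0 v'0 w'0 sv _ sw _); last by rewrite -e -e'.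
  - by move=> a; rewrite /ge0 /orz /negpair => ha /orP[/eqP|] //; lia.
  - by apply: supp_sub sv' => a /= /andP[/orP[/eqP ->|]] //; rewrite /ge0 bil0l.
  - by apply: supp_sub sw' => a /= /andP[]; rewrite /orz /= /ge0 /negpair ltNge.
have := thE n; rewrite /Phi (negPf nax) => /eqP; rewrite eq_sym addrC -subr_eq0 addrK oppr_eq0.
by rewrite mulf_eq0 invr_eq0 (negPf (wn _ n0)) orbF => /eqP.
Qed.

End Good.

(** * One-variable identities for the quantum dilogarithm *)

Section Slices.
Variable dl : nat.
Hypothesis dl_gt0 : (0 < dl)%N.
Implicit Types (p q r u : {poly rat}) (D N : nat).

(** Power series in one variable are represented by polynomials compared below a degree [D]. *)
Definition eqmodX D p q := forall b, (b < D)%N -> p`_b = q`_b.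

Lemma eqmodX_mull D p q u : eqmodX D p q -> eqmodX D (u * p) (u * q).
Proof.
move=> e b hb; rewrite !coefM; apply: eq_bigr => c _; by rewrite e // (leq_ltn_trans (leq_subr _ _) hb).
Qed.

Lemma eqmodX_mulI D p q u : u`_0 = 1 -> eqmodX D (u * p) (u * q) -> eqmodX D p q.
Proof.
move=> u0 e b; have [k] := ubnP b; elim: k b => // k IH b hk hb.
have := e b hb; rewrite !coefM !big_ord_recl /= u0 !mul1r subn0.
rewrite [in RHS](eq_bigr (fun c : 'I_b => u`_(bump 0 c) * p`_(b - bump 0 c))) => [/addIr //|c _].
have hc := ltn_ord c; rewrite IH // /bump /=; lia.
Qed.

Definition pifac (x : rat) : {poly rat} := 1 + x *: 'X.

Definition twopow (z : int) : rat := 2%:R ^ z.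

Definition piroot N (l : nat) : rat := twopow (dl%:Z * ((2 * l).+1%:Z - N%:Z)).

(** The ratio of the dilogarithms at [2^(dl N) X] and [2^(-dl N) X]. The exponents [dl (2l + 1 - N)]
    in its factors are symmetric about 0. *)
Definition Pi N : {poly rat} := \prod_(l < N) pifac (piroot N l).

Definition dilog_poly D (y : rat) : {poly rat} := \poly_(c < D) (qdilog dl c * y ^+ c).

Lemma twopowD z t : twopow (z + t) = twopow z * twopow t.
Proof. by rewrite /twopow expfzDr. Qed.

Lemma twopowN z : twopow (- z) = (twopow z)^-1.
Proof. by rewrite /twopow -invr_expz. Qed.

Lemma twopow_gt0 z : 0 < twopow z.
Proof. by rewrite /twopow exprz_gt0. Qed.

Lemma twopowX z c : twopow z ^+ c = twopow (z * c%:Z).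
Proof. by rewrite /twopow exprnP exprz_exp. Qed.

Lemma qdilogS b : qdilog dl b.+1 * (twopow (2 * dl * b.+1)%N%:Z - 1) = twopow dl%:Z * qdilog dl b.
Proof.
rewrite -[qdilog dl b.+1]/(twopow _ * qdilog dl b / (twopow _ - 1)) mulfVK // subr_eq0 gt_eqF //.
rewrite /twopow -exprnP exprn_egt1 //; lia.
Qed.

Lemma dilog_shift D y :
  eqmodX D (dilog_poly D (twopow (2 * dl)%N%:Z * y))
           (pifac (twopow dl%:Z * y) * dilog_poly D y).
Proof.
move=> [|b] hb; rewrite /pifac mulrDl mul1r coefD -scalerAl coefZ coefXM !coef_poly hb //=.
  by rewrite !expr0 mulr0 addr0.
rewrite ltnW // exprMn twopowX -PoszM.
have := qdilogS b; set A := qdilog dl b.+1; set B := qdilog dl b; set C := twopow dl%:Z.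
set X := twopow _ => e; rewrite [y ^+ b.+1]exprS.
have -> : A * (X * (y * y ^+ b)) = (A * (X - 1) + A) * (y * y ^+ b) by ring.
by rewrite e; ring.
Qed.

Lemma dilog_shiftn D y k :
  eqmodX D (dilog_poly D (twopow (2 * dl * k)%N%:Z * y))
   (\prod_(l < k) pifac (twopow (dl%:Z * (2 * l).+1%:Z) * y) * dilog_poly D y).
Proof.
elim: k => [|k IH]; first by rewrite big_ord0 muln0 mul1r /twopow expr0z mul1r.
move=> b hb.
have -> : twopow (2 * dl * k.+1)%N%:Z * y = twopow (2 * dl)%N%:Z * (twopow (2 * dl * k)%N%:Z * y).
  by rewrite mulrA -twopowD; congr (twopow _ * _); lia.
rewrite dilog_shift // big_ord_recr /=.
have -> : twopow dl%:Z * (twopow (2 * dl * k)%N%:Z * y) = twopow (dl%:Z * (2 * k).+1%:Z) * y.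
  by rewrite mulrA -twopowD; congr (twopow _ * _); lia.
rewrite [_ * pifac _]mulrC -mulrA.
exact: (eqmodX_mull _ IH hb).
Qed.

(** The functional equation is applied [N] times, leading from [x^-1] to [4^(dl N) x^-1 = x]. *)
Lemma dilog_Pi D N (x := twopow (dl%:Z * N%:Z)) :
  eqmodX D (dilog_poly D x) (Pi N * dilog_poly D x^-1).
Proof.
have e : twopow (2 * dl * N)%N%:Z * x^-1 = x.
  by rewrite /x -twopowN -twopowD; congr twopow; lia.
have -> : Pi N = \prod_(l < N) pifac (twopow (dl%:Z * (2 * l).+1%:Z) * x^-1).
  apply: eq_bigr => l _; rewrite /piroot /x -twopowN -twopowD; congr (pifac (twopow _)); lia.
by have := @dilog_shiftn D x^-1 N; rewrite e.
Qed.

(** With [Phi] the dilogarithm, this is [Phi(y^-1 X) r(X) = Phi(y X) p(X)] for the generating series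
    of [p] and [r]: the equation [dil * f = g * dil] restricted to one line in direction [i]. *)
Definition slice_rel (y : rat) (p r : nat -> rat) := forall b,
  \sum_(c < b.+1) qdilog dl c * y^-1 ^+ c * r (b - c)%N =
  \sum_(c < b.+1) qdilog dl c * y ^+ c * p (b - c)%N.

Lemma slice_relP N (p r : nat -> rat) :
  slice_rel (twopow (dl%:Z * N%:Z)) p r <->
  forall b, r b = \sum_(c < b.+1) (Pi N)`_c * p (b - c)%N.
Proof.
set x := twopow _.
have coefE D y s b : (b < D)%N -> \sum_(c < b.+1) qdilog dl c * y ^+ c * s (b - c)%N =
    (dilog_poly D y * \poly_(i < D) s i)`_b.
  move=> hb; rewrite coefM; apply: eq_bigr => c _; rewrite !coef_poly.
  have hc := ltn_ord c; rewrite !ifT //; lia.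
have coefP D s b : (b < D)%N ->
    \sum_(c < b.+1) (Pi N)`_c * s (b - c)%N = (Pi N * \poly_(i < D) s i)`_b.
  move=> hb; rewrite coefM; apply: eq_bigr => c _; have hc := ltn_ord c; rewrite coef_poly ifT //; lia.
have E0 D y : (0 < D)%N -> (dilog_poly D y)`_0 = 1.
  by move=> hD; rewrite coef_poly hD expr0 mulr1.
have xE D (p' : {poly rat}) : eqmodX D (dilog_poly D x * p') (dilog_poly D x^-1 * (Pi N * p')).
  have -> : dilog_poly D x^-1 * (Pi N * p') = p' * (Pi N * dilog_poly D x^-1) by ring.
  rewrite [dilog_poly D x * _]mulrC => b hb.
  by apply: (eqmodX_mull _ (@dilog_Pi D N) hb).
split=> h b.
  have K : eqmodX b.+1 (\poly_(i < b.+1) r i) (Pi N * \poly_(i < b.+1) p i).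
    apply: (@eqmodX_mulI _ _ _ (dilog_poly b.+1 x^-1)) => [|a ha]; first exact: E0.
    by rewrite -xE // -!coefE.
  by rewrite (coefP b.+1) // -(K b) // coef_poly ltnSn.
rewrite !(coefE b.+1) // xE //; apply: (eqmodX_mull _ _ (ltnSn b)) => a ha.
by rewrite coef_poly ha h (coefP b.+1).
Qed.

Definition revp m p : {poly rat} := \poly_(b < m.+1) p`_(m - b).

Lemma revp_fac m x p : (size p <= m.+1)%N ->
  revp m.+1 (pifac x * p) = (x%:P + 'X) * revp m p.
Proof.
move=> sp; apply/polyP => b; have -> : pifac x * p = p + x *: ('X * p).
  by rewrite /pifac mulrDl mul1r scalerAl.
rewrite [(_ + 'X) * _]mulrDl coefD mul_polyC coefZ coefXM /revp !coef_poly coefD coefZ coefXM.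
case: b => [|b]; rewrite /= ?subn0; first by rewrite (nth_default _ sp) add0r addr0.
rewrite subSS !ltnS; case: (ltngtP b m) => [hb|hb|->].
- have -> : (m - b == 0)%N = false by lia.
  by rewrite subnS addrC.
- by rewrite mulr0 addr0.
by rewrite subnn /= !mulr0 addr0 add0r.
Qed.

Lemma size_pifac x : (size (pifac x) <= 2)%N.
Proof.
rewrite /pifac (leq_trans (size_polyD _ _)) // geq_max size_poly1 /=.
by rewrite (leq_trans (size_scale_leq _ _)) // size_polyX.
Qed.

Lemma size_prod_pifac k (f : nat -> rat) m p : (size p <= m.+1)%N ->
  (size (\prod_(l < k) pifac (f l) * p)%R <= (m + k).+1)%N.
Proof.
elim: k => [|k IH] sp; first by rewrite big_ord0 mul1r addn0.
rewrite big_ord_recr /= mulrAC mulrC.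
have := size_polyMleq (pifac (f k)) (\prod_(i < k) pifac (f i) * p).
move=> /leq_trans; apply; have := leq_add (size_pifac (f k)) (IH sp).
by case: (_ + _)%N => [|s] /=; lia.
Qed.

Lemma revp_prod k (f : nat -> rat) m p : (size p <= m.+1)%N ->
  revp (m + k) (\prod_(l < k) pifac (f l) * p) = \prod_(l < k) ((f l)%:P + 'X) * revp m p.
Proof.
move=> sp; elim: k => [|k IH]; first by rewrite !big_ord0 !mul1r addn0.
rewrite !big_ord_recr /= mulrAC mulrC addnS revp_fac ?IH; last exact: size_prod_pifac.
by rewrite mulrCA mulrA.
Qed.

(* The roots of [Pi N] are stable under inversion, so [Pi N] is palindromic. *)
Lemma Pi_rev N : \prod_(l < N) ((piroot N l)%:P + 'X) = Pi N.
Proof.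
have inv (l : 'I_N) : piroot N (rev_ord l) = (piroot N l)^-1.
  rewrite /piroot -twopowN -mulrN; congr (twopow (_ * _)); have := ltn_ord l; rewrite /=; lia.
have prod1 : \prod_(l < N) piroot N l = 1.
  have h0 : 0 < \prod_(l < N) piroot N l by apply: prodr_gt0 => l _; apply: twopow_gt0.
  have : (\prod_(l < N) piroot N l) ^+ 2 = 1.
    rewrite expr2 {2}(reindex_inj rev_ord_inj) -big_split big1 //= => l _.
    by rewrite inv mulfV // gt_eqF // twopow_gt0.
  by move/eqP; rewrite sqrf_eq1 => /orP[/eqP //|/eqP h]; move: h0; rewrite h.
rewrite /Pi [RHS](reindex_inj rev_ord_inj) /=.
transitivity (\prod_(l < N) ((piroot N l)%:P * pifac (piroot N l)^-1)).
  apply: eq_bigr => l _; rewrite /pifac mulrDr mulr1; congr (_ + _).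
  by rewrite mul_polyC scalerA mulfV ?scale1r // gt_eqF // twopow_gt0.
rewrite big_split /= -rmorph_prod /= prod1 mul1r.
by apply: eq_bigr => l _; rewrite inv.
Qed.

Definition revs (m : nat) (p : nat -> rat) : nat -> rat :=
  fun b => if (b <= m)%N then p (m - b)%N else 0.

Lemma slice_bound N (p r : nat -> rat) m : slice_rel (twopow (dl%:Z * N%:Z)) p r ->
  (forall b, (m < b)%N -> p b = 0) -> forall b, (m + N < b)%N -> r b = 0.
Proof.
move=> /slice_relP h p0 b hb; rewrite h big1 // => c _.
have [hc|hc] := ltnP N c; last by rewrite p0 ?mulr0 //; lia.
rewrite nth_default ?mul0r //; apply: leq_trans hc.
by have := @size_prod_pifac N (piroot N) 0 1; rewrite mulr1 size_poly1 => /(_ isT).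
Qed.

(** Here [r = Pi N * p] with [Pi N] palindromic of degree [N], so reversing [p] in degree [m]
    reverses [r] in degree [m + N]. *)
Lemma slice_rev N (p r : nat -> rat) m : slice_rel (twopow (dl%:Z * N%:Z)) p r ->
  (forall b, (m < b)%N -> p b = 0) ->
  slice_rel (twopow (dl%:Z * N%:Z)) (revs m p) (revs (m + N) r).
Proof.
move=> h p0; have r0 := slice_bound h p0; move/slice_relP: h => h.
pose P : {poly rat} := \poly_(i < m.+1) p i.
have Pe b : P`_b = p b by rewrite coef_poly; case: ltnP => // /p0 ->.
have sP : (size P <= m.+1)%N by apply: size_poly.
have Re b : (Pi N * P)`_b = r b by rewrite h coefM; apply: eq_bigr => c _; rewrite Pe.
apply/slice_relP => b; have := revp_prod N (piroot N) sP.
rewrite -/(Pi N) Pi_rev => /polyP /(_ b); rewrite {1}/revp coef_poly Re coefM.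
rewrite /revs ltnS => ->; apply: eq_bigr => c _; congr (_ * _).
by rewrite coef_poly ltnS Pe.
Qed.

Lemma slice_top N (p r : nat -> rat) m : slice_rel (twopow (dl%:Z * N%:Z)) p r ->
  (forall b, (m < b)%N -> p b = 0) -> r (m + N)%N = p m.
Proof.
move=> h p0; have := slice_rev h p0; have r0 := slice_bound h p0.
move/(_ 0%N); rewrite !big_ord1 /revs /= !subn0 !expr0 !mul1r.
by [].
Qed.

Lemma slice_relV y (p r : nat -> rat) : slice_rel y p r -> slice_rel y^-1 r p.
Proof. by move=> h b; rewrite invrK h. Qed.

End Slices.

(** * Mutation of consistent series *)

Definition posn (z : int) : nat := if z is Posz m then m else 0%N.

Lemma posnB z : (posn z)%:Z - (posn (- z))%:Z = z.
Proof. by case: z => [[|m]|m]; rewrite /posn /=; lia. Qed.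

Lemma posn_le0 z : z <= 0 -> posn z = 0%N.
Proof. by case: z => [[|m]|m]; rewrite /posn /=; lia. Qed.

Lemma posn_ge0 z : 0 <= z -> (posn z)%:Z = z.
Proof. by case: z. Qed.

Lemma posnM (m : nat) z : (posn (m%:Z * z))%:Z = m%:Z * (posn z)%:Z.
Proof.
have [z0|z0] := leP 0 z; first by rewrite !posn_ge0 // mulr_ge0.
by rewrite !posn_le0 ?mulr0 ?(ltW z0) // mulr_ge0_le0 // ltW.
Qed.

Section Vectors.
Variable J : finType.
Local Notation E := {ffun J -> nat}.
Local Notation V := {ffun J -> int}.
Implicit Types (x y : V) (om : J -> J -> int).

Definition iv (a : E) : V := [ffun j => (a j)%:Z].

Definition ev (i : J) (s : int) : V := [ffun j => s * (j == i)%:Z].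

Definition bilV om x y : int := \sum_i \sum_j x i * om i j * y j.

Lemma bil_iv om a b : bil om a b = bilV om (iv a) (iv b).
Proof. by apply: eq_bigr => i _; apply: eq_bigr => j _; rewrite !ffunE. Qed.

Lemma bilVDl om x x' y : bilV om (x + x') y = bilV om x y + bilV om x' y.
Proof.
rewrite /bilV -big_split; apply: eq_bigr => i _; rewrite -big_split.
by apply: eq_bigr => j _ /=; rewrite ffunE; ring.
Qed.

Lemma bilVDr om x y y' : bilV om x (y + y') = bilV om x y + bilV om x y'.
Proof.
rewrite /bilV -big_split; apply: eq_bigr => i _; rewrite -big_split.
by apply: eq_bigr => j _ /=; rewrite ffunE; ring.
Qed.

Lemma sum_delta (F : J -> int) i : \sum_j F j * (j == i)%:Z = F i.
Proof.
rewrite (bigD1 i) //= eqxx mulr1 big1 ?addr0 // => j /negPf ->; exact: mulr0.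
Qed.

Lemma bilV_evl om i s y : bilV om (ev i s) y = s * \sum_j om i j * y j.
Proof.
rewrite /bilV exchange_big mulr_sumr; apply: eq_bigr => j _ /=.
rewrite -(sum_delta (fun k => s * (om k j * y j)) i); apply: eq_bigr => k _.
by rewrite ffunE; ring.
Qed.

Lemma bilV_evr om i s x : bilV om x (ev i s) = s * \sum_j x j * om j i.
Proof.
rewrite /bilV mulr_sumr; apply: eq_bigr => j _ /=.
rewrite -(sum_delta (fun k => s * (x j * om j k)) i); apply: eq_bigr => k _.
by rewrite ffunE; ring.
Qed.

(** With [be] the positive or the negative part of row [i] of the matrix, the reflection [tauV]
    below is the coordinate change of a seed mutation at [i] in one of its two sign conventions. *)
Definition pairV (be : J -> int) x : int := \sum_j be j * x j.

Definition tauV i (be : J -> int) x : V :=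
  [ffun j => if j == i then pairV be x - x i else x j].

Lemma tauVE i be x :
  tauV i be x = x + ev i (pairV (fun j => be j - (2 * (j == i))%N%:Z) x).
Proof.
apply/ffunP => j; rewrite !ffunE; have [->|_] := eqVneq j i; last by rewrite mulr0 addr0.
rewrite mulr1 /pairV; under [in RHS]eq_bigr => k _ do rewrite mulrBl.
rewrite big_split /= sumrN.
have -> : \sum_k (2 * (k == i))%N%:Z * x k = 2 * x i.
  by rewrite -(sum_delta x i) mulr_sumr; apply: eq_bigr => k _; rewrite PoszM; ring.
by ring.
Qed.

End Vectors.

Section Mutation.
Variables (J : finType) (d : J -> nat).
Hypothesis d_gt0 : forall j, (0 < d j)%N.
Local Notation E := {ffun J -> nat}.
Local Notation V := {ffun J -> int}.
Implicit Types (a b n : E) (N : J -> J -> int) (x y : V).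
Local Notation om := (omega d).
Local Notation skewsym := (skewsym d).

(** Fomin-Zelevinsky matrix mutation. The terms with 2 make the same formula also change the sign of
    row and column [i], and exhibit the correction as a product of linear forms. *)
Definition mut (i : J) N : J -> J -> int := fun k j =>
  N k j + ((posn (N i j))%:Z - (2 * (j == i))%N%:Z) * N k i
  + ((posn (- N k i))%:Z - (2 * (k == i))%N%:Z) * N i j.

Definition beta_pos N i : J -> int := fun j => (posn (N i j))%:Z.
Definition beta_neg N i : J -> int := fun j => (posn (- N i j))%:Z.

Lemma skew_diag N i : skewsym N -> N i i = 0.
Proof. by move=> sN; have := sN i i; rewrite /omega; have := d_gt0 i; nia. Qed.

Lemma om_mut N i k j : skewsym N ->
  om (mut i N) k j = om N k j + (beta_pos N i j - (2 * (j == i))%N%:Z) * om N k i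
    + (beta_pos N i k - (2 * (k == i))%N%:Z) * om N i j.
Proof.
move=> sN; rewrite /omega /mut /beta_pos.
have h : (d k)%:Z * (posn (- N k i))%:Z = (d i)%:Z * (posn (N i k))%:Z.
  by rewrite -!posnM; congr (posn _)%:Z; have := sN k i; rewrite /omega; lia.
rewrite 2!mulrDr; congr (_ + _ + _); first by ring.
rewrite mulrA mulrBr h.
by have [->|_] := eqVneq k i; rewrite /=; ring.
Qed.

Lemma skew_mut N i : skewsym N -> skewsym (mut i N).
Proof.
move=> sN k j; rewrite !om_mut // (sN j k) (sN j i) (sN i k); ring.
Qed.

Lemma bilV_mutR N i x y : skewsym N ->
  bilV (om (mut i N)) x y = bilV (om N) (tauV i (beta_pos N i) x) (tauV i (beta_pos N i) y).
Proof.
move=> sN; rewrite !tauVE !bilVDl !bilVDr !bilV_evr !bilV_evl /pairV.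
pose ga j := beta_pos N i j - (2 * (j == i))%N%:Z.
have -> : bilV (om (mut i N)) x y =
   bilV (om N) x y + (\sum_j ga j * y j) * (\sum_k x k * om N k i)
   + (\sum_k ga k * x k) * (\sum_j om N i j * y j).
  rewrite /bilV ![in RHS]big_distrlr /= [X in _ + X + _]exchange_big -!big_split.
  apply: eq_bigr => k _; rewrite -!big_split; apply: eq_bigr => j _ /=.
  by rewrite om_mut // -/(ga j) -/(ga k); ring.
have -> : \sum_j ev i (\sum_j0 ga j0 * x j0) j * om N j i = 0.
  rewrite big1 // => j _; rewrite ffunE; have [->|_] := eqVneq j i; last by rewrite mulr0 mul0r.
  by rewrite /omega skew_diag // !mulr0.
by ring.
Qed.

(** The two reflections differ by [z |-> z - N_i(z) e_i]. As [d_i N_i(z)] is the pairing of [e_i]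
    with [z], this is a transvection and preserves the skew form. *)
Lemma bilV_mutL N i x y : skewsym N ->
  bilV (om (mut i N)) x y = bilV (om N) (tauV i (beta_neg N i) x) (tauV i (beta_neg N i) y).
Proof.
move=> sN; rewrite bilV_mutR //; set X := tauV _ _ x; set Y := tauV _ _ y.
have tE z : tauV i (beta_neg N i) z = tauV i (beta_pos N i) z + ev i (- pairV (N i) z).
  apply/ffunP => j; rewrite !ffunE; have [_|_] := eqVneq j i; last by rewrite mulr0 addr0.
  rewrite mulr1 /pairV addrAC -sumrB; congr (_ - _); apply: eq_bigr => k _.
  by rewrite -mulrBl /beta_neg /beta_pos -[in X in _ - X](posnB (N i k)); congr (_ * _); ring.
have dX z : \sum_k om N i k * tauV i (beta_pos N i) z k = (d i)%:Z * pairV (N i) z.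
  rewrite /pairV mulr_sumr; apply: eq_bigr => k _; rewrite ffunE /omega -mulrA; congr (_ * _).
  by have [->|//] := eqVneq k i; rewrite skew_diag // !mul0r.
have dX' z : \sum_k tauV i (beta_pos N i) z k * om N k i = - ((d i)%:Z * pairV (N i) z).
  by rewrite -dX -sumrN; apply: eq_bigr => k _; rewrite sN; ring.
rewrite !tE -/X -/Y !bilVDl !bilVDr !bilV_evr !bilV_evl dX dX'.
have -> : \sum_j ev i (- pairV (N i) x) j * om N j i = 0.
  rewrite big1 // => j _; rewrite ffunE; have [->|_] := eqVneq j i; last by rewrite mulr0 mul0r.
  by rewrite /omega skew_diag // !mulr0.
ring.
Qed.

Lemma mut_row N i j : skewsym N -> mut i N i j = - N i j.
Proof. by move=> sN; rewrite /mut skew_diag // eqxx oppr0 /=; ring. Qed.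

Lemma betaR_mut N i : skewsym N -> beta_pos (mut i N) i = beta_neg N i.
Proof. by move=> sN; apply/funext => j; rewrite /beta_pos mut_row. Qed.

Lemma betaL_mut N i : skewsym N -> beta_neg (mut i N) i = beta_pos N i.
Proof. by move=> sN; apply/funext => j; rewrite /beta_neg mut_row // opprK. Qed.

End Mutation.

(** * Reflection of exponents and transport of series *)

Section Exponents.
Variables (J : finType) (i : J).
Local Notation E := {ffun J -> nat}.
Implicit Types (a b n : E) (be : J -> int).

Definition seti n (b : nat) : E := [ffun j => if j == i then b else n j].

Definition bdeg be n : nat := `|pairV be (iv n)|%N.

(** The domain on which the reflected exponent still has nonnegative entries; there the truncated
    subtraction in [tauE] is honest and [tauE] is an additive involution. *)
Definition below_mid be : pred E := fun n => (n i <= bdeg be n)%N.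

Definition tauE be n : E := seti n (bdeg be n - n i).

Definition adm be := (forall j, 0 <= be j) /\ be i = 0.

Variable be : J -> int.
Hypothesis be_adm : adm be.

Lemma bdegE n : (bdeg be n)%:Z = pairV be (iv n).
Proof.
rewrite /bdeg gez0_abs // sumr_ge0 // => j _; rewrite ffunE mulr_ge0 //; exact: be_adm.1.
Qed.

Lemma bdeg_seti n m : bdeg be (seti n m) = bdeg be n.
Proof.
congr `|_|%N; apply: eq_bigr => j _; rewrite !ffunE.
by case: eqP => // ->; rewrite be_adm.2 !mul0r.
Qed.

Lemma bdegD a b : bdeg be (a + b) = (bdeg be a + bdeg be b)%N.
Proof.
suff : (bdeg be (a + b))%:Z = (bdeg be a)%:Z + (bdeg be b)%:Z by lia.
rewrite !bdegE /pairV -big_split; apply: eq_bigr => j _; rewrite !ffunE /=.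
by rewrite PoszD; ring.
Qed.

Lemma bdeg0 : bdeg be 0 = 0%N.
Proof. by rewrite /bdeg /pairV big1 // => j _; rewrite !ffunE mulr0. Qed.

Lemma below_submonoid : submonoid (below_mid be).
Proof.
split=> [|a b]; rewrite /below_mid ?bdeg0 ?ffunE // bdegD => ha hb.
exact: leq_add.
Qed.

Lemma seti_seti n m m' : seti (seti n m) m' = seti n m'.
Proof. by apply/ffunP => j; rewrite !ffunE; case: eqP. Qed.

Lemma seti_id n : seti n (n i) = n.
Proof. by apply/ffunP => j; rewrite !ffunE; case: eqP => // ->. Qed.

Lemma below_tau n : below_mid be (tauE be n).
Proof. by rewrite /below_mid /tauE bdeg_seti ffunE eqxx leq_subr. Qed.

Lemma tauEK n : below_mid be n -> tauE be (tauE be n) = n.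
Proof.
by move=> hn; rewrite /tauE bdeg_seti seti_seti ffunE eqxx subKn // seti_id.
Qed.

Lemma tauED a b : below_mid be a -> below_mid be b -> tauE be (a + b) = tauE be a + tauE be b.
Proof.
rewrite /below_mid => ha hb; apply/ffunP => j; rewrite !ffunE bdegD.
by case: eqP => // _; rewrite /=; lia.
Qed.

Lemma tauE0 : tauE be 0 = 0.
Proof. by apply/ffunP => j; rewrite !ffunE bdeg0; case: eqP. Qed.

Lemma iv_tau n : below_mid be n -> iv (tauE be n) = tauV i be (iv n).
Proof.
move=> hn; apply/ffunP => j; rewrite !ffunE; case: eqP => // _.
by rewrite -bdegE subzn.
Qed.

End Exponents.

Section Transport.
Variables (J : finType) (i : J) (be : J -> int).
Local Notation E := {ffun J -> nat}.
Variables (om om' : J -> J -> int).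
Implicit Types (f g : qser om) (a b n : E).
Hypothesis be_adm : adm i be.
Local Notation bel := (below_mid i be).
Local Notation tau := (tauE i be).
Hypothesis iso : forall a b, bel a -> bel b -> bil om' (tau a) (tau b) = bil om a b.

(** A change of variables by the involution [tau], cut off outside its domain. It is multiplicative
    on series supported on the domain because [tau] matches the two forms there. *)
Definition transp f : qser om' := fun n => if bel n then f (tau n) else 0.

Lemma transp_supp f : supp (transp f) bel.
Proof. by move=> n; rewrite /transp; case: ifP => //; rewrite eqxx. Qed.

Lemma transp_at0 f : transp f 0 = f 0.
Proof. by rewrite /transp (below_submonoid be_adm).1 tauE0. Qed.

Lemma transp_sub f (G G' : pred E) : (forall n, bel n -> G n -> G' (tau n)) ->
  supp f G -> supp (transp f) G'.
Proof.
move=> GG' sf n; rewrite /transp; case: ifP => [hn|]; last by rewrite eqxx.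
by move=> /sf /(GG' _ (below_tau be_adm n)); rewrite tauEK.
Qed.

Lemma transpM f g : supp f bel -> supp g bel -> transp (f * g) = transp f * transp g.
Proof.
move=> sf sg; have mB := below_submonoid be_adm; apply/funext => n.
case: (boolP (bel n)) => hn; last first.
  rewrite {1}/transp (negPf hn); apply/esym/eqP; apply: contraNT hn.
  by apply: suppM => //; apply: transp_supp.
rewrite {1}/transp hn !qmulE.
rewrite (bigID (fun p : E * E => bel p.1 && bel p.2)) /= [X in _ + X]big1 ?addr0; last first.
  move=> [a b] /=; rewrite negb_and => /orP[] h.
    by have -> : f a = 0; [apply/eqP; apply: contraNT h => /sf | rewrite mulr0 mul0r].
  by have -> : g b = 0; [apply/eqP; apply: contraNT h => /sg | rewrite mulr0].
rewrite [RHS](bigID (fun p : E * E => bel p.1 && bel p.2)) /= [X in _ = _ + X]big1 ?addr0; last first.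
  move=> [a b] /=; rewrite negb_and => /orP[] h; rewrite /transp (negPf h) ?mulr0 ?mul0r //.
rewrite -big_filter -[RHS]big_filter.
rewrite [LHS](perm_big [seq (tau p.1, tau p.2) | p <- decs n & bel p.1 && bel p.2]) /=.
  rewrite big_map !big_filter big_seq_cond [RHS]big_seq_cond; apply: eq_bigr => -[a b] /=.
  move=> /andP[_ /andP[ha hb]]; rewrite /transp ha hb; congr (_ * _ * _).
  by rewrite /tw -[in RHS](tauEK be_adm ha) -[in RHS](tauEK be_adm hb) iso ?below_tau.
apply: uniq_perm => [||[a b]].
- by apply: filter_uniq; apply: decs_uniq.
- rewrite map_inj_in_uniq; first by apply: filter_uniq; apply: decs_uniq.
  move=> -[a b] [a' b'] /=.
  rewrite !mem_filter /= => /andP[/andP[ha hb] _] /andP[/andP[ha' hb'] _] [e1 e2].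
  by rewrite -(tauEK be_adm ha) -(tauEK be_adm hb) e1 e2 !tauEK.
rewrite mem_filter mem_decs /=; apply/idP/mapP.
  move=> /andP[/andP[ha hb] /eqP e]; exists (tau a, tau b); rewrite ?tauEK //.
  by rewrite mem_filter mem_decs !below_tau //= -tauED // e tauEK.
move=> [[a' b']]; rewrite mem_filter mem_decs /= => /andP[/andP[ha hb] /eqP <-] [-> ->].
by rewrite !below_tau // tauED /=.
Qed.

Lemma transp1 : transp 1 = 1.
Proof.
apply/funext => n; rewrite /transp !qoneE; case: ifPn => [hn|].
  suff -> : (tau n == 0) = (n == 0) by [].
  apply/idP/idP => [/eqP e|/eqP ->]; last by rewrite tauE0.
  by rewrite -(tauEK be_adm hn) e tauE0.
by case: (n =P 0) => // ->; rewrite (below_submonoid be_adm).1.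
Qed.

Lemma transp_inv f : f 0 = 1 -> supp f bel -> qinv (transp f) = transp (qinv f).
Proof.
move=> f0 sf; have t0 : transp f 0 = 1 by rewrite transp_at0.
apply: (qmulI t0); rewrite qmulV // -transpM ?qmulV ?transp1 //.
by apply: qinv_supp => //; apply: below_submonoid.
Qed.

Lemma transp_lam (l l' : E -> rat) f n : (forall a, bel a -> l a = l' (tau a)) ->
  f 0 = 1 -> supp f bel -> lam l' (transp f) n = if bel n then lam l f (tau n) else 0.
Proof.
move=> ll f0 sf; rewrite /lam transp_inv //.
have -> : qder l' (transp f) = transp (qder l f).
  apply/funext => a; rewrite /qder /transp; case: ifP => ha; last by rewrite mulr0.
  by rewrite ll ?below_tau // tauEK.
rewrite -transpM //; last exact: qder_supp.
by apply: qinv_supp => //; apply: below_submonoid.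
Qed.

End Transport.

(** * Stripping a dilogarithm from a series *)

Section Dilog.
Variables (J : finType) (d : J -> nat).
Hypothesis d_gt0 : forall j, (0 < d j)%N.
Local Notation E := {ffun J -> nat}.
Implicit Types (a b n : E) (N : J -> J -> int).
Local Notation om := (omega d).
Local Notation skewsym := (skewsym d).
Variable i : J.
Local Notation axis := (axis i).
Local Notation seti := (seti i).

Definition dil N : qser (om N) := fun n => if n == axis (n i) then qdilog (d i) (n i) else 0.

Lemma axis_i m : axis m i = m. Proof. by rewrite ffunE eqxx. Qed.

Lemma axis0 : axis 0 = 0.
Proof. by apply/ffunP => j; rewrite !ffunE if_same. Qed.

Lemma dil_axis N m : dil N (axis m) = qdilog (d i) m.
Proof. by rewrite /dil axis_i eqxx. Qed.

Lemma dil0 N : dil N 0 = 1.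
Proof. by rewrite -axis0 dil_axis. Qed.

Definition is_axis : pred E := fun n => n == axis (n i).

Lemma dil_supp N : supp (dil N) is_axis.
Proof. by move=> n; rewrite /dil /is_axis; case: ifP => //; rewrite eqxx. Qed.

Lemma is_axis_submonoid : submonoid is_axis.
Proof.
split; rewrite /is_axis; first by rewrite ffunE axis0.
move=> a b /eqP ha /eqP hb; apply/eqP/ffunP => j; rewrite {1}ha {1}hb !ffunE.
by case: eqP => // _; rewrite addr0.
Qed.

Lemma is_axis_add a b : is_axis (a + b) -> is_axis a /\ is_axis b.
Proof.
rewrite /is_axis => /eqP/ffunP h; split; apply/eqP/ffunP => j; have := h j; rewrite !ffunE;
  case: eqP => [-> //|_] /eqP; rewrite -[_ + _]/(a j + b j)%N addn_eq0 => /andP[/eqP ? /eqP ?] //.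
Qed.

Definition offaxis N (f : qser (om N)) := f 0 = 1 /\ forall m, f (axis m.+1) = 0.

Lemma offaxisP N (f : qser (om N)) n : offaxis f -> is_axis n -> n != 0 -> f n = 0.
Proof.
case=> _ f0 /eqP ->; case: (n i) => [|m]; last by rewrite f0.
by rewrite axis0 eqxx.
Qed.

Lemma mul_axis_l N (f g : qser (om N)) m : offaxis g -> (f * g) (axis m) = f (axis m).
Proof.
move=> og; rewrite qmulE (@decs_single _ _ _ _ (axis m, 0)) /= ?addr0 //.
  by rewrite tw0r mul1r og.1 mulr1.
move=> [a b] /= e; rewrite xpair_eqE; have [b0|b0 _] := eqVneq b 0.
  by move: e; rewrite b0 addr0 => ->; rewrite eqxx.
have [_ ab] : is_axis a /\ is_axis b by apply: is_axis_add; rewrite e /is_axis axis_i.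
by rewrite (offaxisP og ab b0) mulr0.
Qed.

Lemma axis_S m : axis m.+1 != 0.
Proof. by rewrite axis_neq0. Qed.

Lemma wdeg_axis m : wdeg (axis m) = m.
Proof.
rewrite /wdeg (bigD1 i) //= ffunE eqxx big1 ?addn0 // => j /negPf h; by rewrite ffunE h.
Qed.

Section Split.
Variables (N : J -> J -> int) (th : qser (om N)).
Hypothesis th0 : th 0 = 1.
Hypothesis thi : forall m, th (axis m) = qdilog (d i) m.

Definition facL : qser (om N) := qinv (dil N) * th.
Definition facR : qser (om N) := th * qinv (dil N).

Lemma facLE : th = dil N * facL.
Proof. by rewrite mulrA qmulV ?dil0 // mul1r. Qed.

Lemma facRE : th = facR * dil N.
Proof. by rewrite -mulrA qmulVr ?dil0 // mulr1. Qed.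

Lemma facL_off : offaxis facL.
Proof.
split; first by rewrite /facL qmul_at0 qinv_at0 th0 mulr1.
move=> m; have [k] := ubnP m; elim: k m => // k IH m hm.
have := thi m.+1; rewrite {1}facLE qmul_proper ?axis_S // dil_axis dil0.
have -> : facL 0 = 1 by rewrite /facL qmul_at0 qinv_at0 th0 mulr1.
rewrite pmul_eq0; first by move=> h; lra.
move=> a b e a0 b0 _ /eqP; apply.
have [aa /eqP ab] : is_axis a /\ is_axis b by apply: is_axis_add; rewrite e /is_axis axis_i.
have := ltn_wdegr b a0; rewrite e wdeg_axis; move: b0; rewrite ab.
by case: (b i) => [|c]; rewrite ?axis0 ?eqxx // wdeg_axis => _ hc; apply: IH; lia.
Qed.

Lemma facR_off : offaxis facR.
Proof.
split; first by rewrite /facR qmul_at0 qinv_at0 th0 mulr1.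
move=> m; have [k] := ubnP m; elim: k m => // k IH m hm.
have := thi m.+1; rewrite {1}facRE qmul_proper ?axis_S // dil_axis dil0.
have -> : facR 0 = 1 by rewrite /facR qmul_at0 qinv_at0 th0 mulr1.
rewrite pmul_eq0; first by move=> h; lra.
move=> a b e a0 b0 /eqP h _; apply: h.
have [/eqP aa ab] : is_axis a /\ is_axis b by apply: is_axis_add; rewrite e /is_axis axis_i.
have := ltn_wdegl a b0; rewrite e wdeg_axis; move: a0; rewrite aa.
by case: (a i) => [|c]; rewrite ?axis0 ?eqxx // wdeg_axis => _ hc; apply: IH; lia.
Qed.

End Split.

Definition ndeg N n : int := pairV (N i) (iv n).

Lemma bil_axis N n m : bil (om N) (axis m) n = (d i)%:Z * m%:Z * ndeg N n.
Proof.
have -> : bil (om N) (axis m) n = bilV (om N) (ev i m%:Z) (iv n).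
  rewrite bil_iv; congr (bilV _ _ _); apply/ffunP => j; rewrite !ffunE.
  by case: eqP; rewrite ?mulr1 ?mulr0.
rewrite bilV_evl /ndeg /pairV !mulr_sumr; apply: eq_bigr => j _.
by rewrite /omega; ring.
Qed.

Lemma ndeg_seti N n m : skewsym N -> ndeg N (seti n m) = ndeg N n.
Proof.
move=> sN; apply: eq_bigr => j _; rewrite !ffunE.
by case: eqP => // ->; rewrite (skew_diag d_gt0 _ sN) !mul0r.
Qed.

Lemma axis_seti n c : (c <= n i)%N -> axis c + seti n (n i - c) = n.
Proof.
move=> hc; apply/ffunP => j; rewrite !ffunE; case: eqP => [->|_]; last exact: add0r.
by rewrite -[LHS]/(c + (n i - c))%N subnKC.
Qed.

Lemma axis_dec a b c : axis c + b = a -> (c <= a i)%N /\ b = seti a (a i - c).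
Proof.
move=> <-; rewrite ffunE axis_i; split; first exact: leq_addr.
apply/ffunP => j; rewrite [RHS]ffunE.
case: (j =P i) => [->|/eqP/negPf h]; last by rewrite !ffunE h add0r.
by rewrite -[X in (X - _)%N]/(c + b i)%N addKn.
Qed.

Definition ypow N n : rat := twopow ((d i)%:Z * ndeg N n).

Lemma tw_axis_l N n m : tw (om N) (axis m) n = ypow N n ^+ m.
Proof. by rewrite /ypow twopowX /tw bil_axis /twopow; congr (_ ^ _); ring. Qed.

Lemma tw_axis_r N n m : skewsym N -> tw (om N) n (axis m) = (ypow N n)^-1 ^+ m.
Proof.
move=> sN; rewrite /ypow -twopowN twopowX /tw (bil_skew sN) bil_axis /twopow.
by congr (_ ^ _); ring.
Qed.

Lemma ypow_seti N n m : skewsym N -> ypow N (seti n m) = ypow N n.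
Proof. by move=> sN; rewrite /ypow ndeg_seti. Qed.

Definition axdecs n : seq (E * E) :=
  [seq (axis c, seti n (n i - c)) | c <- iota 0 (n i).+1].

Lemma axdecs_perm n : perm_eq [seq p <- decs n | is_axis p.1] (axdecs n).
Proof.
apply: uniq_perm => [||[a b]].
- by apply: filter_uniq; apply: decs_uniq.
- rewrite map_inj_uniq ?iota_uniq // => c c' [/ffunP /(_ i)].
  by rewrite !axis_i.
rewrite mem_filter mem_decs /is_axis /=; apply/idP/mapP.
  move=> /andP[/eqP aa /eqP e]; exists (a i).
    rewrite mem_iota /= add0n ltnS; move: e; rewrite aa => /axis_dec[].
    by rewrite axis_i.
  by move: e; rewrite {1}aa => /axis_dec[h ->]; rewrite -aa.
move=> [c]; rewrite mem_iota /= add0n ltnS => hc [-> ->].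
by rewrite axis_i eqxx axis_seti /=.
Qed.

Lemma mul_dil_l N (f : qser (om N)) n : skewsym N ->
  (dil N * f) n = \sum_(c < (n i).+1) qdilog (d i) c * ypow N n ^+ c * f (seti n (n i - c)).
Proof.
move=> sN; rewrite qmulE (bigID (fun p : E * E => is_axis p.1)) /= [X in _ + X]big1 ?addr0; last first.
  by move=> p /negPf h; rewrite /dil -/(is_axis p.1) h mulr0 mul0r.
rewrite -big_filter (perm_big _ (axdecs_perm n)) big_map.
rewrite -/(index_iota 0 (n i).+1) big_mkord; apply: eq_bigr => c _ /=.
by rewrite dil_axis tw_axis_l ypow_seti //; ring.
Qed.

Lemma mul_dil_r N (f : qser (om N)) n : skewsym N ->
  (f * dil N) n = \sum_(c < (n i).+1) qdilog (d i) c * (ypow N n)^-1 ^+ c * f (seti n (n i - c)).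
Proof.
move=> sN; rewrite qmulE (@big_decs_perm _ _ _ _ [seq (p.2, p.1) | p <- decs n]); first last.
- move=> [a b]; apply/mapP/eqP => [[[c e]]|h].
    by rewrite mem_decs => /eqP /= <- [-> ->]; rewrite addrC.
  by exists (b, a); rewrite ?mem_decs //= addrC h.
- by rewrite map_inj_uniq ?decs_uniq // => -[a b] [c e] [-> ->].
rewrite big_map (bigID (fun p : E * E => is_axis p.1)) /= [X in _ + X]big1 ?addr0; last first.
  by move=> p /negPf h; rewrite /dil -/(is_axis p.1) h mulr0.
rewrite -big_filter (perm_big _ (axdecs_perm n)) big_map.
rewrite -/(index_iota 0 (n i).+1) big_mkord; apply: eq_bigr => c _ /=.
by rewrite dil_axis tw_axis_r // ypow_seti //; ring.
Qed.

Definition slice N (f : qser (om N)) n : nat -> rat := fun m => f (seti n m).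

(** Multiplication by [dil] only mixes exponents that differ in the coordinate [i], and on such a
    line it acts as a one-variable dilogarithm with argument scaled by [ypow N n] from the left and
    by its inverse from the right. *)
Lemma dil_commP N (f g : qser (om N)) : skewsym N ->
  dil N * f = g * dil N <->
  forall n, slice_rel (d i) (ypow N n) (slice f n) (slice g n).
Proof.
move=> sN; split=> [e n m|h].
  have := congr1 (fun k : qser _ => k (seti n m)) e; rewrite mul_dil_l // mul_dil_r //.
  rewrite ypow_seti // !ffunE eqxx => e'; rewrite /slice.
  under eq_bigr do rewrite -(seti_seti i n m).
  by rewrite -e'; apply: eq_bigr => c _; rewrite seti_seti.
apply/funext => n; rewrite mul_dil_l // mul_dil_r //.
by have := h n (n i); rewrite /slice => ->.
Qed.

End Dilog.

(** * Support bounds for the stripped series *)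

Section Bounds.
Variables (J : finType) (d : J -> nat).
Hypothesis d_gt0 : forall j, (0 < d j)%N.
Local Notation E := {ffun J -> nat}.
Local Notation om := (omega d).
Local Notation skewsym := (skewsym d).
Local Notation good := (good (d := d)).
Local Notation lt0 := (negpair d).
Local Notation wdegq := (@wdegQ J).
Local Notation wdegqD := (@wdegQD J).
Variables (i : J) (N : J -> J -> int).
Hypothesis sN : skewsym N.
Implicit Types (a b n : E) (be : J -> int).
Local Notation axis := (axis i).
Local Notation seti := (seti i).
Local Notation below := (below_mid i).
Local Notation dil := (dil d i N).
Local Notation betaL := (beta_neg N i).
Local Notation betaR := (beta_pos N i).
Local Notation ndeg := (ndeg i N).

Lemma adm_betaL : adm i betaL.
Proof. by split=> [j|]; rewrite /beta_neg ?(skew_diag d_gt0 i sN). Qed.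

Lemma adm_betaR : adm i betaR.
Proof. by split=> [j|]; rewrite /beta_pos ?(skew_diag d_gt0 i sN). Qed.

Lemma bdeg_RL n : (bdeg betaR n)%:Z - (bdeg betaL n)%:Z = ndeg n.
Proof.
rewrite (bdegE adm_betaL) (bdegE adm_betaR) /pairV -sumrB; apply: eq_bigr => j _.
by rewrite -mulrBl /beta_pos /beta_neg posnB.
Qed.

(** Constant on the lines in direction [i], so an induction on it can treat a whole line at a
    time. *)
Definition adeg n := wdeg (seti n 0).

Lemma setiD n m : seti n 0 + axis m = seti n m.
Proof.
by apply/ffunP => j; rewrite !ffunE; case: eqP => _; rewrite ?add0r ?addr0.
Qed.

Lemma adegD a b : adeg (a + b) = (adeg a + adeg b)%N.
Proof.
rewrite /adeg -wdegD; congr wdeg; apply/ffunP => j; rewrite !ffunE.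
by case: eqP.
Qed.

Lemma adeg_seti n m : adeg (seti n m) = adeg n.
Proof. by rewrite /adeg seti_seti. Qed.

Lemma adeg_eq0 n : adeg n = 0%N -> is_axis i n.
Proof.
move=> /eqP; rewrite wdeg_eq0 => /eqP h; apply/eqP.
by rewrite -{1}(seti_id i n) -setiD h add0r.
Qed.

Definition upto (be : J -> int) (D : nat) : pred E := fun n => below be n || (D <= adeg n)%N.

Lemma upto_submonoid be D : adm i be -> submonoid (upto be D).
Proof.
move=> ab; have [b0 bD] := below_submonoid ab; split; first by rewrite /upto b0.
move=> a b; rewrite /upto adegD => /orP[ha|ha] /orP[hb|hb]; last 3 first.
- by rewrite (leq_trans hb) ?orbT // leq_addl.
- by rewrite (leq_trans ha) ?orbT // leq_addr.
- by rewrite (leq_trans ha) ?orbT // leq_addr.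
by rewrite bD.
Qed.

Lemma below_axis be n : adm i be -> below be n -> is_axis i n -> n = 0.
Proof.
move=> ab + /eqP e; rewrite /below_mid e axis_i.
have -> : bdeg be (axis (n i)) = 0%N.
  rewrite -(bdeg_seti ab _ 0) (_ : seti _ 0 = 0) ?bdeg0 //.
  by apply/ffunP => j; rewrite !ffunE; case: eqP.
by rewrite leqn0 => /eqP ->; rewrite axis0.
Qed.

(** Such an [n] is not a sum of two nonzero exponents of [upto be D]: either both lie below the
    bound and so does [n], or one has [adeg] equal to [D] and the other lies on the axis [i] below
    the bound, hence is 0. Therefore [lam] reduces to [wdegQ n * v n], which gives [v n = 0], and
    [w n = 0] because [n] pairs to 0 with itself. *)
Lemma bound_step (f : qser (om N)) be D n : adm i be -> f 0 = 1 ->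
  supp f (upto be D) -> (0 < D)%N -> adeg n = D -> ~~ below be n ->
  (forall v w, f = v * w -> v 0 = 1 -> w 0 = 1 -> supp v (ge0 (om N) n) ->
     supp w (orz (lt0 N n)) -> lam wdegq v n = 0) ->
  f n = 0.
Proof.
move=> ab f0 sf D0 aD nb h.
have n0 : n != 0 by apply: contraNneq nb => ->; apply: (below_submonoid ab).1.
have mQ := upto_submonoid D ab.
have [e v0 w0 sv sw] := @qfactor _ _ f (ge0 (om N) n) _ f0 mQ sf.
set v := fac_v _ _ in e v0 sv; set w := fac_w _ _ in e w0 sw.
have nope a b : a + b = n -> a != 0 -> b != 0 -> upto be D a -> upto be D b -> False.
  move=> hn a0 b0 ha hb; have := adegD a b; rewrite hn aD => ad.
  have bel x : upto be D x -> x != 0 -> (adeg x <= D)%N -> (adeg x == D) || below be x.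
    by rewrite /upto => /orP[->|]; rewrite ?orbT // => h1 _ h2; rewrite eqn_leq h1 h2.
  have [/orP[/eqP ea|ea] /orP[/eqP eb|eb]] : (adeg a == D) || below be a /\ (adeg b == D) || below be b.
    by split; apply: bel => //; lia.
  - lia.
  - have z : adeg b = 0%N by lia.
    by rewrite (below_axis ab eb (adeg_eq0 z)) eqxx in b0.
  - have z : adeg a = 0%N by lia.
    by rewrite (below_axis ab ea (adeg_eq0 z)) eqxx in a0.
  by case/negP: nb; rewrite -hn; apply: (below_submonoid ab).2.
have svQ : supp v (upto be D) by apply: supp_sub sv => x /andP[].
have swQ : supp w (upto be D) by apply: supp_sub sw => x /andP[].
have lv : lam wdegq v n = 0.
  apply: h e v0 w0 _ _.
    by apply: supp_sub sv => x /andP[/orP[/eqP ->|]] // _; rewrite /ge0 bil0l.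
  by apply: supp_sub sw => x /andP[]; rewrite /orz /= /ge0 /negpair ltNge.
have vn : v n = 0.
  move: lv; rewrite lamE //; last exact: wdegqD.
  rewrite pmul_eq0 => [|a b hn a0 b0 va vb]; last first.
    apply: (nope a b hn a0 b0); first exact: (qinv_supp mQ svQ va).
    by apply: svQ; move: vb; rewrite mulf_eq0 negb_or => /andP[].
  by rewrite addr0 => /eqP; rewrite mulf_eq0 /wdegq pnatr_eq0 wdeg_eq0 (negPf n0) => /eqP.
rewrite e qmul_proper // v0 w0 vn pmul_eq0 => [|a b hn a0 b0 /svQ va /swQ vb]; last exact: (nope a b).
suff -> : w n = 0 by ring.
apply/eqP; apply: contraT => /sw /andP[]; rewrite /orz (negPf n0) /= /ge0.
by rewrite (bil_diag (bil_skew sN)).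
Qed.

Variable th : qser (om N).
Hypothesis th_good : good th.
Local Notation fL := (facL i th).
Local Notation fR := (facR i th).

Let th0 : th 0 = 1. Proof. by case: th_good. Qed.
Let thi m : th (axis m) = qdilog (d i) m. Proof. by case: th_good. Qed.

Lemma fL0 : fL 0 = 1. Proof. by case: (facL_off th0 thi). Qed.
Lemma fR0 : fR 0 = 1. Proof. by case: (facR_off th0 thi). Qed.

Lemma lam_dil n l : {morph l : a b / a + b} -> ~~ on_axis n -> lam l dil n = 0.
Proof.
move=> lD nax; apply/eqP; apply: contraNT nax => h; apply: (@axisE _ _ i); apply/eqP.
have mA := is_axis_submonoid i.
apply: (suppM mA _ _ h); first by apply: qinv_supp => //; apply: dil_supp.
by apply: qder_supp; apply: dil_supp.
Qed.

(** The dilogarithm lies on the nonnegative side of [n], so [dil * v] is the corresponding factor of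
    [th]; off the axes [dil] adds nothing to the logarithmic derivative. *)
Lemma lamL n v w : ~~ on_axis n -> 0 <= ndeg n -> fL = v * w -> v 0 = 1 -> w 0 = 1 ->
  supp v (ge0 (om N) n) -> supp w (orz (lt0 N n)) -> lam wdegq v n = 0.
Proof.
move=> nax nd e v0 w0 sv sw.
have sd : supp dil (ge0 (om N) n).
  apply: supp_sub (@dil_supp _ d i N) => a /eqP ->.
  by rewrite /ge0 bil_axis // mulr_ge0.
have mG := ge0_submonoid (om N) n.
have := lamM (bil_skew sN) wdegqD (dil0 d i N) v0 sd sv.
rewrite lam_dil //; last exact: wdegqD.
case: th_good => _ _ /(_ n nax (dil * v) w) ->; rewrite ?qmul_at0 ?dil0 ?v0 ?mulr1 //.
- by rewrite add0r.
- by rewrite -mulrA -e -facLE.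
exact: suppM.
Qed.

(** If [ndeg n < 0] the dilogarithm is absorbed by [w]. If [ndeg n = 0] it is orthogonal to [n] and
    moves to the left through [w]: conjugating by it keeps [w - 1] on the strictly negative side. *)
Lemma lamR n v w : ~~ on_axis n -> ndeg n <= 0 -> fR = v * w -> v 0 = 1 -> w 0 = 1 ->
  supp v (ge0 (om N) n) -> supp w (orz (lt0 N n)) -> lam wdegq v n = 0.
Proof.
move=> nax; rewrite le_eqVlt => /orP[/eqP nd|nd] e v0 w0 sv sw; last first.
  case: th_good => _ _ /(_ n nax v (w * dil)); apply; rewrite ?qmul_at0 ?dil0 ?w0 ?mulr1 //.
    by rewrite mulrA -e -facRE.
  apply: suppM => //; first exact: lt0_submonoid.
  apply: supp_sub (@dil_supp _ d i N) => a /eqP ea; rewrite /orz /negpair.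
  have [//|a0] := eqVneq a 0; rewrite ea bil_axis //.
  have : (0 < a i)%N by rewrite lt0n; apply: contraNneq a0 => h; rewrite ea h axis0.
  by have := d_gt0 i; move: nd; rewrite /=; set z := ndeg n; nia.
have sd : supp dil (fun a => bil (om N) a n == 0).
  by apply: supp_sub (@dil_supp _ d i N) => a /eqP ->; rewrite bil_axis // nd mulr0.
have mZ : submonoid (fun a => bil (om N) a n == 0).
  by split=> [|a b /eqP ha /eqP hb]; rewrite ?bil0l // bilDl ha hb.
have si := qinv_supp mZ sd.
have sd' : supp dil (ge0 (om N) n) by apply: supp_sub sd => a /eqP h; rewrite /ge0 h.
have mG := ge0_submonoid (om N) n.
have := lamM (bil_skew sN) wdegqD v0 (dil0 d i N) sv sd'.
rewrite lam_dil //; last exact: wdegqD.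
case: th_good => _ _ /(_ n nax (v * dil) (qinv dil * w * dil)) ->;
  rewrite ?qmul_at0 ?dil0 ?qinv_at0 ?v0 ?w0 ?mulr1 //.
- by rewrite addr0.
- by rewrite -!mulrA (mulrA dil) qmulV ?dil0 // mul1r mulrA -e -facRE.
- exact: suppM.
pose w1 := w - 1.
have sw1 : supp w1 (lt0 N n).
  move=> a; rewrite /w1 qaddE qoppE qoneE; have [->|a0] := eqVneq a 0.
    by rewrite w0 subrr eqxx.
  by rewrite subr0 => /sw; rewrite /orz (negPf a0).
have -> : qinv dil * w * dil = 1 + qinv dil * w1 * dil.
  by rewrite /w1 mulrBr mulrBl mulr1 qmulVr ?dil0 // addrC subrK.
have mZL a b : bil (om N) a n == 0 -> lt0 N n b -> lt0 N n (a + b).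
  by rewrite /negpair bilDl => /eqP ->; rewrite add0r.
have mLZ a b : lt0 N n b -> bil (om N) a n == 0 -> lt0 N n (b + a).
  by rewrite addrC => hb ha; apply: mZL.
have s1 := suppMg (fun a b => @mLZ b a) (suppMg mZL si sw1) sd.
move=> a; rewrite qaddE qoneE /orz; case: (a =P 0) => //= _.
by rewrite add0r => /s1.
Qed.

Lemma dil_comm : dil * fL = fR * dil.
Proof. by rewrite -facLE -facRE. Qed.

Lemma slicesLR n : slice_rel (d i) (ypow d i N n) (slice i fL n) (slice i fR n).
Proof. by have /(dil_commP d_gt0 i fL fR sN) := dil_comm; apply. Qed.

Lemma ndeg_absP n : (0 <= ndeg n /\ exists m : nat, [/\ ndeg n = m%:Z,
     ypow d i N n = twopow ((d i)%:Z * m%:Z) & (bdeg betaL n + m)%N = bdeg betaR n]) \/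
  (ndeg n <= 0 /\ exists m : nat, [/\ ndeg n = - m%:Z,
     (ypow d i N n)^-1 = twopow ((d i)%:Z * m%:Z) & (bdeg betaR n + m)%N = bdeg betaL n]).
Proof.
have := bdeg_RL n; rewrite /ypow; case: (ndeg n) => m h; [left|right]; split=> //.
  by exists m; split=> //; lia.
exists m.+1; split; rewrite ?NegzE //; last by move: h; rewrite NegzE; lia.
by rewrite mulrN twopowN invrK.
Qed.

(** On a line with [ndeg n >= 0] consistency bounds [fL] directly, and [dil * fL = fR * dil] makes
    [fR] a multiple by a polynomial of degree [ndeg n], exactly the difference of the two bounds. On
    the other lines the roles are exchanged. *)
Lemma facLR_bound : supp fL (below betaL) /\ supp fR (below betaR).
Proof.
suff h D : supp fL (upto betaL D) /\ supp fR (upto betaR D).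
  by split=> n hn; have [h1 h2] := h (adeg n).+1; [have := h1 n hn | have := h2 n hn];
     rewrite /upto ltnn orbF.
elim: D => [|D [IHL IHR]]; first by split=> n _; rewrite /upto orbT.
suff key n : adeg n = D -> (~~ below betaL n -> fL n = 0) /\ (~~ below betaR n -> fR n = 0).
  have goal be f : supp f (upto be D) -> (forall n, adeg n = D -> ~~ below be n -> f n = 0) ->
      supp f (upto be D.+1).
    move=> sf z n fn; rewrite /upto; case: (boolP (below be n)) => //= nb.
    rewrite ltn_neqAle; have := sf n fn; rewrite /upto (negPf nb) /= => ->; rewrite andbT.
    by apply: contraNneq fn => e; rewrite z.
  by split; apply: goal => // n /key[].
move=> aD; have [D0|D0] := posnP D.
  have ax : is_axis i n by apply: adeg_eq0; rewrite aD.
  have n0 be : adm i be -> ~~ below be n -> n != 0.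
    by move=> ab; apply: contraNneq => ->; apply: (below_submonoid ab).1.
  split=> nb; first exact: (offaxisP (facL_off th0 thi) ax (n0 _ adm_betaL nb)).
  exact: (offaxisP (facR_off th0 thi) ax (n0 _ adm_betaR nb)).
have nax be n' : adm i be -> adeg n' = D -> ~~ below be n' -> ~~ on_axis n'.
  move=> ab aD'; apply: contra; rewrite /on_axis => /orP[/eqP ->|/existsP[j /eqP e]].
    exact: (below_submonoid ab).1.
  rewrite /below_mid; suff -> : n' i = 0%N by [].
  rewrite e ffunE; case: eqP => // ij; move: D0; rewrite -aD' e /adeg -ij.
  by rewrite (_ : seti _ _ = 0) ?wdeg0 //; apply/ffunP => x; rewrite !ffunE; case: eqP.
have nd m : ndeg (seti n m) = ndeg n by apply: ndeg_seti.
have sl := slicesLR n.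
have nb be m : adm i be -> (bdeg be n < m)%N -> ~~ below be (seti n m).
  by move=> ab; rewrite /below_mid bdeg_seti // ffunE eqxx ltnNge.
have ei be : adm i be -> (forall m, (bdeg be n < m)%N -> fL (seti n m) = 0) -> ~~ below be n -> fL n = 0.
  by move=> ab h; rewrite /below_mid -ltnNge => /h; rewrite seti_id.
have ei' be : adm i be -> (forall m, (bdeg be n < m)%N -> fR (seti n m) = 0) -> ~~ below be n -> fR n = 0.
  by move=> ab h; rewrite /below_mid -ltnNge => /h; rewrite seti_id.
case: (ndeg_absP n) => -[nd0 [m [hm ym bm]]].
  have zL m' : (bdeg betaL n < m')%N -> fL (seti n m') = 0.
    move=> hm'; have hb := nb _ _ adm_betaL hm'.
    apply: (bound_step adm_betaL fL0 IHL D0) => //; first by rewrite adeg_seti.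
    move=> v w; apply: lamL; last by rewrite nd.
    by apply: (nax _ _ adm_betaL) => //; rewrite adeg_seti.
  split; first by apply: ei => //; apply: adm_betaL.
  apply: ei'; first exact: adm_betaR.
  by rewrite ym in sl; rewrite -bm; apply: slice_bound sl zL.
have zR m' : (bdeg betaR n < m')%N -> fR (seti n m') = 0.
  move=> hm'; have hb := nb _ _ adm_betaR hm'.
  apply: (bound_step adm_betaR fR0 IHR D0) => //; first by rewrite adeg_seti.
  move=> v w; apply: lamR; last by rewrite nd.
  by apply: (nax _ _ adm_betaR) => //; rewrite adeg_seti.
split; last by apply: ei' => //; apply: adm_betaR.
apply: ei; first exact: adm_betaL.
have := slice_relV sl; rewrite ym => sl'; rewrite -bm; exact: slice_bound sl' zR.
Qed.

End Bounds.

(** * The mutated series is consistent *)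

Section Mutation.
Variables (J : finType) (d : J -> nat).
Hypothesis d_gt0 : forall j, (0 < d j)%N.
Local Notation E := {ffun J -> nat}.
Local Notation V := {ffun J -> int}.
Local Notation om := (omega d).
Local Notation skewsym := (skewsym d).
Local Notation good := (good (d := d)).
Local Notation lt0 := (negpair d).
Local Notation wdegq := (@wdegQ J).
Local Notation wdegqD := (@wdegQD J).
Implicit Types (a b n : E) (N : J -> J -> int) (x y : V).

Lemma tauVK i (be : J -> int) x : be i = 0 -> tauV i be (tauV i be x) = x.
Proof.
move=> bi; apply/ffunP => j; rewrite !ffunE eqxx; case: eqP => // ->.
suff -> : pairV be (tauV i be x) = pairV be x by ring.
apply: eq_bigr => k _; rewrite ffunE; case: eqP => // ->.
by rewrite bi !mul0r.
Qed.

Lemma tauV_axis i (be : J -> int) s : be i = 0 -> tauV i be (ev i s) = ev i (- s).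
Proof.
move=> bi; rewrite tauVE; apply/ffunP => j; rewrite !ffunE -mulrDl; congr (_ * _).
suff -> : pairV (fun j => be j - (2 * (j == i))%N%:Z) (ev i s) = - (s * 2) by ring.
rewrite /pairV (bigD1 i) //= big1 ?addr0 => [|k /negPf h]; rewrite ffunE ?h ?mulr0 //.
by rewrite bi eqxx /=; ring.
Qed.

(** Stated through the stripped series to be symmetric: the chamber argument moves from [th] to
    [th'] and back. *)
Definition mutrel i N N' (th : qser (om N)) (th' : qser (om N')) :=
  exists (fL fR : qser (om N)),
  [/\ th = dil d i N * fL /\ th = fR * dil d i N,
      fL 0 = 1 /\ fR 0 = 1,
      supp fL (below_mid i (beta_neg N i)) /\ supp fR (below_mid i (beta_pos N i)),
      th' = dil d i N' * transp i (beta_pos N i) (om N') fR &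
      th' = transp i (beta_neg N i) (om N') fL * dil d i N'].

(** The facts on [mut i N] in symmetric form. The matrix occurs in the type of a series, so this
    avoids rewriting [mut i (mut i N)] to [N] there. *)
Definition mutadj i N N' := [/\ beta_neg N' i = beta_pos N i, beta_pos N' i = beta_neg N i,
  forall x y, bilV (om N') x y = bilV (om N) (tauV i (beta_pos N i) x) (tauV i (beta_pos N i) y) &
  forall x y, bilV (om N') x y = bilV (om N) (tauV i (beta_neg N i) x) (tauV i (beta_neg N i) y)].

Lemma mutadj_mut i N : skewsym N -> mutadj i N (mut i N).
Proof.
move=> sN; split; [exact: (betaL_mut d_gt0)|exact: (betaR_mut d_gt0)| |] => x y.
  exact: bilV_mutR.
exact: bilV_mutL.
Qed.

Lemma mutadj_sym i N N' : skewsym N -> mutadj i N N' -> mutadj i N' N.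
Proof.
move=> sN [eL eR hR hL]; have aL := adm_betaL d_gt0 i sN; have aR := adm_betaR d_gt0 i sN.
by split=> // x y; [rewrite eR hL | rewrite eL hR]; rewrite !tauVK ?aL.2 ?aR.2.
Qed.

Lemma adj_iso i N N' be : adm i be ->
  (forall x y, bilV (om N') x y = bilV (om N) (tauV i be x) (tauV i be y)) ->
  forall a b, below_mid i be a -> below_mid i be b ->
    bil (om N') (tauE i be a) (tauE i be b) = bil (om N) a b.
Proof.
move=> ab h a b ha hb; rewrite !bil_iv h.
by rewrite -!(iv_tau ab) ?below_tau // !tauEK.
Qed.

Lemma transpK i N N' be (f : qser (om N)) : adm i be -> supp f (below_mid i be) ->
  transp i be (om N) (transp i be (om N') f) = f.
Proof.
move=> ab sf; apply/funext => n; rewrite /transp below_tau //.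
case: ifP => [hn|/negbT hn]; first by rewrite tauEK.
by apply/esym/eqP; apply: contraNT hn => /sf.
Qed.

Lemma mutrel_sym i N N' (th : qser (om N)) (th' : qser (om N')) :
  skewsym N -> mutadj i N N' -> mutrel i th th' -> mutrel i th' th.
Proof.
move=> sN [eL eR hR hL]; have aL := adm_betaL d_gt0 i sN; have aR := adm_betaR d_gt0 i sN.
move=> [fL [fR [[e1 e2] [fL0 fR0] [sL sR] e3 e4]]].
exists (transp i (beta_pos N i) (om N') fR), (transp i (beta_neg N i) (om N') fL).
rewrite eL eR !transpK //; split=> //.
- by rewrite !transp_at0.
- by split; apply: transp_supp.
Qed.

Section GoodMutation.
Variables (i : J) (N : J -> J -> int) (th : qser (om N)).
Hypotheses (sN : skewsym N) (th_good : good th).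
Local Notation N' := (mut i N).
Local Notation betaL := (beta_neg N i).
Local Notation betaR := (beta_pos N i).
Local Notation fL := (facL i th).
Local Notation fR := (facR i th).
Local Notation tL := (transp i betaL (om N')).
Local Notation tR := (transp i betaR (om N')).

Let aL := adm_betaL d_gt0 i sN.
Let aR := adm_betaR d_gt0 i sN.
Let sN' : skewsym N' := skew_mut i sN.
Let sL : supp fL (below_mid i betaL). Proof. by case: (facLR_bound d_gt0 i sN th_good). Qed.
Let sR : supp fR (below_mid i betaR). Proof. by case: (facLR_bound d_gt0 i sN th_good). Qed.

Definition mutser : qser (om N') := dil d i N' * tR fR.

Lemma ndeg_mut n : ndeg i N' n = - ndeg i N n.
Proof.
rewrite /ndeg /pairV -sumrN; apply: eq_bigr => j _.
by rewrite (mut_row d_gt0 i j sN) mulNr.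
Qed.

Lemma slice_transp be (f : qser (om N)) n : adm i be ->
  slice i (transp i be (om N') f) n = revs (bdeg be n) (slice i f n).
Proof.
move=> ab; apply/funext => m.
by rewrite /slice /transp /revs /below_mid /tauE bdeg_seti // ffunE eqxx seti_seti.
Qed.

(** On each line, transport reverses the slices of [fL] and [fR] and the new form inverts [ypow];
    the required relation is the reversed one of [slice_rev], the two lengths differing by
    [ndeg n]. *)
Lemma mutserR : mutser = tL fL * dil d i N'.
Proof.
apply/(dil_commP d_gt0 i _ _ sN') => n; rewrite !slice_transp //.
have -> : ypow d i N' n = (ypow d i N n)^-1 by rewrite /ypow ndeg_mut mulrN twopowN.
have sl := slicesLR d_gt0 i sN th n.
have zz be (f : qser (om N)) : adm i be -> supp f (below_mid i be) ->
    forall m, (bdeg be n < m)%N -> slice i f n m = 0.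
  move=> ab sf m hm; apply/eqP; apply: contraTT hm => /sf.
  by rewrite /below_mid bdeg_seti // ffunE eqxx -leqNgt.
case: (ndeg_absP d_gt0 i sN n) => -[_ [m [_ ym bm]]].
  apply: slice_relV; rewrite ym -bm; rewrite ym in sl.
  by apply: slice_rev => //; apply: zz.
have := slice_relV sl; rewrite ym -bm => sl'.
by apply: slice_rev => //; apply: zz.
Qed.

Lemma transp_offaxis be (f : qser (om N)) : adm i be -> f 0 = 1 ->
  offaxis i (transp i be (om N') f).
Proof.
move=> ab f0; split=> [|m]; first by rewrite transp_at0.
rewrite /transp; case: ifP => // hm.
have := below_axis ab hm; rewrite /is_axis axis_i eqxx => /(_ isT) /eqP.
by rewrite axis_neq0.
Qed.

(** For [j] other than [i] with [N i j > 0], reflection moves the axis exponent to the top end of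
    its line. There [fL] is concentrated at the bottom and [slice_top] identifies the top
    coefficient of [fR] with the bottom one of [fL], that of [th]. *)
Lemma mutser_axis j m : mutser (axis j m) = qdilog (d j) m.
Proof.
have [->|ji] := eqVneq j i.
  rewrite /mutser mul_axis_l ?dil_axis //; apply: transp_offaxis => //.
  exact: (fR0 i th_good).
set n := axis j m; have ni : n i = 0%N by rewrite ffunE eq_sym (negPf ji).
have sn : seti i n 0 = n by rewrite -{1}ni seti_id.
rewrite /mutser mul_dil_l // ni big_ord1 subn0 sn expr0 !mul1r /transp.
have bn : below_mid i betaR n by rewrite /below_mid ni leq0n.
rewrite bn /tauE ni subn0.
have thn : th n = qdilog (d j) m by case: th_good => _ h _; apply: h.
have fLn : fL n = th n by rewrite [in RHS](@facLE _ d i _ th) mul_dil_l // ni big_ord1 subn0 sn expr0 !mul1r.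
have fRn : fR n = th n by rewrite [in RHS](@facRE _ d i _ th) mul_dil_r // ni big_ord1 subn0 sn expr0 !mul1r.
have bb (be : J -> int) : bdeg be n = absz (be j * m%:Z).
  rewrite /bdeg /pairV (bigD1 j) //= big1 ?addr0 ?ffunE ?eqxx ?ffunE ?eqxx // => k /negPf h.
  by rewrite !ffunE h mulr0.
have [Nij|Nij] := leP (N i j) 0.
  by rewrite bb /beta_pos posn_le0 // mul0r sn fRn.
have bL0 : bdeg betaL n = 0%N by rewrite bb /beta_neg posn_le0 ?mul0r // oppr_le0 ltW.
have sl := slicesLR d_gt0 i sN th n.
have z m' : (0 < m')%N -> slice i fL n m' = 0.
  move=> hm; apply/eqP; apply: contraTT hm => /sL.
  by rewrite /below_mid bdeg_seti // ffunE eqxx bL0 -leqNgt.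
case: (ndeg_absP d_gt0 i sN n) => -[nd [k [hk yk bk]]].
  rewrite yk in sl; have := slice_top (d_gt0 i) sl z; rewrite add0n -bk bL0 add0n /slice => ->.
  by rewrite sn fLn.
have k0 : k = 0%N by move: bk; rewrite bL0; lia.
have -> : bdeg betaR n = 0%N by lia.
by rewrite sn fRn.
Qed.

(** The factorization is made before transport, by the pull-back [G] of the half space of [n'], and
    kept inside the domain of the reflection. When [n'] is in that domain, the known vanishing at
    its reflection is carried over. *)
Lemma transported (be : J -> int) (f : qser (om N)) n' : adm i be ->
  (forall x y, bilV (om N') x y = bilV (om N) (tauV i be x) (tauV i be y)) ->
  f 0 = 1 -> supp f (below_mid i be) ->
  (forall n v w, below_mid i be n -> n' = tauE i be n -> f = v * w -> v 0 = 1 -> w 0 = 1 ->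
     supp v (ge0 (om N) n) -> supp w (orz (lt0 N n)) -> lam wdegq v n = 0) ->
  exists v w : qser (om N'), [/\ transp i be (om N') f = v * w, v 0 = 1 /\ w 0 = 1,
    supp v (ge0 (om N') n'), supp w (orz (lt0 N' n')) & n' != 0 -> lam wdegq v n' = 0].
Proof.
move=> ab hiso f0 sf hlam; have iso := adj_iso ab hiso.
have mB := below_submonoid ab.
pose G : pred E := fun a => 0 <= bil (om N') (tauE i be a) n'.
have [e v0 w0 sv sw] := @qfactor _ _ f G _ f0 mB sf.
set v := fac_v _ _ in e v0 sv; set w := fac_w _ _ in e w0 sw.
have svB : supp v (below_mid i be) by apply: supp_sub sv => a /andP[].
have swB : supp w (below_mid i be) by apply: supp_sub sw => a /andP[].
have sv' : supp (transp i be (om N') v) (ge0 (om N') n').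
  apply: (transp_sub ab _ sv) => a ha /andP[/orP[/eqP ->|//] _].
  by rewrite tauE0 // /ge0 bil0l.
exists (transp i be (om N') v), (transp i be (om N') w); split => //.
- by rewrite -(transpM ab iso) // -e.
- by rewrite !transp_at0.
- apply: (transp_sub ab _ sw) => a ha /andP[/orP[/eqP ->|h] _]; first by rewrite tauE0 // /orz eqxx.
  by move: h; rewrite /orz /= /G /negpair ltNge => ->; rewrite orbT.
move=> n'0.
(* An additive function on all exponents that agrees with the total degree of [tauE i be a] on the
   domain; [tauE] itself is not additive elsewhere. *)
pose l a : rat := wdegq (seti i a 0) + (pairV be (iv a) - (a i)%:Z)%:~R.
have lD : {morph l : a b / a + b}.
  move=> a b; rewrite /l.
  have -> : seti i (a + b) 0 = seti i a 0 + seti i b 0.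
    by apply/ffunP => j; rewrite !ffunE; case: eqP.
  rewrite wdegqD -!(bdegE ab) (bdegD ab).
  have -> : (a + b) i = (a i + b i)%N by rewrite ffunE.
  rewrite !PoszD.
  by rewrite !rmorphB !rmorphD /=; ring.
have ll a : below_mid i be a -> l a = wdegq (tauE i be a).
  move=> ha; rewrite /l /tauE -(setiD i a (_ - _)) wdegqD; congr (_ + _).
  by rewrite /wdegQ wdeg_axis -(bdegE ab) subzn.
rewrite (transp_lam ab iso (l := l)) //; case: ifP => // hn.
set n := tauE i be n'; have nE : n' = tauE i be n by rewrite tauEK.
have bn : below_mid i be n by apply: below_tau.
have n0 : n != 0 by apply: contraNneq n'0 => h; rewrite nE h tauE0.
have svn : supp v (ge0 (om N) n).
  move=> a va; have /andP[/orP[/eqP ->|]] := sv a va; first by rewrite /ge0 bil0l.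
  by move=> + ha; rewrite /G nE iso.
have swn : supp w (orz (lt0 N n)).
  move=> a wa; have /andP[/orP[/eqP ->|]] := sw a wa; first by rewrite /orz eqxx.
  by rewrite /= /G nE => + ha; rewrite iso // /orz /negpair ltNge => ->; rewrite orbT.
have z := hlam n v w bn nE e v0 w0 svn swn.
(* The vanishing is known for [wdegq] and wanted for [l]. *)
have := lam_indep (bil_skew sN) wdegqD lD v0 svn; rewrite z mulr0 => /eqP.
by rewrite mulf_eq0 {1}/wdegq pnatr_eq0 wdeg_eq0 (negPf n0) => /eqP.
Qed.

Lemma tau_nonaxis be n : adm i be -> below_mid i be n -> ~~ on_axis (tauE i be n) ->
  (forall j m, n = axis j m -> j != i -> bdeg be n = 0%N) -> ~~ on_axis n.
Proof.
move=> ab bn nax h; apply: contra nax => /orP[/eqP ->|/existsP[j /eqP e]].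
  by rewrite tauE0 // /on_axis eqxx.
have [ji|ji] := eqVneq j i.
  by rewrite (below_axis ab bn) ?tauE0 // /on_axis ?eqxx // /is_axis -ji -e.
have ni : n i = 0%N by rewrite e ffunE eq_sym (negPf ji).
rewrite /tauE (h j _ e ji) sub0n -ni seti_id.
by apply/orP; right; apply/existsP; exists j; rewrite -e.
Qed.

Lemma bdeg_axis (be : J -> int) j m : bdeg be (axis j m) = absz (be j * m%:Z).
Proof.
rewrite /bdeg /pairV (bigD1 j) //= big1 ?addr0 ?ffunE ?eqxx ?ffunE ?eqxx // => k /negPf h.
by rewrite !ffunE h mulr0.
Qed.

Lemma ndeg_axis j m : ndeg i N (axis j m) = N i j * m%:Z.
Proof.
rewrite /ndeg /pairV (bigD1 j) //= big1 ?addr0 ?ffunE ?eqxx ?ffunE ?eqxx // => k /negPf h.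
by rewrite !ffunE h mulr0.
Qed.

Lemma mutser0 : mutser 0 = 1.
Proof. by rewrite /mutser qmul_at0 dil0 mul1r transp_at0 // (fR0 i th_good). Qed.

Lemma good_of_factor (N0 : J -> J -> int) (th1 : qser (om N0)) : skewsym N0 -> th1 0 = 1 ->
  (forall j m, th1 (axis j m) = qdilog (d j) m) ->
  (forall n, ~~ on_axis n -> exists v w, [/\ th1 = v * w, v 0 = 1, w 0 = 1,
     supp v (ge0 (om N0) n) & supp w (orz (lt0 N0 n))] /\ lam wdegq v n = 0) -> good th1.
Proof.
move=> sN0 z0 za h; split=> // n nax v w e v0 w0 sv sw.
have [v' [w' [[e' v'0 w'0 sv' sw'] <-]]] := h n nax.
suff -> : v = v' by [].
apply: (qfactor_uniq (ge0_submonoid (om N0) n) (lt0_submonoid d N0 n) _ v0 w0 v'0 w'0 sv sv' sw sw').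
  by move=> a; rewrite /ge0 /orz /negpair => ha /orP[/eqP|] //; lia.
by rewrite -e.
Qed.

(** Mutation changes the sign of [ndeg]. Where the new dilogarithm pairs nonnegatively with [n'],
    the form [dil * tR fR] lets [v] absorb it and [lamR] applies to [fR]; where it pairs negatively,
    [tL fL * dil] lets [w] absorb it and [lamL] applies to [fL]. *)
Lemma mutser_good : good mutser.
Proof.
apply: good_of_factor sN' mutser0 mutser_axis _ => n' nax.
have n'0 : n' != 0 by move: nax; rewrite negb_or => /andP[].
have nd' n be : below_mid i be n -> n' = tauE i be n -> ndeg i N' n' = - ndeg i N n.
  by move=> _ ->; rewrite ndeg_mut /tauE (ndeg_seti d_gt0).
have dilb : supp (dil d i N') (fun a => bil (om N') a n' == (d i)%:Z * (a i)%:Z * ndeg i N' n').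
  by apply: supp_sub (@dil_supp _ d i N') => a /eqP ->; rewrite bil_axis // axis_i.
have [nn|nn] := leP 0 (ndeg i N' n').
  have [v [w [e [v0 w0] sv sw lv]]] :
    exists v w : qser (om N'), [/\ tR fR = v * w, v 0 = 1 /\ w 0 = 1,
      supp v (ge0 (om N') n'), supp w (orz (lt0 N' n')) & n' != 0 -> lam wdegq v n' = 0].
    apply: transported => //; first by move=> x y; apply: bilV_mutR.
      exact: (fR0 i th_good).
    move=> n v w bn en; have hn := nd' n _ bn en.
    have nn' : ndeg i N n <= 0 by move: nn; rewrite hn; lia.
    apply: (lamR d_gt0 (i := i) sN th_good) => //.
    apply: (tau_nonaxis aR bn); first by rewrite -en.
    move=> j m ea _; move: nn'; rewrite ea ndeg_axis bdeg_axis /beta_pos.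
    have [->|m0] := eqVneq m 0%N; first by rewrite !mulr0.
    by rewrite pmulr_lle0 ?ltz_nat ?lt0n // => hN; rewrite posn_le0 // mul0r.
  have sd : supp (dil d i N') (ge0 (om N') n').
    by apply: supp_sub dilb => a /eqP h; rewrite /ge0 h; apply: mulr_ge0 => //; apply: mulr_ge0.
  have mG := ge0_submonoid (om N') n'.
  exists (dil d i N' * v), w; split; first split=> //.
  - by rewrite /mutser e mulrA.
  - by rewrite qmul_at0 dil0 v0 mulr1.
  - exact: suppM.
  by rewrite (lamM (bil_skew sN') wdegqD) ?dil0 // lam_dil ?lv ?addr0 //; apply: wdegqD.
have [v [w [e [v0 w0] sv sw lv]]] :
  exists v w : qser (om N'), [/\ tL fL = v * w, v 0 = 1 /\ w 0 = 1,
    supp v (ge0 (om N') n'), supp w (orz (lt0 N' n')) & n' != 0 -> lam wdegq v n' = 0].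
  apply: transported => //; first by move=> x y; apply: bilV_mutL.
    exact: (fL0 i th_good).
  move=> n v w bn en; have hn := nd' n _ bn en.
  have nn' : 0 <= ndeg i N n by move: nn; rewrite hn; lia.
  apply: (lamL sN th_good) => //.
  apply: (tau_nonaxis aL bn); first by rewrite -en.
  move=> j m ea _; move: nn'; rewrite ea ndeg_axis bdeg_axis /beta_neg.
  have [->|m0] := eqVneq m 0%N; first by rewrite !mulr0.
  by rewrite pmulr_lge0 ?ltz_nat ?lt0n // => hN; rewrite posn_le0 ?oppr_le0 // mul0r.
exists v, (w * dil d i N'); split; first split=> //; last exact: lv.
- by rewrite mutserR e mulrA.
- by rewrite qmul_at0 dil0 w0 mulr1.
apply: suppM => //; first exact: lt0_submonoid.
move=> a da; rewrite /orz /negpair (eqP (dilb a da)).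
have [//|a0] := eqVneq a 0.
have : (0 < a i)%N.
  by rewrite lt0n; apply: contraNneq a0 => h; rewrite (eqP (dil_supp da)) h axis0.
by move: nn (d_gt0 i); rewrite /=; set z := ndeg i N' n'; nia.
Qed.

Lemma mutrel_mut : mutrel i th mutser.
Proof.
exists fL, fR; split=> //.
- by split; [apply: facLE | apply: facRE].
- by split; [apply: (fL0 i th_good) | apply: (fR0 i th_good)].
exact: mutserR.
Qed.

End GoodMutation.
End Mutation.

(** * Chambers and sign coherence *)

Section Combinations.
Variable J : finType.
Local Notation V := {ffun J -> int}.
Implicit Types (x y m : V) (c : J -> V).

Lemma scaleVE x z j : (x *~ z) j = x j * z.
Proof.
have h n : (x *+ n) j = x j * n%:Z by rewrite ffunMnE -mulr_natr natz.
case: z => n; first exact: h.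
by rewrite NegzE mulrNz ffunE -[X in - X]/((x *+ n.+1) j) h mulrN.
Qed.

Definition comb c m : V := \sum_k c k *~ m k.

Lemma combE c m j : comb c m j = \sum_k c k j * m k.
Proof. by rewrite /comb sum_ffunE; apply: eq_bigr => k _; rewrite scaleVE. Qed.

Lemma combD c m m' : comb c (m + m') = comb c m + comb c m'.
Proof. by rewrite /comb -big_split; apply: eq_bigr => k _; rewrite ffunE mulrzDr. Qed.

Lemma combN c m : comb c (- m) = - comb c m.
Proof. by rewrite /comb -sumrN; apply: eq_bigr => k _; rewrite ffunE mulrNz. Qed.

Lemma comb_ev c k s : comb c (ev k s) = c k *~ s.
Proof.
rewrite /comb (bigD1 k) //= ffunE eqxx mulr1 big1 ?addr0 // => j /negPf h.
by rewrite ffunE h mulr0 mulr0z.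
Qed.

Definition c0 : J -> V := fun k => ev k 1.

Lemma comb_c0 m : comb c0 m = m.
Proof.
apply/ffunP => j; rewrite combE (bigD1 j) //= ffunE eqxx mulr1 mul1r big1 ?addr0 // => k h.
by rewrite ffunE eq_sym (negPf h) mul1r mul0r.
Qed.

Lemma ev_scale i s : ev i s = ev i 1 *~ s :> V.
Proof. by apply/ffunP => j; rewrite scaleVE !ffunE; ring. Qed.

Lemma pairVD (be : J -> int) x y : pairV be (x + y) = pairV be x + pairV be y.
Proof. by rewrite /pairV -big_split; apply: eq_bigr => j _; rewrite ffunE mulrDr. Qed.

Lemma pairVZ (be : J -> int) x s : pairV be (x *~ s) = pairV be x * s.
Proof. by rewrite /pairV mulr_suml; apply: eq_bigr => j _; rewrite scaleVE mulrA. Qed.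

Lemma tauVD i be x y : tauV i be (x + y) = tauV i be x + tauV i be y.
Proof. by apply/ffunP => j; rewrite !ffunE pairVD; case: eqP => // _; ring. Qed.

Lemma tauVZ i be x s : tauV i be (x *~ s) = tauV i be x *~ s.
Proof. by apply/ffunP => j; rewrite scaleVE !ffunE pairVZ !scaleVE; case: eqP => // _; ring. Qed.

Lemma tauVN i be x : tauV i be (- x) = - tauV i be x.
Proof. by rewrite -[LHS]/(tauV i be (x *~ -1)) -[RHS]/(tauV i be x *~ -1) tauVZ. Qed.

Lemma tauV0 i be : tauV i be 0 = 0 :> V.
Proof. by rewrite -(mulr0z 0) tauVZ mulr0z. Qed.

(* For sign-coherent [c l] the mutation of c-vectors takes this form, with [t] the
   positive or the negative part of the row of [l]. *)
Definition cstep (t : J -> int) l c : J -> V :=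
  fun k => if k == l then - c l else c k + c l *~ t k.

(** Changing the basis by [cstep] changes coordinates by an involution, so properties of bases
    follow from those of the reflection. *)
Lemma comb_cstep t l c m : t l = 0 -> comb (cstep t l c) m = comb c (tauV l t m).
Proof.
move=> tl; rewrite tauVE combD comb_ev; apply/ffunP => j.
rewrite combE ffunE scaleVE combE /pairV mulr_sumr -big_split; apply: eq_bigr => k _.
rewrite /cstep; have [->|_] := eqVneq k l; first by rewrite ffunE tl /=; ring.
by rewrite ffunE scaleVE /= muln0; ring.
Qed.

End Combinations.

(** * Total preorders as points, and walls through them *)

Section Preorders.
Variable J : finType.
Local Notation V := {ffun J -> int}.
Implicit Types (x y m : V) (c : J -> V) (P : pred V).

(* [P x] stands for [0 <= x] in a total group preorder, i.e. at a generalized point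
   of the space of the scattering diagram. *)
Definition gpre P := [/\ P 0, forall x y, P x -> P y -> P (x + y) & forall x, P x || P (- x)].

Definition gtV P x := ~~ P (- x).
Definition ltV P x := ~~ P x.

Lemma gtV_ge P x : gpre P -> gtV P x -> P x.
Proof. by case=> _ _ /(_ x) /orP[//|h]; rewrite /gtV h. Qed.

Lemma gtVD P x y : gpre P -> gtV P x -> P y -> gtV P (x + y).
Proof.
case=> _ PD _ hx hy; apply: contraNN hx => h.
by have := PD _ _ h hy; rewrite opprD addrNK.
Qed.

Lemma ltVD P x y : gpre P -> ltV P x -> P (- y) -> ltV P (x + y).
Proof.
case=> _ PD _ hx hy; apply: contraNN hx => h.
by have := PD _ _ h hy; rewrite addrK.
Qed.

Lemma geZ P x s : gpre P -> P x -> 0 <= s -> P (x *~ s).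
Proof.
case=> P0 PD _ Px; case: s => // n _; elim: n => [|n IH]; first by rewrite mulr0z.
by rewrite -addn1 PoszD mulrzDr mulr1z PD.
Qed.

Lemma comb_ge P c m : gpre P -> (forall k, P (c k)) -> (forall k, 0 <= m k) -> P (comb c m).
Proof.
move=> gP Pc m0; have [P0 PD _] := gP.
by rewrite /comb; apply: (big_ind (fun x => P x)) => // k _; apply: geZ.
Qed.

Lemma gtZ P x s : gpre P -> gtV P x -> 0 < s -> gtV P (x *~ s).
Proof.
move=> gP gx; case: s => // -[|n] // _; rewrite -addn1 PoszD addrC mulrzDr mulr1z.
by apply: gtVD => //; apply: geZ => //; apply: gtV_ge.
Qed.

Lemma comb_gt P c m k : gpre P -> (forall l, P (c l)) -> (forall l, 0 <= m l) ->
  gtV P (c k) -> 0 < m k -> gtV P (comb c m).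
Proof.
move=> gP Pc m0 gk mk; have [P0 PD _] := gP.
rewrite /comb (bigD1 k) //=; apply: gtVD => //; first exact: gtZ.
by apply: (big_ind (fun x => P x)) => // l _; apply: geZ.
Qed.

Lemma gpre_tau P i be : gpre P -> gpre (fun x => P (tauV i be x)).
Proof.
case=> P0 PD Pt; split=> [|x y|x]; first by rewrite tauV0.
  by rewrite tauVD; apply: PD.
by rewrite tauVN.
Qed.

End Preorders.

Section Chambers.
Variables (J : finType) (d : J -> nat).
Hypothesis d_gt0 : forall j, (0 < d j)%N.
Local Notation E := {ffun J -> nat}.
Local Notation V := {ffun J -> int}.
Local Notation om := (omega d).
Local Notation skewsym := (skewsym d).
Local Notation good := (good (d := d)).
Implicit Types (a b n : E) (N : J -> J -> int) (x y m : V) (c : J -> V) (P : pred V).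

(* No wall of the scattering diagram passes through the point [P]. *)
Definition wall_free N (th : qser (om N)) P := exists v w : qser (om N),
  [/\ th = v * w, v 0 = 1, w 0 = 1, supp v (orz (fun a => gtV P (iv a))) &
      supp w (orz (fun a => ltV P (iv a)))].

Lemma ivD a b : iv (a + b) = iv a + iv b.
Proof. by apply/ffunP => j; rewrite !ffunE -PoszD. Qed.

Lemma gt_submonoid P : gpre P -> submonoid (orz (fun a => gtV P (iv a))).
Proof.
move=> gP; split=> [|a b]; rewrite /orz ?eqxx // => /orP[/eqP ->|ha]; first by rewrite add0r.
move=> /orP[/eqP ->|hb]; first by rewrite addr0 ha orbT.
by rewrite ivD gtVD ?orbT //; apply: gtV_ge.
Qed.

Lemma ltV_le P x : gpre P -> ltV P x -> P (- x).
Proof. by case=> _ _ /(_ x) /orP[h|//]; rewrite /ltV h. Qed.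

Lemma lt_submonoid P : gpre P -> submonoid (orz (fun a => ltV P (iv a))).
Proof.
move=> gP; split=> [|a b]; rewrite /orz ?eqxx // => /orP[/eqP ->|ha]; first by rewrite add0r.
move=> /orP[/eqP ->|hb]; first by rewrite addr0 ha orbT.
by rewrite ivD ltVD ?orbT //; apply: ltV_le.
Qed.

Lemma gt_lt0 P a : gpre P -> orz (fun a => gtV P (iv a)) a -> orz (fun a => ltV P (iv a)) a -> a = 0.
Proof.
move=> gP /orP[/eqP //|h1] /orP[/eqP //|].
by rewrite /ltV (gtV_ge gP h1).
Qed.

Lemma iv_axis i s : iv (axis i s) = ev i s%:Z :> V.
Proof. by apply/ffunP => j; rewrite !ffunE; case: eqP; rewrite ?mulr1 ?mulr0. Qed.

Lemma triv_pos N (th : qser (om N)) P : good th -> gpre P ->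
  (forall j, gtV P (ev j 1)) -> wall_free th P.
Proof.
move=> [th0 _ _] gP pos; exists th, 1; split; rewrite ?mulr1 ?qoneE ?eqxx //; last first.
  by move=> a; rewrite qoneE /orz; case: (a == 0).
move=> a _; rewrite /orz; have [//|a0 /=] := eqVneq a 0.
have /existsP[k ak] : [exists k, a k != 0%N].
  apply: contraNT a0 => /existsPn h; apply/eqP/ffunP => k; rewrite ffunE.
  by apply/eqP; have := h k; rewrite negbK.
rewrite -(comb_c0 (iv a)); apply: (@comb_gt _ _ _ _ k gP) => [l|l||].
- by apply: gtV_ge => //; apply: pos.
- by rewrite ffunE.
- exact: pos.
by rewrite ffunE ltz_nat lt0n.
Qed.

Lemma qdilog1_neq0 dl : (0 < dl)%N -> qdilog dl 1 != 0.
Proof.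
move=> h; rewrite -[qdilog dl 1]/(_ * 1 / _) mulr1 mulf_neq0 ?expfz_neq0 // invr_neq0 //.
by rewrite subr_eq0 gt_eqF // -exprnP exprn_egt1 //; lia.
Qed.

(** The exponent [axis i 1] is indecomposable, so its nonzero coefficient must come from [v] or from
    [w] alone; but [e_i] is neither strictly positive nor strictly negative at [P]. *)
Lemma triv_wall N (th : qser (om N)) P i : good th -> gpre P ->
  P (ev i 1) -> P (- ev i 1) -> ~ wall_free th P.
Proof.
move=> [th0 tha _] gP h1 h2 [v [w [e v0 w0 sv sw]]].
have := tha i 1%N; rewrite e qmul_proper ?axis_neq0 // v0 w0 pmul_eq0 => [|a b hab a0 b0 _ _].
  have -> : v (axis i 1) = 0.
    apply/eqP; apply: contraT => /sv; rewrite /orz axis_neq0 /= iv_axis /gtV.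
    by rewrite h2.
  have -> : w (axis i 1) = 0.
    apply/eqP; apply: contraT => /sw; rewrite /orz axis_neq0 /= iv_axis /ltV.
    by rewrite h1.
  move=> h; have := qdilog1_neq0 (d_gt0 i); rewrite -h.
  by rewrite mul0r mulr0 !addr0 eqxx.
have := wdegD a b; rewrite hab wdeg_axis.
by move: a0 b0; rewrite -!wdeg_eq0; lia.
Qed.

Section Side.
Variables (i : J) (N N' : J -> J -> int).
Hypotheses (sN : skewsym N) (adj : mutadj d i N N').
Variables (th : qser (om N)) (th' : qser (om N')).
Hypothesis rel : mutrel i th th'.

Let aL := adm_betaL d_gt0 i sN.
Let aR := adm_betaR d_gt0 i sN.

Lemma axis_gt P : gpre P -> gtV P (ev i 1) ->
  forall n, is_axis i n -> orz (fun a => gtV P (iv a)) n.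
Proof.
move=> gP h n /eqP ->; rewrite /orz axis_neq0 iv_axis; case: (n i) => [|m]; rewrite ?eqxx //.
by rewrite (ev_scale i) gtZ ?orbT.
Qed.

Lemma axis_lt P : gpre P -> ltV P (ev i 1) ->
  forall n, is_axis i n -> orz (fun a => ltV P (iv a)) n.
Proof.
move=> gP h n /eqP ->; rewrite /orz axis_neq0 iv_axis; case: (n i) => [|m]; rewrite ?eqxx //.
have gP' : gpre (fun x => P (- x)).
  case: gP => P0 PD Pt; split=> [|x y|x]; rewrite ?oppr0 ?opprD //; exact: PD.
have := @gtZ _ _ (ev i 1) m.+1%:Z gP'; rewrite /gtV !opprK => /(_ h isT) hh.
by rewrite (ev_scale i) /ltV hh orbT.
Qed.

Lemma transp_gt P be v : adm i be -> supp v (below_mid i be) ->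
  supp v (orz (fun a => gtV P (iv a))) ->
  supp (transp i be (om N') (v : qser (om N))) (orz (fun a => gtV (fun x => P (tauV i be x)) (iv a))).
Proof.
move=> ab sB sv; apply: (transp_sub ab _ sv) => a ha; rewrite /orz => /orP[/eqP ->|h].
  by rewrite tauE0 // eqxx.
by rewrite /gtV (iv_tau ab ha) -tauVN tauVK ?ab.2 // -/(gtV P (iv a)) h orbT.
Qed.

Lemma transp_lt P be v : adm i be -> supp v (below_mid i be) ->
  supp v (orz (fun a => ltV P (iv a))) ->
  supp (transp i be (om N') (v : qser (om N))) (orz (fun a => ltV (fun x => P (tauV i be x)) (iv a))).
Proof.
move=> ab sB sv; apply: (transp_sub ab _ sv) => a ha; rewrite /orz => /orP[/eqP ->|h].
  by rewrite tauE0 // eqxx.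
by rewrite /ltV (iv_tau ab ha) tauVK ?ab.2 // -/(ltV P (iv a)) h orbT.
Qed.

(** Where [e_i] is positive the dilogarithm belongs to [v], so [fL] factors as [dil^-1 v] times [w].
    By [factor_supp] both factors satisfy the support bound of [fL] and can be transported; the new
    dilogarithm stands on the right, where [e_i] has become negative. *)
Lemma triv_mutL P : gpre P -> gtV P (ev i 1) -> wall_free th P ->
  wall_free th' (fun x => P (tauV i (beta_neg N i) x)).
Proof.
move=> gP pos [v [w [e v0 w0 sv sw]]].
have [eL eR hR hL] := adj; have iso := adj_iso aL hL.
have [fL [fR [[e1 e2] [fL0 fR0] [sL sR] e3 e4]]] := rel.
have mG := gt_submonoid gP.
have sd : supp (dil d i N) (orz (fun a => gtV P (iv a))).
  by apply: supp_sub (@dil_supp _ d i N) => n; apply: axis_gt.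
have efL : fL = (qinv (dil d i N) * v) * w.
  by rewrite -mulrA -e e1 mulrA qmulVr ?mul1r // dil0.
have sv1 : supp (qinv (dil d i N) * v) (orz (fun a => gtV P (iv a))).
  by apply: suppM => //; apply: qinv_supp.
have v10 : (qinv (dil d i N) * v) 0 = 1 by rewrite qmul_at0 qinv_at0 v0 mulr1.
rewrite efL in sL e4.
have [sB1 sB2] := factor_supp v10 w0 (below_submonoid aL) (fun n => @gt_lt0 P n gP) sv1 sw sL.
exists (transp i (beta_neg N i) (om N') (qinv (dil d i N) * v)),
  (transp i (beta_neg N i) (om N') w * dil d i N'); split.
- by rewrite e4 (transpM aL iso) // mulrA.
- by rewrite transp_at0.
- by rewrite qmul_at0 transp_at0 // w0 dil0 mulr1.
- exact: transp_gt.
apply: suppM; first by apply: lt_submonoid; apply: gpre_tau.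
  exact: transp_lt.
apply: supp_sub (@dil_supp _ d i N') => n; apply: axis_lt; first exact: gpre_tau.
rewrite /ltV tauV_axis ?aL.2 //; move: pos; rewrite /gtV.
by have -> : ev i (-1) = - ev i 1 by apply/ffunP => j; rewrite !ffunE mulNr.
Qed.

Lemma triv_mutR P : gpre P -> ltV P (ev i 1) -> wall_free th P ->
  wall_free th' (fun x => P (tauV i (beta_pos N i) x)).
Proof.
move=> gP neg [v [w [e v0 w0 sv sw]]].
have [eL eR hR hL] := adj; have iso := adj_iso aR hR.
have [fL [fR [[e1 e2] [fL0 fR0] [sL sR] e3 e4]]] := rel.
have mL := lt_submonoid gP.
have sd : supp (dil d i N) (orz (fun a => ltV P (iv a))).
  by apply: supp_sub (@dil_supp _ d i N) => n; apply: axis_lt.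
have efR : fR = v * (w * qinv (dil d i N)).
  by rewrite mulrA -e e2 -mulrA qmulV ?mulr1 // dil0.
have sw1 : supp (w * qinv (dil d i N)) (orz (fun a => ltV P (iv a))).
  by apply: suppM => //; apply: qinv_supp.
have w10 : (w * qinv (dil d i N)) 0 = 1 by rewrite qmul_at0 qinv_at0 w0 mulr1.
rewrite efR in sR e3.
have [sB1 sB2] := factor_supp v0 w10 (below_submonoid aR) (fun n => @gt_lt0 P n gP) sv sw1 sR.
exists (dil d i N' * transp i (beta_pos N i) (om N') v),
  (transp i (beta_pos N i) (om N') (w * qinv (dil d i N))); split.
- by rewrite e3 (transpM aR iso) // mulrA.
- by rewrite qmul_at0 transp_at0 // v0 dil0 mulr1.
- by rewrite transp_at0.
- apply: suppM; first by apply: gt_submonoid; apply: gpre_tau.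
    apply: supp_sub (@dil_supp _ d i N') => n; apply: axis_gt; first exact: gpre_tau.
    rewrite /gtV; have -> : - ev i 1 = ev i (-1) by apply/ffunP => j; rewrite !ffunE mulNr.
    by rewrite tauV_axis ?aR.2 // opprK.
  exact: transp_gt.
exact: transp_lt.
Qed.

End Side.

End Chambers.

Section Lex.
Variable T : eqType.
Implicit Types (s : seq T) (f g : T -> int).

Fixpoint lexge (f : T -> int) s : bool :=
  if s is a :: s' then (0 < f a) || ((f a == 0) && lexge f s') else true.

Lemma lexgeD f g s : lexge f s -> lexge g s -> lexge (fun x => f x + g x) s.
Proof.
elim: s => //= a s IH /orP[fa|/andP[/eqP fa fs]] /orP[ga|/andP[/eqP ga gs]].
- by rewrite addr_gt0.
- by rewrite ga addr0 fa.
- by rewrite fa add0r ga.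
by rewrite fa ga addr0 eqxx IH ?orbT.
Qed.

Lemma lexge_total f s : lexge f s || lexge (fun x => - f x) s.
Proof.
elim: s => //= a s; rewrite oppr_gt0 oppr_eq0; case: (ltgtP (f a) 0) => //= _ _.
Qed.

Lemma lexge_eq0 f s : lexge f s -> lexge (fun x => - f x) s -> forall a, a \in s -> f a = 0.
Proof.
elim: s => //= a s IH; rewrite oppr_gt0 oppr_eq0; case: (ltgtP (f a) 0) => //= fa h1 h2 b.
by rewrite inE => /orP[/eqP ->//|]; apply: IH.
Qed.

Lemma lexge_ge0 f s : (forall a, a \in s -> 0 <= f a) -> lexge f s.
Proof.
elim: s => //= a s IH h; have := h a (mem_head _ _); rewrite le_eqVlt eq_sym.
case/orP => [-> /=|->] //; rewrite IH ?orbT // => b hb; apply: h.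
by rewrite inE hb orbT.
Qed.

Lemma eq_lexge f g s : (forall a, f a = g a) -> lexge f s = lexge g s.
Proof. by move=> fg; elim: s => //= a s ->; rewrite fg. Qed.

End Lex.

(** * c-vectors as lattice bases *)

Section SignCoherence.
Variables (J : finType) (d : J -> nat).
Hypothesis d_gt0 : forall j, (0 < d j)%N.
Local Notation E := {ffun J -> nat}.
Local Notation V := {ffun J -> int}.
Local Notation om := (omega d).
Local Notation skewsym := (skewsym d).
Local Notation good := (good (d := d)).
Implicit Types (N : J -> J -> int) (x y m : V) (c : J -> V) (P : pred V) (u w : seq J).

(* [N] and the c-vectors after mutation along a word; the exchange matrix
   entry [eps_kl] is [N l k]. *)
Definition cmut N (l : J) c : J -> V := fun k =>
  if k == l then - c l else
  c k + c l *~ (posn (N l k))%:Z + [ffun j => (posn (- c l j))%:Z * N l k].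

Definition mstep (s : (J -> J -> int) * (J -> V)) (l : J) := (mut l s.1, cmut s.1 l s.2).

Definition run N w := foldl mstep (N, c0 (J := J)) w.

Definition cvec N w := (run N w).2.
Definition nmat N w := (run N w).1.

Definition sgc x := (forall j, 0 <= x j) \/ (forall j, x j <= 0).

Definition dvdi (a : nat) (x : int) := (a %| absz x)%N.

(* [c] is a basis of the lattice, also after rescaling the axes by [d]. *)
Definition unimod c :=
  [/\ forall k j, dvdi (d k) ((d j)%:Z * c k j),
      forall x (D : nat), (forall j, dvdi D ((d j)%:Z * x j)) ->
        exists m, x = comb c m /\ forall k, dvdi D ((d k)%:Z * m k) &
      forall m, comb c m = 0 -> m = 0].

Definition compat N N' c :=
  forall x y, bilV (om N) (comb c x) (comb c y) = bilV (om N') x y.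

Lemma nmat_foldl N w : nmat N w = foldl (fun N l => mut l N) N w.
Proof.
rewrite /nmat /run; move: (c0 (J := J)); elim: w N => //= l w IH N c; exact: IH.
Qed.

Lemma nmat_cons N i w : nmat N (i :: w) = nmat (mut i N) w.
Proof. by rewrite !nmat_foldl. Qed.

Lemma run_rcons N w l : run N (rcons w l) = mstep (run N w) l.
Proof. by rewrite /run foldl_rcons. Qed.

Lemma nmat_rcons N w l : nmat N (rcons w l) = mut l (nmat N w).
Proof. by rewrite /nmat run_rcons. Qed.

Lemma cvec_rcons N w l : cvec N (rcons w l) = cmut (nmat N w) l (cvec N w).
Proof. by rewrite /cvec run_rcons. Qed.

Lemma nmat_skew N w : skewsym N -> skewsym (nmat N w).
Proof.
rewrite nmat_foldl; elim: w N => //= l w IH N sN; apply: IH; exact: skew_mut.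
Qed.

Definition sbeta (b : bool) N i : J -> int := if b then beta_pos N i else beta_neg N i.

Lemma cmut_pos N l c : skewsym N -> (forall j, 0 <= c l j) ->
  cmut N l c = cstep (sbeta true N l) l c.
Proof.
move=> sN cl; apply/funext => k; rewrite /cmut /cstep; case: eqP => // _.
rewrite -[RHS]addr0; congr (_ + _); apply/ffunP => j.
by rewrite !ffunE posn_le0 ?mul0r // oppr_le0.
Qed.

Lemma cmut_neg N l c : skewsym N -> (forall j, c l j <= 0) ->
  cmut N l c = cstep (sbeta false N l) l c.
Proof.
move=> sN cl; apply/funext => k; rewrite /cmut /cstep; case: eqP => // _.
rewrite -addrA; congr (_ + _); apply/ffunP => j.
rewrite !ffunE !scaleVE [(posn (- c l j))%:Z]posn_ge0 ?oppr_ge0 // /= /beta_neg.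
transitivity (c l j * ((posn (N l k))%:Z - N l k)); first by ring.
by rewrite -{2}(posnB (N l k)); ring.
Qed.

Lemma adm_sbeta b N i : skewsym N -> adm i (sbeta b N i).
Proof. by case: b => sN; [apply: (adm_betaR d_gt0)|apply: (adm_betaL d_gt0)]. Qed.

Lemma dvdi_mulr (a : nat) (x y : int) : dvdi a x -> dvdi a (x * y).
Proof. by rewrite /dvdi abszM => h; rewrite dvdn_mulr. Qed.

Lemma dvdiP (a : nat) (x : int) : dvdi a x -> exists q : int, x = q * a%:Z.
Proof.
move=> /dvdnP[q]; case: x => x /= hq; first by exists q%:Z; rewrite hq PoszM.
by exists (- q%:Z); rewrite NegzE hq PoszM; ring.
Qed.

Lemma dvdiD (a : nat) (x y : int) : dvdi a x -> dvdi a y -> dvdi a (x + y).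
Proof.
by move=> /dvdiP[q ->] /dvdiP[r ->]; rewrite /dvdi -mulrDl abszM dvdn_mull.
Qed.

Lemma dvdiN (a : nat) (x : int) : dvdi a x -> dvdi a (- x).
Proof. by rewrite /dvdi abszN. Qed.

Lemma sbeta_exch b N l k : skewsym N ->
  (d l)%:Z * sbeta b N l k = (d k)%:Z * (posn (if b then - N k l else N k l))%:Z.
Proof.
move=> sN; have := sN l k; rewrite /omega => h.
case: b; rewrite /sbeta /beta_pos /beta_neg -!posnM; congr (posn _)%:Z; first by rewrite h; ring.
by rewrite mulrN h; ring.
Qed.

(** The divisibility clauses persist because skew-symmetrizability makes [d_l t_k] a multiple of
    [d_k] ([sbeta_exch]). *)
Lemma unimod_cstep b N l c : skewsym N -> unimod c -> unimod (cstep (sbeta b N l) l c).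
Proof.
move=> sN [h1 h2 h3]; set t := sbeta b N l; have tl : t l = 0 by apply: (adm_sbeta b l sN).2.
split.
- move=> k j; rewrite /cstep; case: eqP => [->|_].
    by rewrite ffunE mulrN; apply/dvdiN/h1.
  rewrite ffunE scaleVE mulrDr; apply: dvdiD; first exact: h1.
  have /dvdiP[s hs] := h1 l j.
  rewrite mulrA hs -mulrA /t sbeta_exch // mulrCA.
  exact: dvdi_mulr (dvdnn _).
- move=> x D hx; have [m [em hm]] := h2 x D hx.
  exists (tauV l t m); rewrite comb_cstep // tauVK //; split=> // k.
  rewrite ffunE; case: eqP => [->|_]; last exact: hm.
  rewrite mulrBr; apply: dvdiD; last by apply/dvdiN/hm.
  rewrite /pairV mulr_sumr; apply: (big_ind (fun z => dvdi D z)).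
  - exact: dvdn0.
  - by move=> y z; apply: dvdiD.
  move=> j _; rewrite mulrA /t sbeta_exch // mulrAC.
  exact/dvdi_mulr/hm.
move=> m; rewrite comb_cstep // => /h3 h; rewrite -(@tauVK _ l t m) // h tauV0 //.
Qed.

Lemma bilV_mut b N i x y : skewsym N ->
  bilV (om (mut i N)) x y = bilV (om N) (tauV i (sbeta b N i) x) (tauV i (sbeta b N i) y).
Proof. by move=> sN; case: b; [apply: bilV_mutR | apply: bilV_mutL]. Qed.

Lemma compat_cstep b N N' l c : skewsym N' -> compat N N' c ->
  compat N (mut l N') (cstep (sbeta b N' l) l c).
Proof.
move=> sN' h x y; have tl := (adm_sbeta b l sN').2.
by rewrite !comb_cstep // h -bilV_mut.
Qed.

Lemma unimod_c0 : unimod (c0 (J := J)).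
Proof.
split=> [k j|x D hx|m]; last by rewrite comb_c0.
  by rewrite ffunE; case: eqP => [->|_]; rewrite ?mul1r ?mulr1 ?mulr0 /dvdi /= ?dvdn0 ?dvdnn.
by exists x; rewrite comb_c0.
Qed.

Lemma compat_c0 N : compat N N (c0 (J := J)).
Proof. by move=> x y; rewrite !comb_c0. Qed.

Section Coordinates.
Variable c : J -> V.
Hypothesis uc : unimod c.

Lemma coord_ex x : exists m, x = comb c m.
Proof.
case: uc => _ h _; have [|m [e _]] := h x 1%N; last by exists m.
by move=> j; apply: dvd1n.
Qed.

Definition coord x : V := projT1 (cid (coord_ex x)).

Lemma coordK x : x = comb c (coord x).
Proof. exact: projT2 (cid (coord_ex x)). Qed.

Lemma comb_inj m m' : comb c m = comb c m' -> m = m'.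
Proof.
case: uc => _ _ h e; apply/eqP; rewrite -subr_eq0; apply/eqP/h.
by rewrite combD combN e subrr.
Qed.

Lemma coord_comb m : coord (comb c m) = m.
Proof. by apply: comb_inj; rewrite -coordK. Qed.

Lemma coordD x y : coord (x + y) = coord x + coord y.
Proof. by apply: comb_inj; rewrite combD -!coordK. Qed.

Lemma coordN x : coord (- x) = - coord x.
Proof. by apply: comb_inj; rewrite combN -!coordK. Qed.

Lemma coord_c k : coord (c k) = ev k 1.
Proof. by rewrite -[c k]mulr1z -comb_ev coord_comb. Qed.

Lemma coord0 : coord 0 = 0.
Proof. by apply: comb_inj; rewrite -coordK /comb big1 // => k _; rewrite ffunE mulr0z. Qed.

Lemma c_neq0 k : c k != 0.
Proof.
apply/eqP => h; have := coord_c k; rewrite h coord0 => /ffunP /(_ k) /eqP.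
by rewrite !ffunE eqxx mulr1 eq_sym oner_eq0.
Qed.
End Coordinates.

Definition linpre (c : J -> V) (uc : unimod c) (t : V) : pred V :=
  fun x => 0 <= \sum_k t k * coord uc x k.

Lemma oppVE x k : (- x) k = - x k. Proof. by rewrite ffunE. Qed.

Lemma sum_coordN c (uc : unimod c) t x :
  \sum_k t k * coord uc (- x) k = - \sum_k t k * coord uc x k.
Proof. by rewrite -sumrN; apply: eq_bigr => k _; rewrite coordN oppVE mulrN. Qed.

Lemma linpre_gpre c (uc : unimod c) t : gpre (linpre uc t).
Proof.
have e x y : \sum_k t k * coord uc (x + y) k =
    \sum_k t k * coord uc x k + \sum_k t k * coord uc y k.
  by rewrite -big_split; apply: eq_bigr => k _; rewrite coordD ffunE mulrDr.
split=> [|x y|x]; rewrite /linpre.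
- by rewrite big1 // => k _; rewrite coord0 ffunE mulr0.
- by rewrite e; apply: addr_ge0.
by rewrite sum_coordN oppr_ge0 le_total.
Qed.

Lemma linpre_c c (uc : unimod c) t k : \sum_l t l * coord uc (c k) l = t k.
Proof.
rewrite coord_c (bigD1 k) //= ffunE eqxx !mulr1 big1 ?addr0 // => l /negPf h.
by rewrite ffunE h !mulr0.
Qed.

(** A generic point of the facet [c_k = 0]: the remaining coordinates are compared
    lexicographically, so only multiples of [c_k] are equivalent to 0. An integral functional would
    in general annihilate more. *)
Definition lexpre (c : J -> V) (uc : unimod c) (k : J) : pred V :=
  fun x => lexge (coord uc x) [seq l <- enum J | l != k].

Lemma lexpre_gpre c (uc : unimod c) k : gpre (lexpre uc k).
Proof.
split=> [|x y|x]; rewrite /lexpre.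
- by apply: lexge_ge0 => a _; rewrite coord0 ffunE.
- move=> hx hy; rewrite (@eq_lexge _ _ (fun a => coord uc x a + coord uc y a)).
    exact: lexgeD.
  by move=> a; rewrite coordD ffunE.
rewrite (@eq_lexge _ (coord uc (- x)) (fun a => - coord uc x a)) ?lexge_total // => a.
by rewrite coordN ffunE.
Qed.

Lemma lexpre_eq0 c (uc : unimod c) k x : lexpre uc k x -> lexpre uc k (- x) ->
  exists s, x = c k *~ s.
Proof.
rewrite /lexpre (@eq_lexge _ (coord uc (- x)) (fun a => - coord uc x a)) => [h1 h2|a];
  last by rewrite coordN ffunE.
have z := lexge_eq0 h1 h2; exists (coord uc x k).
rewrite -comb_ev [LHS](coordK uc); congr comb; apply/ffunP => l; rewrite ffunE.
have [->|lk] := eqVneq l k; first by rewrite mulr1.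
by rewrite mulr0 z // mem_filter lk mem_enum.
Qed.

Lemma lexpre_wall c (uc : unimod c) k : lexpre uc k (c k) /\ lexpre uc k (- c k).
Proof.
split; rewrite /lexpre; apply: lexge_ge0 => a; rewrite mem_filter => /andP[/negPf ak _].
  by rewrite coord_c ffunE ak mulr0.
by rewrite coordN coord_c !ffunE ak mulr0 oppr0.
Qed.

Lemma lexpre_gt c (uc : unimod c) k l : l != k -> gtV (lexpre uc k) (c l).
Proof.
move=> lk; apply/negP => h.
have h' : lexpre uc k (c l).
  rewrite /lexpre; apply: lexge_ge0 => a _; rewrite coord_c ffunE mul1r; by case: (a == l).
have [s] := lexpre_eq0 h' h => /(congr1 (coord uc)).
rewrite -[c k *~ s]comb_ev coord_comb coord_c => /ffunP /(_ l) /eqP.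
by rewrite !ffunE eqxx (negPf lk) mulr0 mulr1 oner_eq0.
Qed.

(* The facet [c_k = 0] of the chamber of [c] carries a nontrivial wall element,
   whose exponents are nonnegative and, for a generic point of the facet,
   multiples of [c_k]. *)
Lemma facet_sgc N (th : qser (om N)) c (uc : unimod c) k : good th ->
  (forall P, gpre P -> P (c k) -> P (- c k) -> (forall l, l != k -> gtV P (c l)) -> ~ wall_free th P) ->
  sgc (c k).
Proof.
move=> [th0 _ _] wall; apply: contrapT => ns.
have gP := lexpre_gpre uc k; have [w1 w2] := lexpre_wall uc k.
apply: (wall _ gP w1 w2) => [l|]; first exact: lexpre_gt.
pose G : pred E := fun a => lexpre uc k (iv a).
have [e v0 w0 sv sw] := @qfactor _ _ th G predT th0 (conj isT (fun _ _ _ _ => isT)) (fun _ _ => isT).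
exists (fac_v G (fac G th)), (fac_w G (fac G th)); split=> //; last first.
  by apply: supp_sub sw => a /andP[].
apply: supp_sub sv => a /andP[/orP[/eqP ->|ha] _]; rewrite /orz ?eqxx //.
have [//|a0 /=] := eqVneq a 0; apply/negP => ha'; apply: ns.
have [s es] := lexpre_eq0 ha ha'.
have sa j : 0 <= c k j * s by rewrite -scaleVE -es ffunE.
have [s0|s0|s0] := ltgtP s 0; last first.
- move: a0 => /eqP; case; apply/ffunP => j; have /ffunP/(_ j) := es.
  by rewrite s0 mulr0z !ffunE => -[].
- by left=> j; have := sa j; rewrite pmulr_lge0.
by right=> j; have := sa j; rewrite nmulr_lge0.
Qed.

(** If [e_i] had coordinates of both signs in the basis [c], a functional strictly positive on [c]
    would vanish on [e_i], and a point of the chamber would lie on the wall of the axis [i]. *)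
Lemma chamber_side N (th : qser (om N)) c (uc : unimod c) i : good th ->
  (forall P, gpre P -> (forall k, gtV P (c k)) -> wall_free th P) ->
  sgc (coord uc (ev i 1)).
Proof.
move=> gth cham; set m := coord uc (ev i 1); apply: contrapT => ns.
pose Sp := \sum_k (posn (m k))%:Z; pose Sn := \sum_k (posn (- m k))%:Z.
have pos (f : J -> int) k : 0 < f k -> 0 < \sum_l (posn (f l))%:Z.
  move=> h; rewrite (bigD1 k) //= ltr_pwDl ?sumr_ge0 // posn_ge0 //; exact: ltW.
have Sp0 : 0 < Sp.
  apply/negP => /negP; rewrite -leNgt => h; apply: ns; right=> k; rewrite leNgt.
  by apply/negP => /pos; rewrite ltNge h.
have Sn0 : 0 < Sn.
  apply/negP => /negP; rewrite -leNgt => h; apply: ns; left=> k; rewrite leNgt.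
  by apply/negP => hk; have /= := pos (fun l => - m l) k; rewrite oppr_gt0 -/Sn => /(_ hk); rewrite ltNge h.
(* Each sign is weighted by the total mass of the other, so the pairing with [m] cancels; the value
   1 keeps [t] strictly positive where [m] vanishes. *)
pose t : V := [ffun k => if 0 < m k then Sn else if m k < 0 then Sp else 1].
have tm k : t k * m k = Sn * (posn (m k))%:Z - Sp * (posn (- m k))%:Z.
  rewrite ffunE; case: (ltgtP (m k) 0) => h.
  - by rewrite posn_le0 ?(ltW h) // posn_ge0 ?oppr_ge0 ?(ltW h) //; ring.
  - by rewrite posn_ge0 ?(ltW h) // posn_le0 ?oppr_le0 ?(ltW h) //; ring.
  by rewrite h oppr0 posn_le0 // !mulr0 subr0.
have z : \sum_k t k * m k = 0.
  under eq_bigr do rewrite tm.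
  by rewrite sumrB -!mulr_sumr -/Sp -/Sn; ring.
have gP := linpre_gpre uc t.
apply: (triv_wall d_gt0 (i := i) gth gP).
- by rewrite /linpre -/m z.
- by rewrite /linpre sum_coordN -/m z oppr0.
apply: cham => // k; rewrite /gtV /linpre sum_coordN linpre_c oppr_ge0 -ltNge ffunE.
by case: (ltP 0 (m k)) => // _; case: (ltP (m k) 0).
Qed.

End SignCoherence.

(** * Induction on the word *)

Section Main.
Variables (J : finType) (d : J -> nat).
Hypothesis d_gt0 : forall j, (0 < d j)%N.
Local Notation V := {ffun J -> int}.
Local Notation om := (omega d).
Local Notation skewsym := (skewsym d).
Local Notation good := (good (d := d)).
Implicit Types (N : J -> J -> int) (x y m : V) (c : J -> V) (P : pred V) (u w : seq J).

Definition sgb (b : bool) x := forall j, if b then 0 <= x j else x j <= 0.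

Lemma sgcP x : sgc x <-> exists b, sgb b x.
Proof.
split=> [[h|h]|[[] h]]; by [exists true | exists false | left | right].
Qed.

Lemma cmut_sgb b N l c : skewsym N -> sgb b (c l) -> cmut N l c = cstep (sbeta b N l) l c.
Proof. by case: b => sN h; [apply: (cmut_pos sN) | apply: (cmut_neg sN)]. Qed.

(* The preorders positive on the c-vectors form a chamber of the diagram. *)
Record chamber N (th : qser (om N)) w : Prop := Chamber {
  ch_unimod : unimod d (cvec N w);
  ch_compat : compat d N (nmat N w) (cvec N w);
  ch_sgc : forall k, sgc (cvec N w k);
  ch_triv : forall P, gpre P -> (forall k, gtV P (cvec N w k)) -> wall_free th P;
  ch_wall : forall P k, gpre P -> P (cvec N w k) -> P (- cvec N w k) ->
    (forall l, l != k -> gtV P (cvec N w l)) -> ~ wall_free th P }.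

Lemma tauV_RL N i x : tauV i (beta_pos N i) x = tauV i (beta_neg N i) x + ev i (pairV (N i) x).
Proof.
apply/ffunP => j; rewrite !ffunE; have [_|_] := eqVneq j i; last by rewrite mulr0 addr0.
rewrite mulr1 /pairV addrAC -big_split; congr (_ - _); apply: eq_bigr => k _ /=.
rewrite -mulrDl /beta_pos /beta_neg; congr (_ * _); have := posnB (N i k); lia.
Qed.

Lemma tau_cstep i be t l c k :
  tauV i be (cstep t l c k) = cstep t l (fun k => tauV i be (c k)) k.
Proof. by rewrite /cstep; case: eqP => _; rewrite ?tauVN // tauVD tauVZ. Qed.

Lemma bilV_row N i x : bilV (om N) (ev i 1) x = (d i)%:Z * pairV (N i) x.
Proof.
rewrite bilV_evl mul1r /pairV mulr_sumr; apply: eq_bigr => j _.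
by rewrite /omega mulrA.
Qed.

Lemma bilV_om N k l : bilV (om N) (ev k 1) (ev l 1) = om N k l.
Proof.
rewrite bilV_evr mul1r (bigD1 k) //= ffunE eqxx !mul1r big1 ?addr0 // => j /negPf h.
by rewrite ffunE h mulr0 mul0r.
Qed.

Section InitialMutation.
Variables (N : J -> J -> int) (i : J).
Hypothesis sN : skewsym N.
Local Notation N' := (mut i N).
Variables (th : qser (om N)) (th' : qser (om N')).
Hypothesis gth' : good th'.

(** The sign [b] says on which side of the hyperplane of [e_i] the chamber of [w] lies, and the
    reflection of that side carries its c-vectors to those of [i :: w]. Appending a letter [l] keeps
    the side unless [c_l] is a multiple of [e_i]; in that case the new chamber lies across the
    hyperplane and the other reflection takes over. *)
Lemma cvec_cons w :
  (forall u, (size u <= size w)%N -> chamber th' u) ->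
  (forall u, (size u <= size w)%N -> chamber th u) ->
  exists b, (forall k, cvec N (i :: w) k = tauV i (sbeta b N i) (cvec N' w k)) /\
    exists m, ev i 1 = comb (cvec N' w) m /\ sgb b m.
Proof.
have sN' : skewsym N' by apply: skew_mut.
elim/last_ind: w => [|u l IH] ch' ch.
  exists true; split=> [k|]; last first.
    by exists (ev i 1); rewrite comb_c0; split=> // j; rewrite ffunE mul1r.
  rewrite -[[:: i]]/(rcons [::] i) cvec_rcons (@cmut_sgb true) //; last first.
    by move=> j; rewrite ffunE mul1r.
  by rewrite -[LHS]mulr1z -comb_ev comb_cstep ?(adm_sbeta d_gt0 true i sN).2 // comb_c0.
have [b [hb [m [em sm]]]] : exists b, (forall k, cvec N (i :: u) k = tauV i (sbeta b N i) (cvec N' u k)) /\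
    exists m, ev i 1 = comb (cvec N' u) m /\ sgb b m.
  apply: IH => v hv; [apply: ch' | apply: ch]; by rewrite size_rcons (leq_trans hv).
have chu' : chamber th' u by apply: ch'; rewrite size_rcons.
have chu : chamber th (i :: u) by apply: ch; rewrite size_rcons.
have chl' : chamber th' (rcons u l) by apply: ch'.
have sNu : skewsym (nmat N' u) by apply: nmat_skew.
rewrite -rcons_cons !cvec_rcons nmat_cons.
have uc := ch_unimod chu'; have uc2 := ch_unimod chl'.
have [b1 s1] := (sgcP _).1 (ch_sgc chu' l).
have [b2 s2] := (sgcP _).1 (ch_sgc chu l).
rewrite (cmut_sgb sNu s1) (cmut_sgb sNu s2).
rewrite cvec_rcons (cmut_sgb sNu s1) in uc2.
have ea : cvec N (i :: u) = fun k => tauV i (sbeta b N i) (cvec N' u k).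
  by apply/funext => k; apply: hb.
rewrite ea in s2 *; move: s1 s2 em uc uc2 (ch_compat chu').
set c := cvec N' u; set Nu := nmat N' u => s1 s2 em uc uc2 cc.
have t0 b' : sbeta b' Nu l l = 0 by apply: (adm_sbeta d_gt0 b' l sNu).2.
have tge b' k : 0 <= sbeta b' Nu l k by apply: (adm_sbeta d_gt0 b' l sNu).1.
case: (pselect (exists2 j, j != i & c l j != 0)) => [[j ji clj]|none].
  (* The reflection only changes coordinate [i], so the nonzero coordinate [j] of [c_l] shows the
     same sign before and after. *)
  have e12 : b1 = b2.
    have := s1 j; have := s2 j; rewrite ffunE (negPf ji).
    by move: clj; case: (b1); case: (b2) => //=; case: (ltgtP (c l j) 0).
  exists b; split=> [k|]; first by rewrite e12 tau_cstep.
  set t := sbeta b1 Nu l; have tl : t l = 0 by apply: t0.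
  have em' : ev i 1 = comb (cstep t l c) (tauV l t m) by rewrite comb_cstep // tauVK.
  exists (tauV l t m); split=> //.
  have [b3 s3] : exists b3, sgb b3 (tauV l t m).
    apply/sgcP; rewrite -(coord_comb uc2 (tauV l t m)) -em'.
    apply: (chamber_side d_gt0 uc2 i gth') => P gP hP; apply: (ch_triv chl') => // k.
    by rewrite cvec_rcons (cmut_sgb sNu s1); apply: hP.
  (* The new coordinates of [e_i] differ from the old ones only at [l], so a nonzero one elsewhere
     fixes the side. Without one, [e_i] would be a multiple of [c_l], contrary to [clj]. *)
  suff [k [kl mk]] : exists k, k != l /\ m k != 0.
    suff -> : b = b3 by [].
    have := sm k; have := s3 k; rewrite ffunE (negPf kl).
    by move: mk; case: (b); case: (b3) => //=; case: (ltgtP (m k) 0).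
  apply: contrapT => nk; case/eqP: clj.
  have mE : m = ev l (m l).
    apply/ffunP => k; rewrite ffunE; have [->|kl] := eqVneq k l; first by rewrite mulr1.
    by rewrite mulr0; apply/eqP; apply: contrapT => /negP mk; apply: nk; exists k.
  move: em; rewrite mE comb_ev => /ffunP em.
  have := em j; rewrite !ffunE scaleVE (negPf ji) mulr0 => /esym/eqP.
  rewrite mulf_eq0 => /orP[/eqP //|/eqP ml0].
  by have := em i; rewrite ffunE scaleVE eqxx ml0 mulr0.
pose s := c l i.
have clE : c l = ev i s.
  apply/ffunP => j; rewrite ffunE; have [->|ji] := eqVneq j i; first by rewrite mulr1.
  by rewrite mulr0; apply/eqP; apply: contrapT => /negP h; apply: none; exists j.
have sm1 : m *~ s = ev l 1.
  apply: (comb_inj uc); rewrite comb_ev mulr1z clE ev_scale em.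
  by apply/ffunP => j; rewrite scaleVE !combE mulr_suml; apply: eq_bigr => k _; rewrite scaleVE mulrA.
have sml : m l * s = 1 by rewrite -scaleVE sm1 ffunE eqxx.
have s0 : s != 0 by apply/eqP => h; move: sml; rewrite h mulr0.
have mE k : k != l -> m k = 0.
  move=> kl; have := congr1 (fun f : V => f k) sm1; rewrite scaleVE ffunE (negPf kl) mulr0.
  by move=> /eqP; rewrite mulf_eq0 (negPf s0) orbF => /eqP.
(* Both divisibilities come from the clauses of [unimod] on rescaled axes, as [m l] and [s] are
   inverse integers. Equal symmetrizers let [key] pass from forms to matrix entries. *)
have dil : d i = d l.
  apply/eqP; rewrite eqn_dvd; apply/andP; split.
    have [h1 h2 h3] := uc; have [|m' [em' hm']] := h2 (ev i 1) (d i).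
      move=> j; rewrite ffunE mul1r /dvdi; have [->|_] := eqVneq j i; rewrite ?mulr1 ?mulr0 /= ?dvdn0 ?dvdnn //.
    have := hm' l; have -> : m' = m by apply: (comb_inj uc); rewrite -em.
    rewrite /dvdi abszM => h; have : `|m l|%N = 1%N by apply/eqP; rewrite -dvdn1; apply/dvdnP; exists `|s|%N; rewrite -abszM mulrC sml.
    by move=> e; rewrite e muln1 in h.
  have [h1 h2 h3] := uc; have := h1 l i; rewrite -/s /dvdi abszM => h.
  have : `|s|%N = 1%N by apply/eqP; rewrite -dvdn1; apply/dvdnP; exists `|m l|%N; rewrite -abszM sml.
  by move=> e; rewrite e muln1 in h.
have s1' : s = 1 \/ s = -1.
  have : `|s|%N = 1%N by apply/eqP; rewrite -dvdn1; apply/dvdnP; exists `|m l|%N; rewrite -abszM sml.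
  by case: (s) => [[|[|z]]|[|z]] //= _; [left|right].
have eb1 : s = if b1 then 1 else -1.
  by have := s1 i; rewrite -/s; case: (b1); case: s1' => ->.
have al : tauV i (sbeta b N i) (c l) = ev i (- s).
  by rewrite clE tauV_axis // (adm_sbeta d_gt0 b i sN).2.
have eb2 : b2 = ~~ b1.
  have := s2 i; rewrite al ffunE eqxx mulr1 eb1; by case: (b1); case: (b2).
have ml : m l = s by move: sml; case: s1' => ->; rewrite ?mulr1 // mulrN1 => <-; rewrite opprK.
have eb : b = b1.
  by have := sm l; rewrite ml eb1; case: (b); case: (b1).
exists (~~ b); split; last first.
  set t := sbeta b1 Nu l; have tl : t l = 0 by apply: t0.
  have em' : ev i 1 = comb (cstep t l c) (tauV l t m) by rewrite comb_cstep // tauVK.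
  exists (tauV l t m); split=> // k; rewrite ffunE; have [_|kl] := eqVneq k l; last first.
    by rewrite mE //; case: (~~ b).
  have -> : pairV t m = 0.
    rewrite /pairV big1 // => k' _; have [->|h] := eqVneq k' l; first by rewrite tl mul0r.
    by rewrite mE // mulr0.
  by rewrite sub0r ml eb1 eb; case: (b1).
move=> k; rewrite tau_cstep /cstep; have [_|kl] := eqVneq k l.
  by rewrite al clE tauV_axis // (adm_sbeta d_gt0 _ i sN).2.
have key : pairV (N i) (c k) = - (s * Nu l k).
  have : bilV (om N') (c l) (c k) = om Nu l k.
    by rewrite -bilV_om -cc !comb_ev !mulr1z.
  rewrite clE ev_scale.
  have -> : bilV (om N') (ev i 1 *~ s) (c k) = s * bilV (om N') (ev i 1) (c k).
    by rewrite -ev_scale !bilV_evl; ring.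
  rewrite bilV_row /omega -dil.
  have -> : pairV (N' i) (c k) = - pairV (N i) (c k).
    by rewrite /pairV -sumrN; apply: eq_bigr => j _; rewrite (mut_row d_gt0 i j sN) mulNr.
  move=> h; have d0 : (d i)%:Z != 0 by rewrite eqz_nat -lt0n.
  have h' : s * - pairV (N i) (c k) = Nu l k.
    by apply: (mulfI d0); rewrite -h; ring.
  by rewrite -h'; case: s1' => ->; ring.
rewrite al clE tauV_axis ?(adm_sbeta d_gt0 _ i sN).2 //.
have dif : tauV i (sbeta b N i) (c k) = tauV i (sbeta (~~ b) N i) (c k) + ev i (- Nu l k).
  rewrite eb; case: (b1) eb1 => /= es.
    by rewrite tauV_RL key es mul1r.
  rewrite tauV_RL key es; apply/ffunP => j; rewrite !ffunE; ring.
rewrite dif -addrA; congr (_ + _); rewrite (ev_scale i (- Nu l k)) (ev_scale i (- s)) -!mulrzA.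
rewrite -mulrzDr; congr (_ *~ _); rewrite eb2.
have pB := posnB (Nu l k).
have -> : sbeta (~~ b1) Nu l k = sbeta b1 Nu l k - s * Nu l k.
  rewrite eb1 /sbeta /beta_pos /beta_neg; move: pB; case: (b1) => /=; lia.
by case: s1' => ->; ring.
Qed.

End InitialMutation.

Lemma triv_mut b N N' (th : qser (om N)) (th' : qser (om N')) i P :
  skewsym N -> mutadj d i N N' -> mutrel i th th' -> gpre P ->
  (if b then ltV P (ev i 1) else gtV P (ev i 1)) -> wall_free th P ->
  wall_free th' (fun x => P (tauV i (sbeta b N i) x)).
Proof. by case: b => sN adj rel gP h; [apply: (triv_mutR d_gt0) | apply: (triv_mutL d_gt0)]. Qed.

Lemma sgb_ge b P c m : gpre P -> sgb b m -> (forall k, P (c k)) ->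
  if b then P (comb c m) else P (- comb c m).
Proof.
by case: b => gP sm Pc; rewrite -?combN; apply: comb_ge => // k; rewrite ?oppVE ?oppr_ge0; apply: sm.
Qed.

Lemma sgb_gt b P c m k : gpre P -> sgb b m -> (forall k, gtV P (c k)) -> m k != 0 ->
  if b then gtV P (comb c m) else ltV P (comb c m).
Proof.
move=> gP; have Pc' := gtV_ge gP; case: b => sm Pc mk.
  apply: (@comb_gt _ _ _ _ k gP) => // [l|]; first exact: Pc'.
  by rewrite lt_neqAle eq_sym mk sm.
have := @comb_gt _ P c (- m) k gP (fun l => Pc' _ (Pc l)); rewrite combN {2}/gtV opprK; apply=> [l||].
- by rewrite oppVE oppr_ge0; apply: sm.
- exact: Pc.
by rewrite oppVE oppr_gt0 lt_neqAle mk; apply: sm.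
Qed.

Lemma chamber_nil N (th : qser (om N)) : skewsym N -> good th -> chamber th [::].
Proof.
move=> sN gth; split.
- exact: unimod_c0.
- exact: compat_c0.
- by move=> k; left=> j; rewrite ffunE mul1r.
- by move=> P gP h; apply: triv_pos.
by move=> P k gP h1 h2 _; apply: (triv_wall d_gt0 gth gP h1 h2).
Qed.

Lemma chamber_rcons N (th : qser (om N)) u l : skewsym N -> chamber th u ->
  unimod d (cvec N (rcons u l)) /\ compat d N (nmat N (rcons u l)) (cvec N (rcons u l)).
Proof.
move=> sN ch; have sNu : skewsym (nmat N u) by apply: nmat_skew.
have [b s] := (sgcP _).1 (ch_sgc ch l).
rewrite cvec_rcons nmat_rcons (cmut_sgb sNu s); split.
  by apply: unimod_cstep => //; apply: (ch_unimod ch).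
by apply: compat_cstep => //; apply: (ch_compat ch).
Qed.

(** The tail [w] is known for the mutated series, and [cvec_cons] together with [triv_mut] brings
    its chamber and walls back through the reflection of the first letter. Sign coherence is then
    read off from the walls by [facet_sgc]. *)
Lemma chamberP N (th : qser (om N)) w : skewsym N -> good th -> chamber th w.
Proof.
have [n] := ubnP (size w); elim: n w N th => // n IH [|i w] N th hw sN gth; first exact: chamber_nil.
rewrite ltnS /= in hw.
pose N' := mut i N; pose th' := mutser i th.
have sN' : skewsym N' by apply: skew_mut.
have gth' : good th' by apply: mutser_good.
have adj := mutadj_mut d_gt0 i sN; have adj' := mutadj_sym d_gt0 sN adj.
have rel := mutrel_mut d_gt0 i sN gth; have rel' := mutrel_sym d_gt0 sN adj rel.
have ch' : chamber th' w by apply: IH.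
have [b [hb [m [em sm]]]] : exists b, (forall k, cvec N (i :: w) k = tauV i (sbeta b N i) (cvec N' w k)) /\
    exists m, ev i 1 = comb (cvec N' w) m /\ sgb b m.
  by apply: (cvec_cons sN (th := th) gth') => u hu; apply: IH => //; apply: leq_ltn_trans hw.
have bi : sbeta b N i i = 0 by apply: (adm_sbeta d_gt0 b i sN).2.
(* The basis properties come from the other end: drop the last letter and use the chamber of the
   shorter word for the same [th]. *)
have [uc cc] : unimod d (cvec N (i :: w)) /\ compat d N (nmat N (i :: w)) (cvec N (i :: w)).
  rewrite lastI; apply: (@chamber_rcons _ th) => //; apply: IH => //.
  by rewrite size_belast.
have [k0 mk0] : exists k, m k != 0.
  apply: contrapT => h; have : m = 0.
    by apply/ffunP => k; rewrite ffunE; apply/eqP; apply: contrapT => /negP hk; apply: h; exists k.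
  move=> m0; move: em; rewrite m0 /comb big1 => [/ffunP /(_ i)|k _]; last by rewrite ffunE mulr0z.
  by rewrite !ffunE eqxx.
pose P' (P : pred V) : pred V := fun x => P (tauV i (sbeta b N i) x).
have gP' P : gpre P -> gpre (P' P) by apply: gpre_tau.
have PP P : (fun x => P' P (tauV i (sbeta b N i) x)) = P.
  by apply/funext => x /=; rewrite /P' tauVK.
have Pe P : P' P (ev i 1) = P (- ev i 1).
  by rewrite /P' tauV_axis //; congr P; apply/ffunP => j; rewrite !ffunE mulNr.
have Pe' P : P' P (- ev i 1) = P (ev i 1).
  rewrite /P' tauVN tauV_axis //; congr P; apply/ffunP => j; rewrite !ffunE; ring.
have wall P k : gpre P -> P (cvec N (i :: w) k) -> P (- cvec N (i :: w) k) ->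
    (forall l, l != k -> gtV P (cvec N (i :: w) l)) -> ~ wall_free th P.
  move=> gP h1 h2 h3 tr; have g' := gP' P gP.
  have h1' : P' P (cvec N' w k) by rewrite /P' -hb.
  have h2' : P' P (- cvec N' w k) by rewrite /P' tauVN -hb.
  have h3' l : l != k -> gtV (P' P) (cvec N' w l) by move=> lk; rewrite /gtV /P' tauVN -hb; apply: h3.
  have ge l : P' P (cvec N' w l).
    by have [->//|lk] := eqVneq l k; apply: gtV_ge => //; apply: h3'.
  apply: (ch_wall ch' g' h1' h2' h3').
  case: (boolP (P (ev i 1) && P (- ev i 1))) => [/andP[p1 p2]|].
    by case: (triv_wall d_gt0 gth gP p1 p2 tr).
  rewrite negb_and => np; apply: (@triv_mut b _ _ th) => //.
  have := sgb_ge g' sm ge; rewrite -em Pe Pe'; move: np; rewrite /ltV /gtV.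
  by case: (b); do 2 case: (P _).
split=> //.
- by move=> k; apply: (facet_sgc uc gth) => P; apply: wall.
move=> P gP pos; have g' := gP' P gP.
have pos' k : gtV (P' P) (cvec N' w k) by rewrite /gtV /P' tauVN -hb; apply: pos.
(* Now transport runs from [th'] to [th], so the reflection is named by the opposite sign of the
   mutated matrix. *)
rewrite -(PP P); have -> : sbeta b N i = sbeta (~~ b) N' i.
  by have [e1 e2 _ _] := adj; case: (b); rewrite /sbeta /= ?e1 ?e2.
apply: (@triv_mut (~~ b) _ _ th') => //; last exact: (ch_triv ch').
by have := sgb_gt g' sm pos' mk0; rewrite -em; case: (b).
Qed.

Theorem sign_coherence N w : skewsym N -> forall k,
  cvec N w k != 0 /\ ((forall j, 0 <= cvec N w k j) \/ (forall j, cvec N w k j <= 0)).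
Proof.
move=> sN k; have [th gth] := good_exists sN.
have ch := chamberP w sN gth; split; last exact: (ch_sgc ch).
exact: (c_neq0 (ch_unimod ch)).
Qed.

End Main.

(** * Substitution in rational functions *)

Section Fractions.
Variable R : idomainType.

Lemma frac_numden (h : {fraction R}) :
  h = @FracField.tofrac R \n_(repr h) / @FracField.tofrac R \d_(repr h).
Proof.
have d0 : @FracField.tofrac R \d_(repr h) != 0 by rewrite tofrac_eq0 denom_ratioP.
apply: (mulIf d0); rewrite divfK //.
rewrite -{1}[h]reprK; unlock FracField.tofrac; rewrite -[LHS]FracField.pi_mul.
apply/eqmodP; rewrite /= FracField.equivfE /FracField.mulf.
by rewrite !numden_Ratio ?mulr1 ?oner_eq0 ?denom_ratioP // mulrC.
Qed.

End Fractions.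

Section PartialEvaluation.
Variables (R : idomainType) (F : fieldType) (phi : {rmorphism R -> F}).
Local Notation K := {fraction R}.
Local Notation tofrac := (@FracField.tofrac R).
Implicit Types (h g : K) (p q : R).

(** The local ring at the kernel of [phi], which may be nonzero: the residue at [X = 0] is such an
    evaluation. Outside it [peval] returns 0. *)
Definition pdom h := exists p q, phi q != 0 /\ h = tofrac p / tofrac q.

Definition peval h : F :=
  if pselect (exists pq : R * R, phi pq.2 != 0 /\ h = tofrac pq.1 / tofrac pq.2) is left e
  then phi (projT1 (cid e)).1 / phi (projT1 (cid e)).2 else 0.

Lemma phi_neq0 q : phi q != 0 -> tofrac q != 0.
Proof. by rewrite tofrac_eq0; apply: contraNneq => ->; rewrite rmorph0. Qed.

Lemma pevalE p q : phi q != 0 -> peval (tofrac p / tofrac q) = phi p / phi q.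
Proof.
move=> q0; rewrite /peval; case: pselect => [e|[]]; last by exists (p, q).
case: (cid e) => -[p' q'] /= [q'0 /eqP].
rewrite eqr_div ?phi_neq0 // -!rmorphM tofrac_eq => /eqP h.
by apply/eqP; rewrite eqr_div // -!rmorphM h.
Qed.

Lemma pdom_frac p : pdom (tofrac p).
Proof. by exists p, 1; rewrite !rmorph1 oner_eq0 divr1. Qed.

Lemma peval_frac p : peval (tofrac p) = phi p.
Proof. by rewrite -[tofrac p]divr1 -(rmorph1 tofrac) pevalE rmorph1 ?oner_eq0 // divr1. Qed.

Lemma pdomD h g : pdom h -> pdom g -> pdom (h + g) /\ peval (h + g) = peval h + peval g.
Proof.
move=> [p [q [q0 ->]]] [p' [q' [q'0 ->]]].
have -> : tofrac p / tofrac q + tofrac p' / tofrac q' =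
    tofrac (p * q' + p' * q) / tofrac (q * q').
  by rewrite addf_div ?phi_neq0 // -!rmorphM -rmorphD.
have qq : phi (q * q') != 0 by rewrite rmorphM mulf_neq0.
split; first by exists (p * q' + p' * q), (q * q').
by rewrite !pevalE // addf_div // rmorphD !rmorphM.
Qed.

Lemma pdomM h g : pdom h -> pdom g -> pdom (h * g) /\ peval (h * g) = peval h * peval g.
Proof.
move=> [p [q [q0 ->]]] [p' [q' [q'0 ->]]].
have -> : tofrac p / tofrac q * (tofrac p' / tofrac q') =
    tofrac (p * p') / tofrac (q * q').
  by rewrite mulf_div -!rmorphM.
have qq : phi (q * q') != 0 by rewrite rmorphM mulf_neq0.
split; first by exists (p * p'), (q * q').
by rewrite !pevalE // mulf_div !rmorphM.
Qed.

Lemma pdomV h : pdom h -> peval h != 0 -> pdom h^-1 /\ peval h^-1 = (peval h)^-1.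
Proof.
move=> [p [q [q0 ->]]]; rewrite pevalE // => h0.
have p0 : phi p != 0 by apply: contraNneq h0 => ->; rewrite mul0r.
by rewrite !invf_div; split; [exists q, p | rewrite pevalE].
Qed.

Lemma pdom1 : pdom 1 /\ peval 1 = 1.
Proof. by rewrite -(rmorph1 tofrac); split; [apply: pdom_frac | rewrite peval_frac rmorph1]. Qed.

Lemma pdom0 : pdom 0 /\ peval 0 = 0.
Proof. by rewrite -(rmorph0 tofrac); split; [apply: pdom_frac | rewrite peval_frac rmorph0]. Qed.

Lemma pdomX h n : pdom h -> pdom (h ^+ n) /\ peval (h ^+ n) = peval h ^+ n.
Proof.
move=> dh; elim: n => [|n [IH1 IH2]]; first by rewrite !expr0; apply: pdom1.
by rewrite !exprS; have [h1 h2] := pdomM dh IH1; rewrite h2 IH2.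
Qed.

Lemma pdomXz h (z : int) : pdom h -> (0 <= z) || (peval h != 0) ->
  pdom (h ^ z) /\ peval (h ^ z) = peval h ^ z.
Proof.
move=> dh; case: z => n /=; first by move=> _; apply: pdomX.
move=> h0; have [h1 h2] := pdomX n.+1 dh.
have e0 : peval (h ^+ n.+1) != 0 by rewrite h2 expf_neq0.
by have [h3 h4] := pdomV h1 e0; rewrite NegzE -!exprnN h4 h2.
Qed.

Lemma pdom_prod (I : Type) (s : seq I) (f : I -> K) : (forall x, pdom (f x)) ->
  pdom (\prod_(x <- s) f x) /\ peval (\prod_(x <- s) f x) = \prod_(x <- s) peval (f x).
Proof.
move=> df; elim: s => [|x s [IH1 IH2]]; first by rewrite !big_nil; apply: pdom1.
by rewrite !big_cons; have [h1 h2] := pdomM (df x) IH1; rewrite h2 IH2.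
Qed.

Lemma pdom_inj h : injective phi -> pdom h.
Proof.
move=> inj; exists \n_(repr h), \d_(repr h); split; last exact: frac_numden.
by rewrite -(rmorph0 phi) (inj_eq inj) denom_ratioP.
Qed.

Lemma peval_inj h : injective phi -> peval h = phi \n_(repr h) / phi \d_(repr h).
Proof.
move=> inj; rewrite {1}(frac_numden h) pevalE //.
by rewrite -(rmorph0 phi) (inj_eq inj) denom_ratioP.
Qed.

End PartialEvaluation.

Section Ratfun.
Variables (k : fieldType) (r : nat).
Local Notation K := (ratfun k r).
Local Notation tofrac := (@FracField.tofrac {mpoly k[r]}).

HB.instance Definition _ := GRing.RMorphism.copy (@rconst k r) (tofrac \o @mpolyC r k).

Lemma mpoly_ring_ind (Q : {mpoly k[r]} -> Prop) :
  (forall c, Q c%:MP) -> (forall i, Q 'X_i) -> (forall p q, Q p -> Q q -> Q (p + q)) ->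
  (forall p q, Q p -> Q q -> Q (p * q)) -> forall p, Q p.
Proof.
move=> QC QX QD QM p; rewrite (mpolyE p).
apply: (big_ind Q) => [||m _]; [by rewrite -mpolyC0; apply: QC | exact: QD |].
rewrite -mul_mpolyC; apply: (QM _ _) => //; rewrite mpolyXE_id.
apply: (big_ind Q) => [||i _]; [by rewrite -mpolyC1; apply: QC | exact: QM |].
elim: (m i) => [|n IH]; first by rewrite expr0 -mpolyC1; apply: QC.
by rewrite exprS; apply: QM.
Qed.

Definition xvar i : K := tofrac 'X_i.

Lemma xvar_neq0 i : xvar i != 0.
Proof.
rewrite tofrac_eq0; apply/eqP => /(congr1 (mcoeff U_(i))).
by rewrite mcoeffXU eqxx mcoeff0 => /eqP; rewrite oner_eq0.
Qed.

Lemma lmonomE (a : 'rV[int]_r) : lmonom k a = \prod_i xvar i ^ a 0 i.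
Proof. by []. Qed.

Lemma lmonom_neq0 a : lmonom k a != 0 :> K.
Proof. by apply/prodf_neq0 => i _; apply: expfz_neq0; apply: xvar_neq0. Qed.

Lemma lmonomD a b : lmonom k (a + b) = lmonom k a * lmonom k b :> K.
Proof.
rewrite /lmonom -big_split; apply: eq_bigr => i _ /=.
by rewrite mxE expfzDr // xvar_neq0.
Qed.

Lemma lmonom0 : lmonom k 0 = 1 :> K.
Proof. by rewrite /lmonom big1 // => i _; rewrite mxE expr0z. Qed.

Lemma lmonomN a : lmonom k (- a) = (lmonom k a)^-1 :> K.
Proof.
by apply: (mulfI (lmonom_neq0 a)); rewrite -lmonomD subrr lmonom0 divff // lmonom_neq0.
Qed.

Lemma lmonomX a n : lmonom k (a *+ n) = lmonom k a ^+ n :> K.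
Proof. by elim: n => [|n IH]; rewrite ?mulr0n ?expr0 ?lmonom0 // mulrS lmonomD IH exprS. Qed.

Lemma lmonomXz a (z : int) : lmonom k (a *~ z) = lmonom k a ^ z :> K.
Proof.
case: z => n; first by rewrite -pmulrn lmonomX.
by rewrite NegzE mulrNz lmonomN -pmulrn lmonomX exprnN.
Qed.

Lemma lmonom_delta i : lmonom k (delta_mx 0 i) = xvar i :> K.
Proof.
rewrite lmonomE (bigD1 i) //= mxE !eqxx expr1z big1 ?mulr1 // => j /negPf h.
by rewrite mxE h andbF expr0z.
Qed.

Section Eval.
Variables (F : fieldType) (f : {rmorphism k -> F}) (u : 'I_r -> F).
Local Notation phi := (mmap f u).

Lemma phiX i : phi 'X_i = u i.
Proof. by rewrite mmapX mmap1U. Qed.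

Lemma pdom_const c : pdom phi (rconst r c) /\ peval phi (rconst r c) = f c.
Proof. by split; [apply: pdom_frac | rewrite peval_frac /= mmapC]. Qed.

Lemma pdom_xvar i : pdom phi (xvar i) /\ peval phi (xvar i) = u i.
Proof. by split; [apply: pdom_frac | rewrite peval_frac /= phiX]. Qed.

Lemma pdom_lmonom (a : 'rV[int]_r) : (forall i, (0 <= a 0 i) || (u i != 0)) ->
  pdom phi (lmonom k a) /\ peval phi (lmonom k a) = \prod_i u i ^ a 0 i.
Proof.
move=> h; have hi i : pdom phi (xvar i ^ a 0 i) /\ peval phi (xvar i ^ a 0 i) = u i ^ a 0 i.
  have [h1 h2] := pdom_xvar i; rewrite -h2; apply: pdomXz => //; by rewrite h2.
have [h1 h2] := @pdom_prod _ _ phi _ (index_enum _) (fun i => xvar i ^ a 0 i) (fun i => (hi i).1).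
by split=> //; rewrite -/(lmonom k a) in h2; rewrite h2; apply: eq_bigr => i _; rewrite (hi i).2.
Qed.

End Eval.
End Ratfun.

(** * Mutations as automorphisms of the function field *)

Section MutationAutomorphism.
Variables (k : fieldType) (r : nat).
Local Notation K := (ratfun k r).
Local Notation tofrac := (@FracField.tofrac {mpoly k[r]}).
Variables (v : 'rV[int]_r) (H : 'I_r -> int).

Definition hval (a : 'rV[int]_r) : int := \sum_i a 0 i * H i.

Hypothesis hv0 : hval v = 0.
Let g : K := 1 + lmonom k v.
Hypothesis g_neq0 : g != 0.

Lemma hvalD a b : hval (a + b) = hval a + hval b.
Proof. by rewrite /hval -big_split; apply: eq_bigr => i _; rewrite mxE mulrDl. Qed.

Lemma hvalMz a z : hval (a *~ z) = z * hval a.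
Proof.
rewrite /hval mulr_sumr; apply: eq_bigr => i _.
by rewrite -scaler_int mxE intz mulrA.
Qed.

Definition mutvar (s : int) (i : 'I_r) : K := xvar k i * g ^ (s * H i).

Local Notation phi s := (mmap (@rconst k r) (mutvar s)).

Lemma mutvar_neq0 s i : mutvar s i != 0.
Proof. by rewrite mulf_neq0 ?xvar_neq0 ?expfz_neq0. Qed.

Lemma mut_lmonom s a : pdom (phi s) (lmonom k a) /\
  peval (phi s) (lmonom k a) = lmonom k a * g ^ (s * hval a).
Proof.
have [|h1 h2] := @pdom_lmonom k r K (@rconst k r) (mutvar s) a.
  by move=> i; rewrite mutvar_neq0 orbT.
split=> //; rewrite h2 lmonomE.
have -> : g ^ (s * hval a) = \prod_i g ^ (s * H i * a 0 i).
  rewrite /hval mulr_sumr.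
  rewrite (@big_morph _ _ (exprz g) 1 *%R 0 +%R) // => [|x y]; last by rewrite expfzDr.
  by apply: eq_bigr => i _; congr (_ ^ _); ring.
by rewrite -big_split; apply: eq_bigr => i _; rewrite /mutvar expfzMl exprz_exp.
Qed.

(** The condition [hval v = 0] makes the binomial invariant, so the substitutions for [s] and [- s]
    undo each other; injectivity and the automorphism property follow. *)
Lemma mut_g s : pdom (phi s) g /\ peval (phi s) g = g.
Proof.
have [h1 h2] := mut_lmonom s v; have [o1 o2] := pdom1 (phi s).
have [h3 h4] := pdomD o1 h1; split=> //.
by rewrite h4 o2 h2 hv0 mulr0 expr0z mulr1.
Qed.

Lemma phiK s (P : {mpoly k[r]}) :
  pdom (phi (- s)) (phi s P) /\ peval (phi (- s)) (phi s P) = tofrac P.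
Proof.
apply: (mpoly_ring_ind (Q := fun P => pdom (phi (- s)) (phi s P) /\
  peval (phi (- s)) (phi s P) = tofrac P)) => [c|i|p q [p1 p2] [q1 q2]|p q [p1 p2] [q1 q2]].
- by rewrite mmapC; apply: pdom_const.
- rewrite phiX; have [x1 x2] := @pdom_xvar k r K (@rconst k r) (mutvar (- s)) i.
  have [g1 g2] := mut_g (- s).
  have [|g3 g4] := @pdomXz _ _ (phi (- s)) g (s * H i) g1; first by rewrite g2 g_neq0 orbT.
  have [m1 m2] := pdomM x1 g3; split=> //.
  by rewrite m2 x2 g4 g2 /mutvar -mulrA -expfzDr // mulNr addNr expr0z mulr1.
- by rewrite !rmorphD /=; have [h1 h2] := pdomD p1 q1; split=> //; rewrite h2 p2 q2.
by rewrite !rmorphM /=; have [h1 h2] := pdomM p1 q1; split=> //; rewrite h2 p2 q2.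
Qed.

Lemma phi_inj s : injective (phi s).
Proof.
move=> P Q e; apply/eqP; rewrite -tofrac_eq; apply/eqP.
by rewrite -(phiK s P).2 -(phiK s Q).2 /= e.
Qed.

Definition mutauto s : K -> K := ratfun_subst (mutvar s).

Lemma mutautoE s h : mutauto s h = peval (phi s) h.
Proof. by rewrite /mutauto /ratfun_subst (peval_inj _ (phi_inj (s := s))). Qed.

Lemma pdom_mut s h : pdom (phi s) h. Proof. exact: pdom_inj (@phi_inj s). Qed.

Lemma mutautoD s h h' : mutauto s (h + h') = mutauto s h + mutauto s h'.
Proof. by rewrite !mutautoE (pdomD (pdom_mut s h) (pdom_mut s h')).2. Qed.

Lemma mutautoM s h h' : mutauto s (h * h') = mutauto s h * mutauto s h'.
Proof. by rewrite !mutautoE (pdomM (pdom_mut s h) (pdom_mut s h')).2. Qed.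

Lemma mutauto_const s c : mutauto s (rconst r c) = rconst r c.
Proof. by rewrite mutautoE; have [_ ->] := @pdom_const k r K (@rconst k r) (mutvar s) c. Qed.

Lemma mutauto_lmonom s a : mutauto s (lmonom k a) = lmonom k a * g ^ (s * hval a).
Proof. by rewrite mutautoE (mut_lmonom s a).2. Qed.

Lemma mutautoK s h : mutauto (- s) (mutauto s h) = h.
Proof.
rewrite [mutauto s h]mutautoE (peval_inj _ (phi_inj (s := s))).
rewrite [RHS](frac_numden h) mutautoE.
have [n1 n2] := phiK s \n_(repr h); have [d1 d2] := phiK s \d_(repr h).
have [|d3 d4] := pdomV d1; first by rewrite d2 tofrac_eq0 denom_ratioP.
by have [m1 ->] := pdomM n1 d3; rewrite n2 d4 d2.
Qed.

End MutationAutomorphism.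

(** * Glueing *)

Section SpecTheory.
Variables (K : fieldType).
Implicit Types (A B : set K).

Definition subring_set A :=
  [/\ A 1, forall a b, A a -> A b -> A (a + b), forall a, A a -> A (- a) &
      forall a b, A a -> A b -> A (a * b)].

Lemma spec_ext A (p q : spec A) : ideal p = ideal q -> p = q.
Proof.
case: p q => [p hp] [q hq] /= e; rewrite e in hp *; congr Spec; exact: Prop_irrelevance.
Qed.

Lemma subring_exp A a n : subring_set A -> A a -> A (a ^+ n).
Proof.
by case=> A1 _ _ AM Aa; elim: n => [|n IH]; rewrite ?expr0 // exprS; apply: AM.
Qed.

Section Prime.
Variables (A : set K) (p : spec A).
Hypothesis sA : subring_set A.

Lemma prime_sub a : ideal p a -> A a.
Proof. by case: (idealP p) => -[h _ _] _ _ _; apply: h. Qed.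

Lemma prime0 : ideal p 0. Proof. by case: (idealP p) => -[]. Qed.
Lemma prime1 : ~ ideal p 1. Proof. by case: (idealP p) => -[]. Qed.

Lemma primeD a b : ideal p a -> ideal p b -> ideal p (a + b).
Proof. by case: (idealP p) => _ h _ _; apply: h. Qed.

Lemma primeMl a b : A a -> ideal p b -> ideal p (a * b).
Proof. by case: (idealP p) => _ _ h _; apply: h. Qed.

Lemma primeMr a b : ideal p a -> A b -> ideal p (a * b).
Proof. by rewrite mulrC => h h'; apply: primeMl. Qed.

Lemma prime_split a b : A a -> A b -> ideal p (a * b) -> ideal p a \/ ideal p b.
Proof. by case: (idealP p) => _ _ _ h; apply: h. Qed.

Lemma primeN a : ideal p a -> ideal p (- a).
Proof.
have [A1 _ AN _] := sA.
by move=> h; rewrite -mulN1r; apply: primeMl => //; apply: AN.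
Qed.

Lemma prime_exp a n : A a -> ~ ideal p a -> ~ ideal p (a ^+ n).
Proof.
move=> Aa na; elim: n => [|n IH]; first by rewrite expr0; apply: prime1.
by rewrite exprS => /prime_split []//; apply: subring_exp.
Qed.

Lemma prime_mul_exp a g n : A a -> A g -> ~ ideal p g -> ideal p (a * g ^+ n) -> ideal p a.
Proof.
move=> Aa Ag ng /prime_split []//; first exact: subring_exp.
by move=> h; case: (prime_exp Ag ng h).
Qed.

End Prime.

Lemma zopenT A : subring_set A -> zopen (setT : set (spec A)).
Proof.
case=> A1 _ _ _; exists [set 1]; split; first by move=> a ->.
by apply/seteqP; split=> // p _; exists 1 => //; apply: prime1.
Qed.

Lemma zopenI A (U V : set (spec A)) : subring_set A -> zopen U -> zopen V -> zopen (U `&` V).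
Proof.
move=> sA [E [EA ->]] [F [FA ->]]; have [_ _ _ AM] := sA.
exists [set x | exists a b, [/\ E a, F b & x = a * b]]; split.
  by move=> x [a [b [Ea Fb ->]]]; apply: AM; [apply: EA | apply: FA].
apply/seteqP; split=> p /=.
  move=> [[a Ea na] [b Fb nb]]; exists (a * b); first by exists a, b.
  by move=> h; case: (prime_split (EA a Ea) (FA b Fb) h).
move=> [x [a [b [Ea Fb ->]]] h]; split; [exists a => // | exists b => //] => h'; apply: h.
  by apply: primeMr => //; apply: FA.
by apply: primeMl => //; apply: EA.
Qed.

Lemma zopen_bigcup A (I : Type) (D : set I) (U : I -> set (spec A)) :
  (forall i, D i -> zopen (U i)) -> zopen (\bigcup_(i in D) U i).
Proof.
move=> h; exists [set a | A a /\ exists2 i, D i & forall p : spec A, ~ ideal p a -> U i p].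
split; first by move=> a [].
apply/seteqP; split=> p /=.
  move=> [i Di Uip]; have [E [EA e]] := h i Di; move: Uip; rewrite e => -[a Ea na].
  by exists a => //; split; [apply: EA | exists i => // q nq; rewrite e; exists a].
by move=> [a [_ [i Di hi]] na]; exists i => //; apply: hi.
Qed.

Lemma zopenD A a : A a -> zopen [set p : spec A | ~ ideal p a].
Proof.
move=> Aa; exists [set a]; split; first by move=> _ ->.
by apply/seteqP; split=> p /= => [h|[_ ->]//]; exists a.
Qed.

(* [psi] and [psi'] are inverse automorphisms of [K] that identify [A'] and [A]
   after inverting [g]. *)
Record local_iso A A' (psi psi' : K -> K) (g : K) : Prop := LocalIso {
  li_A : subring_set A; li_A' : subring_set A';
  li_D : {morph psi : x y / x + y}; li_M : {morph psi : x y / x * y};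
  li_D' : {morph psi' : x y / x + y}; li_M' : {morph psi' : x y / x * y};
  li_K : cancel psi psi'; li_K' : cancel psi' psi;
  li_g : psi g = g; li_Ag : A g; li_A'g : A' g;
  li_b : forall a, A' a -> exists N, A (psi a * g ^+ N);
  li_b' : forall a, A a -> exists N, A' (psi' a * g ^+ N) }.

Lemma local_iso_sym A A' psi psi' g : local_iso A A' psi psi' g -> local_iso A' A psi' psi g.
Proof. by case=> sA sA' D M D' M' K1 K2 gg Ag A'g b b'; split=> //; rewrite -{1}gg K1. Qed.

Section LocalIso.
Variables (A A' : set K) (psi psi' : K -> K) (g : K).
Hypothesis li : local_iso A A' psi psi' g.

Let sA := li_A li. Let sA' := li_A' li.
Let AM : forall a b, A a -> A b -> A (a * b). Proof. by case: sA. Qed.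
Let AD : forall a b, A a -> A b -> A (a + b). Proof. by case: sA. Qed.
Let Ag n : A (g ^+ n). Proof. by apply: subring_exp; [apply: (li_A li) | apply: (li_Ag li)]. Qed.

Lemma psi0 : psi 0 = 0.
Proof.
have h : psi 0 + psi 0 = psi 0 + 0 by rewrite -(li_D li) !addr0.
exact: addrI h.
Qed.

Lemma psi1 : psi 1 = 1.
Proof.
have h : psi 1 * psi 1 = psi 1 * 1 by rewrite -(li_M li) !mulr1.
apply: mulfI h; apply/eqP; rewrite -psi0 => /(can_inj (li_K li)) /eqP.
by rewrite oner_eq0.
Qed.

Lemma psiX n : psi (g ^+ n) = g ^+ n.
Proof. by elim: n => [|n IH]; rewrite ?expr0 ?psi1 // !exprS (li_M li) IH (li_g li). Qed.

Lemma psiV a : psi a^-1 = (psi a)^-1.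
Proof.
have [->|a0] := eqVneq a 0; first by rewrite invr0 psi0 invr0.
have h : psi a * psi a^-1 = 1 by rewrite -(li_M li) divff // psi1.
have pa : psi a != 0 by apply/eqP => e; move: h; rewrite e mul0r => /eqP; rewrite eq_sym oner_eq0.
by apply: (mulfI pa); rewrite h divff.
Qed.

(** The preimage under [psi] of the extension of [p] to the localization at [g], with denominators
    cleared by powers of [g]. *)
Definition push_ideal (p : spec A) : set K :=
  [set a | A' a /\ exists N, ideal p (psi a * g ^+ N)].

Lemma push_prime (p : spec A) : ~ ideal p g -> is_prime A' (push_ideal p).
Proof.
move=> ng; have [A'1 A'D _ A'M] := sA'; split.
- split; first by move=> a [].
    split; last by exists 0%N; rewrite psi0 mul0r; apply: prime0.
    by rewrite -(subrr 1); apply: A'D => //; case: sA' => _ _ h _; apply: h.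
  move=> [_ [N]]; rewrite psi1 mul1r; apply: prime_exp => //; exact: (li_Ag li).
- move=> a b [Aa [N hN]] [Ab [M hM]]; split; first exact: A'D.
  exists (N + M)%N; rewrite (li_D li) mulrDl exprD; apply: primeD.
    by rewrite mulrA; apply: primeMr.
  by rewrite [g ^+ N * _]mulrC mulrA; apply: primeMr.
- move=> a b Aa [Ab [M hM]]; split; first exact: A'M.
  have [N hN] := li_b li Aa; exists (N + M)%N.
  by rewrite (li_M li) exprD mulrACA; apply: primeMl.
move=> a b Aa Ab [_ [N hN]].
have [M hM] := li_b li Aa; have [L hL] := li_b li Ab.
have : ideal p ((psi a * g ^+ M) * (psi b * g ^+ L)).
  apply: (prime_mul_exp sA (g := g) (n := N) _ (li_Ag li) ng); first exact: AM.
  have -> : psi a * g ^+ M * (psi b * g ^+ L) * g ^+ N =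
      psi (a * b) * g ^+ N * (g ^+ M * g ^+ L) by rewrite (li_M li); ring.
  by apply: primeMr => //; apply: AM.
by move/(prime_split hM hL) => [] h; [left|right]; split=> //; eexists; apply: h.
Qed.

Definition push (p : spec A) (ng : ~ ideal p g) : spec A' := Spec (push_prime ng).

Lemma push_g p ng : ~ ideal (@push p ng) g.
Proof.
move=> [_ [N]]; rewrite (li_g li) -exprS; apply: prime_exp => //; exact: (li_Ag li).
Qed.

Lemma pushP p ng a N : A' a -> A (psi a * g ^+ N) ->
  ideal (@push p ng) a <-> ideal p (psi a * g ^+ N).
Proof.
move=> A'a Aa; split=> [[_ [M hM]]|h]; last by split=> //; exists N.
apply: (prime_mul_exp sA (g := g) (n := M) Aa (li_Ag li) ng).
by rewrite mulrAC; apply: primeMr.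
Qed.

Lemma push_local p ng : local_ring p = psi @` local_ring (@push p ng).
Proof.
apply/seteqP; split=> h /=.
  move=> [a [b [Aa Ab nb ->]]].
  have [N hN] := li_b' li Aa; have [M hM] := li_b' li Ab.
  have A'g n : A' (g ^+ n) by apply: subring_exp => //; apply: (li_A'g li).
  have A'M : forall x y, A' x -> A' y -> A' (x * y) by case: sA'.
  have g0 : g != 0 by apply/eqP => e; case: (ng); rewrite e; apply: prime0.
  have hN' : A' (psi' a * g ^+ (N + M)) by rewrite exprD mulrA; apply: A'M.
  have hM' : A' (psi' b * g ^+ (N + M)) by rewrite addnC exprD mulrA; apply: A'M.
  exists (psi' a * g ^+ (N + M) / (psi' b * g ^+ (N + M))).
    exists (psi' a * g ^+ (N + M)), (psi' b * g ^+ (N + M)); split=> //.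
    move=> [_ [L]]; rewrite (li_M li) (li_K' li) psiX -mulrA -exprD.
    by move=> hb; apply: nb; apply: (prime_mul_exp sA (g := g) _ _ ng hb) => //; apply: (li_Ag li).
  by rewrite (li_M li) psiV !(li_M li) !(li_K' li) psiX invfM mulrACA divff ?mulr1 // expf_neq0.
move=> [_ [a [b [Aa Ab nb ->]]] <-].
have [N hN] := li_b li Aa; have [M hM] := li_b li Ab.
have g0 : g != 0 by apply/eqP => e; case: (ng); rewrite e; apply: prime0.
have hN' : A (psi a * g ^+ (N + M)) by rewrite exprD mulrA; apply: AM.
have hM' : A (psi b * g ^+ (N + M)) by rewrite addnC exprD mulrA; apply: AM.
exists (psi a * g ^+ (N + M)), (psi b * g ^+ (N + M)); split=> //.
  by move=> hb; apply: nb; split=> //; exists (N + M)%N.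
by rewrite (li_M li) psiV invfM mulrACA divff ?mulr1 // expf_neq0.
Qed.

End LocalIso.

Lemma pushK A A' psi psi' g (li : local_iso A A' psi psi' g) p ng :
  push (local_iso_sym li) (@push_g _ _ _ _ _ li p ng) = p.
Proof.
apply: spec_ext; apply/seteqP; split=> a /=.
  move=> [Aa [N [_ [M]]]]; rewrite (li_M li) (li_K' li) (psiX li) -mulrA -exprD => h.
  exact: (prime_mul_exp (li_A li) Aa (li_Ag li) ng h).
move=> pa; have Aa := prime_sub pa; split=> //.
have [N hN] := li_b' li Aa; exists N; split=> //; exists 0%N.
rewrite (li_M li) (li_K' li) (psiX li) expr0 mulr1.
by apply: primeMr => //; apply: subring_exp; [apply: (li_A li) | apply: (li_Ag li)].
Qed.

End SpecTheory.

Section PushOpen.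
Variables (K : fieldType) (A A' : set K) (psi psi' : K -> K) (g : K).
Hypothesis li : local_iso A A' psi psi' g.

Lemma push_open (O : set (spec A)) (f : spec A -> spec A') :
  (forall p (ng : ~ ideal p g), f p = push li ng) ->
  O `<=` [set p | ~ ideal p g] -> zopen O -> zopen (f @` O).
Proof.
move=> fE Og [E [EA eO]]; have sA := li_A li; have sA' := li_A' li.
have [_ _ _ A'M] := sA'; have A'g := li_A'g li.
(* The last factor [g] confines the open set to the locus where [g] does not vanish, the image of
   the domain of the isomorphism. *)
exists [set b | A' b /\ exists a N, [/\ E a, A' (psi' a * g ^+ N) & b = psi' a * g ^+ N * g]].
split; first by move=> b [].
have key p (ng : ~ ideal p g) a N : A a -> A' (psi' a * g ^+ N) ->
    ideal (push li ng) (psi' a * g ^+ N) <-> ideal p a.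
  move=> Aa h; have e : psi (psi' a * g ^+ N) * g ^+ 0 = a * g ^+ N.
    by rewrite (li_M li) (li_K' li) (psiX li) expr0 mulr1.
  have Ag : A (g ^+ N) by apply: subring_exp => //; apply: (li_Ag li).
  rewrite (pushP li ng (N := 0%N) h); last by rewrite e; case: sA => _ _ _; apply.
  rewrite e; split=> [h'|h']; last exact: primeMr.
  exact: (prime_mul_exp sA Aa (li_Ag li) ng h').
apply/seteqP; split=> q /=.
  move=> [p Op <-]; have ng := Og p Op; move: Op; rewrite eO => -[a Ea na].
  have [N hN] := li_b' li (EA a Ea).
  exists (psi' a * g ^+ N * g); first by split; [apply: A'M | exists a, N].
  rewrite (fE _ ng) => /(prime_split hN A'g) [|]; last exact: push_g.
  by rewrite key //; apply: EA.
move=> [_ [_ [a [N [Ea hN ->]]]] nb].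
have ngq : ~ ideal q g by move=> h; apply: nb; apply: primeMl.
have li' := local_iso_sym li.
pose p := push li' ngq; have ng : ~ ideal p g by apply: push_g.
have fp : f p = q.
  rewrite (fE _ ng); apply: spec_ext; have := pushK li' ngq.
  move=> /(congr1 (@ideal _ _)) <-; apply/seteqP; split=> b /= [h1 [M hM]]; split=> //; exists M => //.
exists p => //; rewrite eO /=; exists a => // pa; apply: nb.
apply: primeMr => //; rewrite -fp (fE _ ng) key //; exact: EA.
Qed.

End PushOpen.

Section Glueing.
Variables (K : fieldType) (W : Type) (A : W -> set K) (theta : W -> K -> K).
Hypothesis sA : forall w, subring_set (A w).
Local Notation glued := (glued (A := A) theta).
Local Notation chart_point := (chart_point A).
Local Notation chart_stalk := (chart_stalk theta).
Implicit Types x y z : chart_point.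

Lemma glued_refl x : glued x x.
Proof.
exists setT, setT, id; split=> //; split=> //; try exact: zopenT.
  by split=> // q _; exists q.
by move=> O _; rewrite image_id.
Qed.

Lemma glued_stalk x y : glued x y -> chart_stalk x = chart_stalk y.
Proof.
case: x y => w p [w' q] [U [V [f [[_ _ _ _ h] /= Up <-]]]]; exact: h.
Qed.

Lemma glued_sym x y : glued x y -> glued y x.
Proof.
case: x y => w p [w' q] [U [V [f [[oU oV [fV fi fs] fo fst] /= Up fp]]]].
simpl in U, V, f.
pose f' (z : spec (A w')) := if pselect (exists2 y, U y & f y = z) is left e then projT1 (cid2 e) else p.
have f'P (z : spec (A w')) : V z -> U (f' z) /\ f (f' z) = z.
  move=> Vz; rewrite /f'; case: pselect => [e|[]]; first by case: (cid2 e).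
  by have [y Uy <-] := fs z Vz; exists y.
have f'f (z : spec (A w)) : U z -> f' (f z) = z.
  by move=> Uz; have [h1 h2] := f'P _ (fV z Uz); apply: fi h2; rewrite inE.
have Vq : V q by rewrite -fp; apply: fV.
exists V, U, f'; split=> //; last by rewrite /= -fp f'f.
split=> //.
- split=> [z /f'P[]//|z z'|z Uz].
    by rewrite !inE => /f'P[_ e] /f'P[_ e'] ee; rewrite -e -e' ee.
  by exists (f z); [apply: fV | apply: f'f].
- move=> O OV; have OU : f' @` O `<=` U by move=> _ [z Oz <-]; case: (f'P z (OV z Oz)).
  rewrite (fo _ OU); suff -> : f @` (f' @` O) = O by [].
  apply/seteqP; split=> z; first by move=> [_ [y Oy <-] <-]; have [_ ->] := f'P y (OV y Oy).
  by move=> Oz; exists (f' z); [exists z | have [_ ->] := f'P z (OV z Oz)].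
by move=> z Vz; have [h1 h2] := f'P z Vz; rewrite (fst _ h1) h2.
Qed.

Lemma glued_trans y x z : glued x y -> glued y z -> glued x z.
Proof.
case: x y z => w p [w' q] [w'' s] [U [V [f [[oU oV [fV fi fs] fo fst] /= Up fp]]]].
move=> [U' [V' [f' [[oU' oV' [fV' fi' fs'] fo' fst'] /= Uq fq]]]].
simpl in U, V, f, U', V', f'.
have VU : zopen (V `&` U') by apply: zopenI.
pose O := U `&` f @^-1` U'.
have fO : f @` O = V `&` U'.
  apply/seteqP; split=> a; first by move=> [b [Ub Ub'] <-]; split=> //; apply: fV.
  by move=> [Va Ua]; have [b Ub e] := fs a Va; exists b => //; split=> //; rewrite /preimage /= e.
have oO : zopen O by apply/(fo O); [move=> a [] | rewrite fO].
exists O, (f' @` (V `&` U')), (f' \o f); split; last first.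
- by rewrite /= fp fq.
- by split=> //; rewrite /preimage /= fp.
split=> //.
- by apply/(fo' _) => // a [].
- split=> [a [Ua Ua']|a b|_ [a [Va Ua] <-]].
  + by exists (f a) => //; split=> //; apply: fV.
  + rewrite !inE => -[Ua Ua'] [Ub Ub'] /= e.
    by apply: fi; rewrite ?inE //; apply: fi' e; rewrite inE.
  + by have [b Ub e] := fs a Va; exists b; rewrite /= ?e //; split=> //; rewrite /preimage /= e.
- move=> D DO; rewrite -image_comp.
  have DU : D `<=` U by move=> a /DO[].
  have fDU : f @` D `<=` U' by move=> _ [a /DO[_ h] <-].
  by rewrite (fo _ DU) (fo' _ fDU).
by move=> a [Ua Ua']; rewrite (fst _ Ua) (fst' _ Ua').
Qed.

Lemma glued_eq x y : glued x y -> glued x = glued y.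
Proof.
move=> h; apply/seteqP; split=> z; apply: glued_trans => //; exact: glued_sym.
Qed.

Lemma glued_push w w' psi psi' g (li : local_iso (A w) (A w') psi psi' g) p
    (ng : ~ ideal p g) : (forall h, theta w (psi h) = theta w' h) ->
  glued (existT _ w p) (existT _ w' (push li ng)).
Proof.
(* Where [g] vanishes the value is immaterial; the given point serves as default. *)
move=> th; pose f q := if pselect (~ ideal q g) is left ng' then push li ng' else push li ng.
have fE q (ng' : ~ ideal q g) : f q = push li ng'.
  by rewrite /f; case: pselect => // ng''; congr push; apply: Prop_irrelevance.
have li' := local_iso_sym li; have ng1 : ~ ideal (push li ng) g by apply: push_g.
pose f' q := if pselect (~ ideal q g) is left ng' then push li' ng' else push li' ng1.
have f'E q (ng' : ~ ideal q g) : f' q = push li' ng'.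
  by rewrite /f'; case: pselect => // ng''; congr push; apply: Prop_irrelevance.
pose U := [set q : spec (A w) | ~ ideal q g]; pose V := [set q : spec (A w') | ~ ideal q g].
have fV q : U q -> V (f q) by move=> Uq; rewrite (fE _ Uq); apply: push_g.
have f'U q : V q -> U (f' q) by move=> Uq; rewrite (f'E _ Uq); apply: push_g.
have pp (B B' : set K) (s s' : K -> K) (l1 l2 : local_iso B B' s s' g) q (n1 n2 : ~ ideal q g) :
  push l1 n1 = push l2 n2 by apply: spec_ext.
have f'f q : U q -> f' (f q) = q.
  move=> Uq; have h := fV q Uq; rewrite (f'E _ h); move: h; rewrite (fE _ Uq) => h.
  by rewrite -[RHS](pushK li Uq); apply: pp.
have ff' q : V q -> f (f' q) = q.
  move=> Uq; have h := f'U q Uq; rewrite (fE _ h); move: h; rewrite (f'E _ Uq) => h.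
  by rewrite -[RHS](pushK li' Uq); apply: pp.
exists U, V, f; split=> //; last exact: fE.
split.
- exact/zopenD/(li_Ag li).
- exact/zopenD/(li_A'g li).
- split=> // [a b|q Vq]; last by exists (f' q); [apply: f'U | apply: ff'].
  by rewrite !inE => Ua Ub e; rewrite -(f'f a Ua) e f'f.
- move=> O OU; split=> h; first exact: (push_open (li := li)).
  have -> : O = f' @` (f @` O).
    apply/seteqP; split=> a; first by move=> Oa; exists (f a); [exists a | apply: f'f; apply: OU].
    by move=> [_ [b Ob <-] <-]; rewrite f'f //; apply: OU.
  by apply: (push_open (li := li')) => // _ [a Oa <-]; apply: fV; apply: OU.
move=> q Uq; rewrite (fE _ Uq) /Defs.chart_stalk /= (push_local li Uq).
by apply/seteqP; split=> h /=; [move=> [_ [a la <-] <-]; exists a | move=> [a la <-]; exists (psi a) => //; exists a].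
Qed.

End Glueing.

(** * Central fibres *)

Section MaxIdeal.
Variable k : fieldType.

Lemma local_ring_max (K : fieldType) (c : k -> K) (A : set K) (p : spec A) h :
  subring_set A ->
  @max_ideal_at k (Spec_scheme c A) p h <->
  exists a b, [/\ A a, A b, ~ ideal p b, ideal p a & h = a / b].
Proof.
move=> [A1 AD AN AM]; split=> [[[a [b [Aa Ab nb e]]] nu]|[a [b [Aa Ab nb pa ->]]]].
  exists a, b; split=> //; apply: contrapT => na; apply: nu; split.
  - by exists a, b.
  - rewrite e mulf_neq0 ?invr_eq0 //; apply/eqP => z.
      by apply: na; rewrite z; apply: prime0.
    by apply: nb; rewrite z; apply: prime0.
  by exists b, a; rewrite e invf_div.
split; first by exists a, b.
move=> [_ h0 [a' [b' [Aa' Ab' nb' e]]]].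
have b0 : b != 0 by apply/eqP => z; apply: nb; rewrite z; apply: prime0.
have b'0 : b' != 0 by apply/eqP => z; apply: nb'; rewrite z; apply: prime0.
have : b * b' = a * a'.
  have := divff h0; rewrite e => /(congr1 (fun x => x * (b * b'))).
  by rewrite mul1r => <-; field; rewrite b0 b'0.
move=> e'; have : ideal p (b * b') by rewrite e'; apply: primeMr.
by move/(prime_split Ab Ab') => [].
Qed.

End MaxIdeal.

Section CentralFibre.
Variables (k : fieldType) (n r : nat) (W : Type).
Local Notation K := (ratfun k r).
Local Notation Kn := (ratfun k n).
Variables (A : W -> set K) (theta : W -> K -> K) (w0 : W).
(** [sigma] restricts functions of the root chart to [X = 0]. It is defined on the whole field but
    is a ring map only on fractions whose denominator survives, as the restriction to a proper
    closed subscheme must be. *)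
Variables (X : 'I_n -> K) (T : set Kn) (sigma : K -> Kn).
Local Notation S := (glued_scheme (@rconst k r) A theta).
Local Notation Z := (Spec_scheme (@rconst k n) T).
Local Notation A0 := (A w0).

Hypothesis sA : forall w, subring_set (A w).
Hypothesis sT : subring_set T.
Hypothesis theta0 : forall h, theta w0 h = h.
Hypothesis thetaV : forall w h, theta w h^-1 = (theta w h)^-1.
Hypothesis thetaX : forall w j, theta w (X j) = X j.
Hypothesis AX : forall w j, A w (X j).
Hypothesis X_neq0 : forall j, X j != 0.
Hypothesis A0c : forall c, A0 (rconst r c).
Hypothesis sigmaT : forall a, A0 a -> T (sigma a).
Hypothesis sigmaD : forall a b, A0 a -> A0 b -> sigma (a + b) = sigma a + sigma b.
Hypothesis sigmaM : forall a b, A0 a -> A0 b -> sigma (a * b) = sigma a * sigma b.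
Hypothesis sigmac : forall c, sigma (rconst r c) = rconst n c.
Hypothesis sigma_surj : forall t, T t -> exists2 a, A0 a & sigma a = t.
Hypothesis sigma_ker : forall a, A0 a -> sigma a = 0 ->
  exists b : 'I_n -> K, (forall j, A0 (b j)) /\ a = \sum_j X j * b j.
Hypothesis sigmaX : forall j, sigma (X j) = 0.
Hypothesis sigma_frac : forall a b, A0 a -> A0 b -> sigma b != 0 ->
  sigma (a / b) = sigma a / sigma b.
Hypothesis central : forall w (p : spec (A w)), (forall j, ideal p (X j)) ->
  exists p0 : spec A0, (forall j, ideal p0 (X j)) /\
    glued (A := A) theta (existT _ w p) (existT _ w0 p0).

Let sA0 := sA w0.

Definition cls (x : chart_point A) : pt S := exist _ (glued theta x) (ex_intro _ x erefl).

Lemma cls_eq x y : glued theta x y -> cls x = cls y.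
Proof.
move=> h; rewrite /cls; have := glued_eq sA h => e.
apply: eq_exist => //=; exact: e.
Qed.

Lemma cls_surj (C : pt S) : exists x, C = cls x.
Proof.
case: C => C [x e]; exists x; rewrite /cls; move: (ex_intro _ x e).
by rewrite {1 2}e => e1; congr exist; apply: Prop_irrelevance.
Qed.

Lemma stalk_cls x : stalk (cls x) = chart_stalk theta x.
Proof.
apply/seteqP; split=> h /=; last by exists x => //; apply: glued_refl.
by move=> [y xy]; rewrite -(glued_stalk xy).
Qed.

Lemma stalk_root (p : spec A0) : stalk (cls (existT _ w0 p)) = local_ring p.
Proof.
rewrite stalk_cls /chart_stalk /=; apply/seteqP; split=> h /=.
  by move=> [x lx <-]; rewrite theta0.
by move=> lh; exists h; rewrite ?theta0.
Qed.

Lemma max_root (p : spec A0) h : max_ideal_at (cls (existT _ w0 p)) h <->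
  exists a b, [/\ A0 a, A0 b, ~ ideal p b, ideal p a & h = a / b].
Proof.
rewrite -(@local_ring_max k _ (@rconst k r) _ p h sA0).
by rewrite /max_ideal_at /unit_at stalk_root.
Qed.

Lemma local_root (p : spec A0) a : A0 a -> local_ring p a.
Proof.
move=> Aa; exists a, 1; rewrite divr1; split=> //; first by case: sA0.
exact: prime1.
Qed.

Lemma max_root_in (p : spec A0) a : A0 a -> max_ideal_at (cls (existT _ w0 p)) a <-> ideal p a.
Proof.
move=> Aa; rewrite max_root; split=> [[b [c [Ab Ac nc pb e]]]|pa].
  have c0 : c != 0 by apply/eqP => z; apply: nc; rewrite z; apply: prime0.
  have : ideal p (a * c) by rewrite e divfK.
  by move/(prime_split Aa Ac) => [].
exists a, 1; rewrite divr1; split=> //; [by case: sA0|exact: prime1].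
Qed.

Lemma sigma0 : sigma 0 = 0.
Proof. by rewrite -(rmorph0 (@rconst k r)) sigmac rmorph0. Qed.

Lemma sigma1 : sigma 1 = 1.
Proof. by rewrite -(rmorph1 (@rconst k r)) sigmac rmorph1. Qed.

Lemma pull_prime (q : spec T) : is_prime A0 [set a | A0 a /\ ideal q (sigma a)].
Proof.
have [A1 AD AN AM] := sA0; split.
- split; first by move=> a [].
    by split; [rewrite -(subrr 1); apply: AD => //; apply: AN | rewrite sigma0; apply: prime0].
  by move=> [_]; rewrite sigma1; apply: prime1.
- by move=> a b [Aa qa] [Ab qb]; split; [apply: AD | rewrite sigmaD //; apply: primeD].
- by move=> a b Aa [Ab qb]; split; [apply: AM | rewrite sigmaM //; apply: primeMl => //; apply: sigmaT].
move=> a b Aa Ab [_]; rewrite sigmaM // => /(prime_split (sigmaT Aa) (sigmaT Ab)) [h|h]; by [left|right].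
Qed.

Definition pull (q : spec T) : spec A0 := Spec (pull_prime q).

Lemma pull_X q j : ideal (pull q) (X j).
Proof. by split; rewrite ?sigmaX //; apply: prime0. Qed.

Lemma ker_in (p : spec A0) a : (forall j, ideal p (X j)) -> A0 a -> sigma a = 0 -> ideal p a.
Proof.
move=> pX Aa /(sigma_ker Aa) [b [Ab ->]].
apply: (big_ind (ideal p)); first exact: prime0.
  by move=> x y; apply: primeD.
by move=> j _; apply: primeMr.
Qed.

Lemma sigmaN a : A0 a -> sigma (- a) = - sigma a.
Proof.
move=> Aa; apply: (addrI (sigma a)); rewrite -sigmaD //; last by case: sA0 => _ _ h _; apply: h.
by rewrite !subrr sigma0.
Qed.

Lemma pull_surj (p : spec A0) : (forall j, ideal p (X j)) -> exists q, pull q = p.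
Proof.
move=> pX; have [A1 AD AN AM] := sA0.
have ker a b : A0 a -> ideal p b -> sigma a = sigma b -> ideal p a.
  move=> Aa pb e; have Ab := prime_sub pb.
  rewrite -[a](subrK b); apply: primeD => //; apply: ker_in => //; first by apply: AD => //; apply: AN.
  by rewrite sigmaD ?sigmaN ?e ?subrr //; apply: AN.
have qp : is_prime T (sigma @` ideal p).
  split.
  - split; first by move=> _ [a /prime_sub Aa <-]; apply: sigmaT.
      by exists 0; [apply: prime0 | apply: sigma0].
    move=> [a pa e]; apply: (@prime1 _ _ p); apply: ker pa _ => //.
    by rewrite sigma1.
  - move=> _ _ [a pa <-] [b pb <-]; exists (a + b); first exact: primeD.
    by rewrite sigmaD //; apply: prime_sub; [exact: pa | exact: pb].
  - move=> t _ Tt [b pb <-]; have [a Aa <-] := sigma_surj Tt.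
    exists (a * b); first exact: primeMl.
    by rewrite sigmaM //; apply: prime_sub pb.
  move=> s t Ts Tt [x px]; have [a Aa <-] := sigma_surj Ts; have [b Ab <-] := sigma_surj Tt.
  rewrite -sigmaM // => e.
  have : ideal p (a * b) by apply: ker px _ => //; apply: AM.
  by move/(prime_split Aa Ab) => [h|h]; [left; exists a | right; exists b].
exists (Spec qp); apply: spec_ext; apply/seteqP; split=> a /=.
  by move=> [Aa [b pb e]]; apply: ker pb _ => //; rewrite e.
by move=> pa; split; [apply: prime_sub pa | exists a].
Qed.

Definition iota : smap Z S :=
  @SMap k Z S (fun q : spec T => cls (existT _ w0 (pull q))) (fun _ => sigma).

Lemma pull_poly_A0 P : A0 (pull_poly (X := S) X P) /\
  sigma (pull_poly (X := S) X P) = rconst n P.@[fun=> 0].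
Proof.
have [A1 AD AN AM] := sA0.
apply: (mpoly_ring_ind (Q := fun P => A0 (pull_poly (X := S) X P) /\
  sigma (pull_poly (X := S) X P) = rconst n P.@[fun=> 0])) => [c|j|p q [p1 p2] [q1 q2]|p q [p1 p2] [q1 q2]].
- by rewrite /pull_poly mmapC mevalC; split; [apply: A0c | apply: sigmac].
- by rewrite /pull_poly mmapX mmap1U mevalXU rmorph0.
- rewrite /pull_poly !rmorphD /=; split; first exact: AD.
  by rewrite sigmaD // p2 q2.
rewrite /pull_poly !rmorphM /=; split; first exact: AM.
by rewrite sigmaM // p2 q2.
Qed.


Lemma image_origin (p : spec A0) : (forall j, ideal p (X j)) ->
  image_point (X := S) X (cls (existT _ w0 p)) = @origin k n.
Proof.
move=> pX; have [A1 AD AN AM] := sA0; apply/seteqP; split=> P /=; rewrite /origin /image_point /=.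
  have [AP eP] := pull_poly_A0 P; rewrite max_root_in // => pP.
  apply: contrapT => /eqP c0; apply: (@prime1 _ _ p).
  set c := P.@[_] in eP c0.
  have pc : ideal p (rconst r c).
    have -> : rconst r c = pull_poly (X := S) X P + - (pull_poly (X := S) X P - rconst r c) by ring.
    apply: primeD => //; apply: primeN => //; apply: ker_in => //.
      by apply: AD => //; apply: AN.
    by rewrite sigmaD ?sigmaN ?eP ?sigmac ?subrr //; apply: AN.
  have -> : 1 = rconst r c^-1 * rconst r c by rewrite -rmorphM mulVf // rmorph1.
  exact: primeMl.
move=> e; have [AP eP] := pull_poly_A0 P; rewrite max_root_in //.
by apply: ker_in => //; rewrite eP e rmorph0.
Qed.

Lemma origin_X w (p : spec (A w)) :
  image_point (X := S) X (cls (existT _ w p)) = @origin k n -> forall j, ideal p (X j).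
Proof.
move=> e j; have : @origin k n 'X_j by rewrite /origin /= mevalXU.
rewrite -e /image_point /= /pull_poly mmapX mmap1U => -[_ nu].
apply: contrapT => np; apply: nu.
have A1 : A w 1 by case: (sA w).
rewrite /unit_at stalk_cls; split=> //.
  exists (X j); last exact: thetaX.
  by exists (X j), 1; rewrite divr1; split=> //; apply: prime1.
exists (X j)^-1; last by rewrite thetaV thetaX.
by exists 1, (X j); rewrite mul1r.
Qed.

Lemma range_iota : range (ptmap iota) = [set x | image_point (X := S) X x = @origin k n].
Proof.
apply/seteqP; split=> x /=; first by move=> [q _ <-]; apply: image_origin; apply: pull_X.
have [[w p] ->] := cls_surj x; move=> /origin_X /central [p0 [p0X gl]].
have [q eq] := pull_surj p0X; exists q => //.
by rewrite eq; apply/esym/cls_eq.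
Qed.

Lemma isopen_cls (U : set (pt S)) : isopen U <->
  forall w, zopen [set p : spec (A w) | U (cls (existT _ w p))].
Proof.
have e w : [set p : spec (A w) | exists2 C, U C & sval C (existT _ w p)] =
    [set p : spec (A w) | U (cls (existT _ w p))].
  apply/seteqP; split=> p /=.
    move=> [C UC]; have [x eC] := cls_surj C; move: UC; rewrite eC /= => Ux gl.
    by rewrite -(cls_eq gl).
  by move=> Up; exists (cls (existT _ w p)) => //; apply: glued_refl.
by split=> h w; have := h w; rewrite e.
Qed.

(** The trace on another chart is the union, over all partial isomorphisms between open subsets of
    the two charts, of the preimages of [O]. *)
Lemma open_charts w (O : set (spec (A w))) : zopen O ->
  isopen [set C : pt S | exists2 p, O p & C = cls (existT _ w p)].
Proof.
move=> oO; apply/isopen_cls => w'.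
pose D := [set UVf : set (spec (A w')) * set (spec (A w)) * (spec (A w') -> spec (A w)) |
  @birational_iso _ _ A theta w' w UVf.1.1 UVf.1.2 UVf.2].
have -> : [set p : spec (A w') | exists2 p0, O p0 & cls (existT _ w' p) = cls (existT _ w p0)] =
   \bigcup_(UVf in D) (UVf.1.1 `&` UVf.2 @^-1` O).
  apply/seteqP; split=> p /=.
    move=> [p0 Op0] /(congr1 sval) /= e.
    have : glued theta (existT _ w' p) (existT _ w p0) by rewrite e; apply: glued_refl.
    by move=> [U [V [f [h /= Up fp]]]]; exists (U, V, f) => //=; split=> //; rewrite /preimage /= fp.
  move=> [[[U V] f] /= h [Up Of]]; exists (f p) => //.
  by apply: cls_eq; exists U, V, f.
apply: zopen_bigcup => -[[U V] f] /= [oU oV [fV fi fs] fo _].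
have e : f @` (U `&` f @^-1` O) = V `&` O.
  apply/seteqP; split=> a /=; first by move=> [b [Ub Ob] <-]; split=> //; apply: fV.
  by move=> [Va Oa]; have [b Ub fb] := fs a Va; exists b => //; split=> //; move: Oa; rewrite -fb.
by apply/fo; [move=> a [] | rewrite e; apply: zopenI].
Qed.

Lemma iota_morphism : is_morphism iota.
Proof.
split.
- move=> U /isopen_cls /(_ w0) [E [EA eE]].
  exists (sigma @` E); split; first by move=> _ [a Ea <-]; apply: sigmaT; apply: EA.
  apply/seteqP; split=> q /=.
    move=> Uq; have : [set p : spec A0 | U (cls (existT _ w0 p))] (pull q) by [].
    rewrite eE => -[a Ea na]; exists (sigma a); first by exists a.
    by move=> qa; apply: na; split=> //; apply: EA.
  move=> [_ [a Ea <-] na].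
  have : [set p : spec A0 | (exists2 a : K, E a & ~ ideal p a)] (pull q).
    by exists a => // -[].
  by rewrite -eE.
- move=> q; have [A1 AD AN AM] := sA0.
  have s_neq0 b : ~ ideal (pull q) b -> A0 b -> sigma b != 0.
    by move=> nb Ab; apply/eqP => e; apply: nb; split=> //; rewrite e; apply: prime0.
  have b_neq0 b : ~ ideal (pull q) b -> b != 0.
    by move=> nb; apply/eqP => e; apply: nb; rewrite e; apply: prime0.
  rewrite /local_hom_at stalk_root; split.
  + move=> _ [a [b [Aa Ab nb ->]]]; exists (sigma a), (sigma b); split; try exact: sigmaT.
      by move=> qb; apply: nb.
    by rewrite /= sigma_frac // s_neq0.
  + move=> _ _ [a [b [Aa Ab nb ->]]] [a' [b' [Aa' Ab' nb' ->]]].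
    have nbb : ~ ideal (pull q) (b * b') by move/(prime_split Ab Ab') => [].
    rewrite /= addf_div ?b_neq0 // !sigma_frac ?s_neq0 //; try (by apply: AM); last first.
      by apply: AD; apply: AM.
    by rewrite sigmaD ?sigmaM ?addf_div ?s_neq0 //; apply: AM.
  + move=> _ _ [a [b [Aa Ab nb ->]]] [a' [b' [Aa' Ab' nb' ->]]].
    have nbb : ~ ideal (pull q) (b * b') by move/(prime_split Ab Ab') => [].
    rewrite /= mulf_div !sigma_frac ?s_neq0 //; try (by apply: AM).
    by rewrite !sigmaM // mulf_div.
  + exact: sigmac.
  move=> h /max_root [a [b [Aa Ab nb [_ qa] ->]]].
  apply/(@local_ring_max k _ (@rconst k n) _ q _ sT).
  exists (sigma a), (sigma b); split=> //; try exact: sigmaT; last by rewrite /= sigma_frac // s_neq0.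
  by move=> qb; apply: nb.
by move=> U _ h _; exists (sigma h).
Qed.

(** A point of the glued scheme is a class of chart points; its ideal in the root chart is recovered
    from the maximal ideal of the stalk of the class. *)
Lemma iota_inj : injective (ptmap iota).
Proof.
move=> q q' /= e; have := congr1 (@stalk _ S) e; rewrite !stalk_root => el.
have em h : (exists a b, [/\ A0 a, A0 b, ~ ideal (pull q) b, ideal (pull q) a & h = a / b]) <->
   (exists a b, [/\ A0 a, A0 b, ~ ideal (pull q') b, ideal (pull q') a & h = a / b]).
  by rewrite -!max_root e.
have key a : A0 a -> ideal (pull q) a <-> ideal (pull q') a.
  by move=> Aa; rewrite -!max_root_in // e.
apply: spec_ext; apply/seteqP; split=> t qt.
  have [a Aa ea] := sigma_surj (prime_sub qt); rewrite -ea.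
  by have [|_ ] := (key a Aa).1; first by split=> //; rewrite ea.
have [a Aa ea] := sigma_surj (prime_sub qt); rewrite -ea.
by have [|_ ] := (key a Aa).2; first by split=> //; rewrite ea.
Qed.

Theorem central_fibre : is_fibre (X := S) X (@origin k n) iota.
Proof.
have [A1 AD AN AM] := sA0; split; last split.
- move=> j x _; have [[w p] ->] := cls_surj x; rewrite stalk_cls.
  exists (X j); last exact: thetaX.
  by exists (X j), 1; rewrite divr1; split=> //; [case: (sA w) | apply: prime1].
- exact: range_iota.
- exact: iota_morphism.
- exact: iota_inj.
- apply/isopen_cls => w; rewrite range_iota.
  exists (range X); split; first by move=> _ [j _ <-]; apply: AX.
  apply/seteqP; split=> p /=.
    move=> nor; apply: contrapT => h; apply: nor.
    have pX j : ideal p (X j) by apply: contrapT => nj; apply: h; exists (X j) => //; exists j.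
    have [p0 [p0X gl]] := central pX; rewrite (cls_eq gl); exact: image_origin.
  by move=> [_ [j _ <-] nj] /origin_X /(_ j).
- move=> V [E [ET eV]].
  pose O := [set p : spec A0 | exists2 a, (A0 a /\ E (sigma a)) & ~ ideal p a].
  have oO : zopen O by exists [set a | A0 a /\ E (sigma a)]; split=> // a [].
  exists [set C : pt S | exists2 p, O p & C = cls (existT _ w0 p)]; first exact: open_charts.
  rewrite eV; apply/seteqP; split=> q /=.
    move=> [t Et nt]; have [a Aa ea] := sigma_surj (ET t Et).
    exists (pull q) => //; exists a; first by rewrite ea.
    by move=> [_]; rewrite ea.
  move=> [p [a [Aa Ea] na] e]; exists (sigma a) => // qa; apply: na.
  by rewrite -max_root_in // -e max_root_in.
move=> q; split.
  move=> _ [s [t [Ts Tt nt ->]]]; have [a Aa ea] := sigma_surj Ts; have [b Ab eb] := sigma_surj Tt.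
  exists (a / b); last first.
    rewrite /= sigma_frac ?ea ?eb //; apply/eqP => z; apply: nt; rewrite z; exact: prime0.
  change (stalk (cls (existT _ w0 (pull q))) (a / b)).
  rewrite stalk_root; exists a, b; split=> //.
  by move=> [_]; rewrite eb.
(* The kernel of [sigma] on the stalk is the extended ideal: dividing the relation of [sigma_ker] by
   [b] gives one inclusion, and the other holds because [sigma] sends the pullback of a polynomial
   to its value at the origin. *)
move=> h hs; have : local_ring (pull q) h by rewrite -stalk_root.
move=> [a [b [Aa Ab nb eh]]].
have sb : sigma b != 0 by apply/eqP => z; apply: nb; split=> //; rewrite z; apply: prime0.
have b0 : b != 0 by apply/eqP => z; apply: nb; rewrite z; apply: prime0.
rewrite /= eh sigma_frac //; split.
  move=> /eqP; rewrite mulf_eq0 invr_eq0 (negPf sb) orbF => /eqP /(sigma_ker Aa) [f [Af ea]].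
  exists [seq ('X_j, f j / b) | j <- index_enum 'I_n]; split.
    move=> _ /mapP[j _ ->]; split; first by rewrite /origin /= mevalXU.
    change (stalk (cls (existT _ w0 (pull q))) (f j / b)).
    by rewrite stalk_root; exists (f j), b.
  rewrite big_map ea mulr_suml; apply: eq_bigr => j _ /=.
  by rewrite /pull_poly mmapX mmap1U mulrA.
move=> [s [hs' e]].
suff : sigma (a / b) = 0 by rewrite sigma_frac.
have [loc z] : local_ring (pull q) (\sum_(p <- s) pull_poly (X := S) X p.1 * p.2) /\
    sigma (\sum_(p <- s) pull_poly (X := S) X p.1 * p.2) = 0; last by rewrite e.
have [_ lh _] := iota_morphism; have := lh q.
rewrite /local_hom_at stalk_root => -[_ lD' lM' _ _].
have lD (x y : K) : local_ring (pull q) x -> local_ring (pull q) y -> sigma (x + y) = sigma x + sigma y.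
  exact: lD'.
have lM (x y : K) : local_ring (pull q) x -> local_ring (pull q) y -> sigma (x * y) = sigma x * sigma y.
  exact: lM'.
have locAM (x y : K) : local_ring (pull q) x -> local_ring (pull q) y -> local_ring (pull q) (x * y).
  move=> [x1 [x2 [h1 h2 h3 ->]]] [y1 [y2 [h4 h5 h6 ->]]].
  exists (x1 * y1), (x2 * y2); split; try (by apply: AM); last by rewrite mulf_div.
  by move/(prime_split h2 h5) => [].
have locAD (x y : K) : local_ring (pull q) x -> local_ring (pull q) y -> local_ring (pull q) (x + y).
  move=> [x1 [x2 [h1 h2 h3 ->]]] [y1 [y2 [h4 h5 h6 ->]]].
  exists (x1 * y2 + y1 * x2), (x2 * y2); split; try (by apply: AM).
  - by apply: AD; apply: AM.
  - by move/(prime_split h2 h5) => [].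
  have x20 : x2 != 0 by apply/eqP => zz; apply: h3; rewrite zz; apply: prime0.
  have y20 : y2 != 0 by apply/eqP => zz; apply: h6; rewrite zz; apply: prime0.
  exact: addf_div.
elim: s hs' {e} => [|[P y] s IH] hs'.
  rewrite big_nil; split; last exact: sigma0.
  by apply: local_root; rewrite -(subrr 1); apply: AD => //; apply: AN.
have [|l z] := IH; first by move=> p ps; apply: hs'; rewrite inE ps orbT.
have [oP ly] := hs' (P, y) (mem_head _ _).
change (stalk (cls (existT _ w0 (pull q))) y) in ly; rewrite stalk_root in ly.
have [AP eP] := pull_poly_A0 P; have lP := local_root (pull q) AP.
have lPy := locAM _ _ lP ly.
rewrite big_cons; split; first exact: locAD.
by rewrite lD // lM // z eP oP rmorph0 mul0r addr0.
Qed.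

End CentralFibre.

(** * Monoid algebras, and restriction of the root chart to [X = 0] *)

Section MonoidAlgebra.
Variables (k : fieldType) (r : nat).
Local Notation K := (ratfun k r).
Local Notation L := 'rV[int]_r.
Implicit Types (S : set L) (h : K).

Lemma monoid_alg_ind S (Q : K -> Prop) :
  Q 0 -> (forall c a h, S a -> monoid_alg (k := k) S h -> Q h -> Q (rconst r c * lmonom k a + h)) ->
  forall h, monoid_alg (k := k) S h -> Q h.
Proof.
move=> Q0 QD h [s [hs ->]]; elim: s hs => [|[c a] s IH] hs; first by rewrite big_nil.
have hs' p : p \in s -> S p.2 by move=> ps; apply: hs; rewrite inE ps orbT.
rewrite big_cons; apply: QD; [exact: (hs (c, a) (mem_head _ _)) | by exists s | exact: IH].
Qed.

Lemma monoid_alg_term S c a : S a -> monoid_alg (k := k) S (rconst r c * lmonom k a).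
Proof.
move=> Sa; exists [:: (c, a)]; rewrite big_seq1; split=> // p.
by rewrite inE => /eqP ->.
Qed.

Lemma monoid_algD S g h : monoid_alg (k := k) S g -> monoid_alg (k := k) S h -> monoid_alg (k := k) S (g + h).
Proof.
move=> [s [hs ->]] [t [ht ->]]; exists (s ++ t); rewrite big_cat; split=> // p.
by rewrite mem_cat => /orP[/hs|/ht].
Qed.

Lemma monoid_alg0 S : monoid_alg (k := k) S 0.
Proof. by exists [::]; rewrite big_nil. Qed.

Lemma monoid_alg_lmonom S a : S a -> monoid_alg (k := k) S (lmonom k a).
Proof. by move=> Sa; rewrite -[lmonom k a]mul1r -(rmorph1 (@rconst k r)); apply: monoid_alg_term. Qed.

Section Submonoid.
Variable S : set L.
Hypotheses (S0 : S 0) (SD : forall a b, S a -> S b -> S (a + b)).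

Lemma monoid_alg_const c : monoid_alg (k := k) S (rconst r c).
Proof. by rewrite -[rconst r c]mulr1 -(lmonom0 k r); apply: monoid_alg_term. Qed.

Lemma monoid_algM g h : monoid_alg (k := k) S g -> monoid_alg (k := k) S h -> monoid_alg (k := k) S (g * h).
Proof.
move=> Sg Sh; elim/monoid_alg_ind: g / Sg => [|c a g Sa _ IH]; first by rewrite mul0r; apply: monoid_alg0.
rewrite mulrDl; apply: monoid_algD => // {IH}.
elim/monoid_alg_ind: h / Sh => [|d b h Sb _ IH]; first by rewrite mulr0; apply: monoid_alg0.
rewrite mulrDr; apply: monoid_algD => //.
by rewrite mulrACA -lmonomD -rmorphM; apply/monoid_alg_term/SD.
Qed.

Lemma monoid_alg_subring : subring_set (monoid_alg (k := k) S).
Proof.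
split=> [|a b|a Sa|a b]; [|exact: monoid_algD| |exact: monoid_algM].
  by rewrite -(rmorph1 (@rconst k r)); apply: monoid_alg_const.
by rewrite -mulN1r -(rmorph1 (@rconst k r)) -rmorphN; apply: monoid_algM => //; apply: monoid_alg_const.
Qed.

(** A function has finitely many terms, each acquiring its own power of [G]; one high power clears
    all the negative ones. *)
Lemma monoid_alg_image (S' : set L) (psi : K -> K) (G : K) (sg : L -> L) (hg : L -> int) :
  {morph psi : x y / x + y} -> {morph psi : x y / x * y} ->
  (forall c, psi (rconst r c) = rconst r c) ->
  (forall a, psi (lmonom k a) = lmonom k (sg a) * G ^ (hg a)) ->
  (forall a, S' a -> S (sg a)) -> G != 0 -> monoid_alg (k := k) S G ->
  forall h, monoid_alg (k := k) S' h -> exists N, monoid_alg (k := k) S (psi h * G ^+ N).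
Proof.
move=> pD pM pc pl sS G0 SG h Sh; have sR := monoid_alg_subring.
have SX n : monoid_alg (k := k) S (G ^+ n) by apply: subring_exp.
elim/monoid_alg_ind: h / Sh => [|c a h Sa _ [N hN]].
  by exists 0%N; rewrite -(rmorph0 (@rconst k r)) pc rmorph0 mul0r; apply: monoid_alg0.
exists (N + `|hg a|)%N; rewrite pD mulrDl; apply: monoid_algD; last first.
  by rewrite exprD mulrA; apply: monoid_algM.
rewrite pM pc pl mulrA -mulrA; apply: monoid_algM; first by apply/monoid_alg_term/sS.
have -> : G ^ hg a * G ^+ (N + `|hg a|) = G ^+ `|hg a + `|hg a|%N%:Z + N%:Z|.
  by rewrite !exprnP -expfzDr //; congr (_ ^ _); lia.
exact: SX.
Qed.

End Submonoid.
End MonoidAlgebra.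

Section Residue.
Variables (k : fieldType) (n : nat).
Local Notation K := (ratfun k (n + n)).
Local Notation Kn := (ratfun k n).

(** The exponents of the root chart, whose cone is generated by the [(0, f_j)]: polynomial in the
    [X_j], Laurent in the rest. *)
Definition effective : set 'rV[int]_(n + n) := [set a | forall j, 0 <= a 0 (rshift n j)].
Local Notation A0 := (monoid_alg (k := k) effective).
Local Notation T := (monoid_alg (k := k) (setT : set 'rV[int]_n)).
Local Notation xr j := (xvar k (rshift n j)).

Definition resvar (i : 'I_(n + n)) : Kn :=
  match fintype.split i with inl j => xvar k j | inr _ => 0 end.

Local Notation phi := (mmap (@rconst k n) resvar).

Definition residue : K -> Kn := peval phi.

Lemma resvarl j : resvar (lshift n j) = xvar k j.
Proof. by rewrite /resvar (unsplitK (inl j)). Qed.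

Lemma resvarr j : resvar (rshift n j) = 0.
Proof. by rewrite /resvar (unsplitK (inr j)). Qed.

Lemma eff_ok a : effective a -> forall i, (0 <= a 0 i) || (resvar i != 0).
Proof.
move=> ea i; rewrite -(splitK i); case: (fintype.split i) => j /=.
  by rewrite resvarl xvar_neq0 orbT.
by rewrite (ea j).
Qed.

Lemma residue_lmonom a : effective a -> pdom phi (lmonom k a) /\
  residue (lmonom k a) = if [forall j, a 0 (rshift n j) == 0] then lmonom k (lsubmx a) else 0.
Proof.
move=> ea; have [h1 h2] := @pdom_lmonom k (n + n) _ (@rconst k n) resvar a (eff_ok ea).
split=> //; rewrite /residue h2 big_split_ord /=.
have -> : \prod_(i < n) resvar (lshift n i) ^ a 0 (lshift n i) = lmonom k (lsubmx a).
  by apply: eq_bigr => j _; rewrite resvarl mxE.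
case: ifPn => [/forallP h|/forallPn[j hj]].
  by rewrite [X in _ * X]big1 ?mulr1 // => j _; rewrite (eqP (h j)) expr0z.
by rewrite [X in _ * X](bigD1 j) //= resvarr exp0rz (negPf hj) mul0r mulr0.
Qed.

Lemma A0_pdom h : A0 h -> pdom phi h.
Proof.
move=> Sh; elim/monoid_alg_ind: h / Sh => [|c a h ea _ IH]; first by case: (pdom0 phi).
have [d1 _] := @pdom_const k (n + n) _ (@rconst k n) resvar c.
have [d2 _] := residue_lmonom ea.
have [d3 _] := pdomM d1 d2; by have [] := pdomD d3 IH.
Qed.

Lemma residue_const c : residue (rconst (n + n) c) = rconst n c.
Proof. by have [_ h] := @pdom_const k (n + n) _ (@rconst k n) resvar c. Qed.

Lemma residue0 : residue 0 = 0.
Proof. exact: (pdom0 phi).2. Qed.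

Lemma residue_add g h : A0 g -> A0 h -> residue (g + h) = residue g + residue h.
Proof. by move=> /A0_pdom dg /A0_pdom dh; have [_] := pdomD dg dh. Qed.

Lemma residue_mul g h : A0 g -> A0 h -> residue (g * h) = residue g * residue h.
Proof. by move=> /A0_pdom dg /A0_pdom dh; have [_] := pdomM dg dh. Qed.

Lemma residue_div g h : A0 g -> A0 h -> residue h != 0 -> residue (g / h) = residue g / residue h.
Proof.
move=> /A0_pdom dg /A0_pdom dh h0; have [d1 e1] := pdomV dh h0.
by rewrite /residue (pdomM dg d1).2 e1.
Qed.

Lemma eff0 : effective 0. Proof. by move=> j; rewrite mxE. Qed.
Lemma residue_term c a : effective a -> residue (rconst (n + n) c * lmonom k a) =
  if [forall j, a 0 (rshift n j) == 0] then rconst n c * lmonom k (lsubmx a) else 0.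
Proof.
move=> ea; rewrite residue_mul ?residue_const; last by apply: monoid_alg_lmonom.
  by have [_ ->] := residue_lmonom ea; case: ifP; rewrite ?mulr0.
by apply: monoid_alg_const; apply: eff0.
Qed.

Lemma residue_im h : A0 h -> T (residue h).
Proof.
move=> Sh; elim/monoid_alg_ind: h / Sh => [|c a h ea Ah IH].
  by rewrite residue0; apply: monoid_alg0.
rewrite residue_add //; last by apply: monoid_alg_term.
apply: monoid_algD => //; rewrite residue_term //; case: ifP => _; last exact: monoid_alg0.
exact: monoid_alg_term.
Qed.

Definition lift_exp (a : 'rV[int]_n) : 'rV[int]_(n + n) := row_mx a 0.

Lemma eff_lift a : effective (lift_exp a).
Proof. by move=> j; rewrite row_mxEr mxE. Qed.

Lemma lift_forall a : [forall j, lift_exp a 0 (rshift n j) == 0].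
Proof. by apply/forallP => j; rewrite row_mxEr mxE. Qed.

Lemma residue_surj t : T t -> exists2 a, A0 a & residue a = t.
Proof.
move=> Tt; elim/monoid_alg_ind: t / Tt => [|c a t _ _ [h Ah <-]].
  by exists 0; [apply: monoid_alg0 | apply: residue0].
have At : A0 (rconst (n + n) c * lmonom k (lift_exp a)) by apply/monoid_alg_term/eff_lift.
exists (rconst (n + n) c * lmonom k (lift_exp a) + h); first exact: monoid_algD.
rewrite residue_add // residue_term; last exact: eff_lift.
by rewrite lift_forall row_mxKl.
Qed.

Lemma residue_xvar j : residue (xr j) = 0.
Proof. by have [_ h] := @pdom_xvar k (n + n) _ (@rconst k n) resvar (rshift n j); rewrite /residue h resvarr. Qed.

Local Notation phi' := (mmap (@rconst k (n + n)) (fun j => xvar k (lshift n j))).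

Lemma unlift_lmonom a : pdom phi' (lmonom k a) /\ peval phi' (lmonom k a) = lmonom k (lift_exp a).
Proof.
have [|h1 h2] := @pdom_lmonom k n _ (@rconst k (n + n)) (fun j => xvar k (lshift n j)) a.
  by move=> i; rewrite xvar_neq0 orbT.
split=> //; rewrite h2 lmonomE big_split_ord /= [X in _ * X]big1 ?mulr1 => [|j _]; last first.
  by rewrite row_mxEr mxE expr0z.
by apply: eq_bigr => j _; rewrite row_mxEl.
Qed.

Definition in_X (h : K) := exists b : 'I_n -> K, (forall j, A0 (b j)) /\ h = \sum_j xr j * b j.

Lemma in_XD g h : in_X g -> in_X h -> in_X (g + h).
Proof.
move=> [b [Ab ->]] [c [Ac ->]]; exists (fun j => b j + c j); split.
  by move=> j; apply: monoid_algD.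
by rewrite -big_split; apply: eq_bigr => j _; rewrite mulrDr.
Qed.

Lemma in_X0 : in_X 0.
Proof.
exists (fun=> 0); split; first by move=> j; apply: monoid_alg0.
by rewrite big1 // => j _; rewrite mulr0.
Qed.

Lemma in_X_term j h : A0 h -> in_X (xr j * h).
Proof.
move=> Ah; exists (fun l => if l == j then h else 0); split.
  by move=> l; case: ifP => _ //; apply: monoid_alg0.
by rewrite (bigD1 j) //= eqxx big1 ?addr0 // => l /negPf ->; rewrite mulr0.
Qed.

(* Modulo the ideal of the variables, an element of the algebra is the lift of its
   residue. *)
Lemma residue_split h : A0 h -> exists g, [/\ in_X g, pdom phi' (residue h) &
  h = g + peval phi' (residue h)].
Proof.
move=> Sh; elim/monoid_alg_ind: h / Sh => [|c a h ea Ah [g [Xg dh eh]]].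
  exists 0; rewrite residue0; have [d1 d2] := pdom0 phi'.
  by rewrite d2 addr0; split=> //; apply: in_X0.
rewrite residue_add //; last by apply: monoid_alg_term.
rewrite residue_term //; case: ifPn => [/forallP z|/forallPn[j hj]].
  have [d1 e1] := @pdom_const k n _ (@rconst k (n + n)) (fun j => xvar k (lshift n j)) c.
  have [d2 e2] := unlift_lmonom (lsubmx a); have [d3 e3] := pdomM d1 d2; have [d4 e4] := pdomD d3 dh.
  exists g; split=> //; rewrite e4 e3 e1 e2.
  have -> : lift_exp (lsubmx a) = a.
    rewrite -[RHS]hsubmxK; congr row_mx; apply/rowP => j.
    by rewrite !mxE (eqP (z j)).
  by rewrite {1}eh addrCA.
rewrite add0r; exists (rconst (n + n) c * lmonom k a + g); split=> //; last by rewrite {1}eh addrA.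
apply: in_XD => //; set dl : 'rV[int]_(n + n) := delta_mx 0 (rshift n j).
have -> : rconst (n + n) c * lmonom k a = xr j * (rconst (n + n) c * lmonom k (a - dl)).
  by rewrite mulrCA -lmonom_delta -lmonomD addrC subrK.
apply/in_X_term/monoid_alg_term => l; rewrite !mxE eqxx /= (inj_eq (@rshift_inj _ _)).
have := ea l; case: eqP => [->|_]; last by rewrite subr0.
by move: hj => /=; lia.
Qed.

Lemma residue_ker h : A0 h -> residue h = 0 -> in_X h.
Proof.
move=> Ah h0; have [g [Xg _ ->]] := residue_split Ah.
by rewrite h0 (pdom0 phi').2 addr0.
Qed.

End Residue.

(** * Seeds *)

Section Pairing.
Variable n : nat.
Implicit Types (x y : 'rV[rat]_n) (m : 'cV[rat]_n).

Lemma pairingDl x y m : pairing (x + y) m = pairing x m + pairing y m.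
Proof. by rewrite /pairing mulmxDl mxE. Qed.
Lemma pairingZl c x m : pairing (c *: x) m = c * pairing x m.
Proof. by rewrite /pairing -scalemxAl mxE. Qed.
Lemma pairingDr x m m' : pairing x (m + m') = pairing x m + pairing x m'.
Proof. by rewrite /pairing mulmxDr mxE. Qed.
Lemma pairingZr c x m : pairing x (c *: m) = c * pairing x m.
Proof. by rewrite /pairing -scalemxAr mxE. Qed.
Lemma pairing0l m : pairing 0 m = 0.
Proof. by rewrite /pairing mul0mx mxE. Qed.
Lemma pairing0r x : pairing x 0 = 0.
Proof. by rewrite /pairing mulmx0 mxE. Qed.
Lemma pairingNl x m : pairing (- x) m = - pairing x m.
Proof. by rewrite /pairing mulNmx mxE. Qed.

Lemma pairing_suml (I : Type) (s : seq I) (P : pred I) (f : I -> 'rV_n) m :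
  pairing (\sum_(i <- s | P i) f i) m = \sum_(i <- s | P i) pairing (f i) m.
Proof. by rewrite /pairing mulmx_suml summxE. Qed.

Lemma pairing_sumr (I : Type) (s : seq I) (P : pred I) x (f : I -> 'cV_n) :
  pairing x (\sum_(i <- s | P i) f i) = \sum_(i <- s | P i) pairing x (f i).
Proof. by rewrite /pairing mulmx_sumr summxE. Qed.

End Pairing.

Section LatticeBasis.
Variables (V : zmodType) (I : finType) (L : set V) (J : {set I}) (b : I -> V).
Hypothesis hb : lattice_basis L J b.

Lemma lattice_basisD x y : L x -> L y -> L (x + y).
Proof.
case: hb => h _ /h [c ->] /h [c' ->]; apply/h; exists (fun i => c i + c' i).
by rewrite -big_split; apply: eq_bigr => i _; rewrite mulrzDr.
Qed.

Lemma lattice_basisMz x z : L x -> L (x *~ z).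
Proof.
case: hb => h _ /h [c ->]; apply/h; exists (fun i => c i * z).
by rewrite mulrz_suml; apply: eq_bigr => i _; rewrite mulrzA.
Qed.

Lemma lattice_basis_mem i : i \in J -> L (b i).
Proof.
case: hb => h _ iJ; apply/h; exists (fun j => (j == i)%:Z).
rewrite (bigD1 i) //= eqxx mulr1z big1 ?addr0 // => j /andP[_ /negPf ->].
by rewrite mulr0z.
Qed.

End LatticeBasis.

Section Seed.
Variables (n : nat) (G : fixed_data n) (e : 'I_n -> 'rV[rat]_n).
Hypothesis he : is_seed G e.
Local Notation d := (d G).
Local Notation nform := (nform G).

Lemma d_gt0 i : 0 < d i.
Proof. by rewrite ltr0n dmul_gt0. Qed.

Lemma d_neq0 i : d i != 0.
Proof. by rewrite gt_eqF ?d_gt0. Qed.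

(** A rational relation among the [e_j], multiplied by the product of its denominators, becomes an
    integral one. *)
Lemma seed_unit : (\matrix_j e j) \in unitmx.
Proof.
rewrite -row_free_unit; apply: inj_row_free => u hu; apply/rowP => i.
have [[_ li] _ _] := he; pose D := \prod_j denq (u 0 j).
have D0 : D != 0 by apply/prodf_neq0 => j _; apply: denq_neq0.
pose c j := numq (u 0 j) * \prod_(l | l != j) denq (u 0 l).
have cE j : (c j)%:~R = D%:~R * u 0 j.
  rewrite /D (bigD1 j) //= /c !intrM -{3}(divq_num_den (u 0 j)); field.
  by rewrite intr_eq0 denq_neq0.
have /li /(_ i (finset.in_setT i)) ci : \sum_(j in [set: 'I_n]%SET) e j *~ c j = 0.
  transitivity (D%:~R *: (u *m \matrix_j e j)); last by rewrite hu scaler0.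
  rewrite mulmx_sum_row scaler_sumr; apply: eq_big => [j|j _]; first by rewrite inE.
  by rewrite rowK scalerA -cE scaler_int.
by apply/eqP; have := cE i; rewrite ci mxE => /esym/eqP; rewrite mulf_eq0 intr_eq0 (negPf D0).
Qed.

Lemma pairing_dual i j : pairing (e i) (dual_basis e j) = (i == j)%:R.
Proof.
have := congr1 (fun A : 'M_n => A i j) (mulmxV seed_unit); rewrite [RHS]mxE => <-.
rewrite /pairing !mxE; apply: eq_bigr => l _; rewrite !mxE; by [].
Qed.

Lemma dual_expandN x : x = \sum_i pairing x (dual_basis e i) *: e i.
Proof.
rewrite -{1}(mulmxKV seed_unit x) mulmx_sum_row; apply: eq_bigr => i _.
rewrite rowK; congr (_ *: _); rewrite /pairing !mxE; apply: eq_bigr => j _.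
by rewrite !mxE.
Qed.

Lemma dual_expandM m : m = \sum_i pairing (e i) m *: dual_basis e i.
Proof.
rewrite -{1}(mulKmx seed_unit m); apply/colP => i; rewrite mxE summxE.
apply: eq_bigr => j _; rewrite !mxE mulrC; congr (_ * _).
by rewrite /pairing mxE; apply: eq_bigr => l _; rewrite !mxE.
Qed.

Lemma latNP x : latN G x <-> forall i, pairing x (dual_basis e i) \is a Num.int.
Proof.
have [[h _] _ _] := he; split=> [/h [c ->] i|hx].
  rewrite pairing_suml rpred_sum // => j _.
  by rewrite -scaler_int pairingZl pairing_dual rpredM ?rpred_nat ?rpred_int.
apply/h; exists (fun i => Num.floor (pairing x (dual_basis e i))).
rewrite {1}[x]dual_expandN; apply: eq_big => [i|i _]; first by rewrite inE.
by rewrite -scaler_int (floorK (hx i)).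
Qed.

Lemma latMoP m : latMo G m <-> forall i, pairing (d i *: e i) m \is a Num.int.
Proof.
have [_ _ hb] := he; have [h _] := hb; split=> [hm i|hm x /h [c ->]].
  by apply/hm/(lattice_basis_mem hb); rewrite inE.
rewrite pairing_suml rpred_sum // => i _.
by rewrite -scaler_int pairingZl rpredM ?rpred_int.
Qed.

Definition decM (a : 'rV[int]_(n + n)) : 'cV[rat]_n :=
  \sum_i (a 0 (lshift n i))%:~R *: fvec G e i.
Definition decN (a : 'rV[int]_(n + n)) : 'rV[rat]_n :=
  \sum_i (a 0 (rshift n i))%:~R *: e i.

Lemma pairing_fvec i j : pairing (d i *: e i) (fvec G e j) = (i == j)%:R.
Proof.
rewrite pairingZl pairingZr pairing_dual; case: eqP => [->|_]; last by rewrite !mulr0.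
by rewrite mulr1 mulfV ?d_neq0.
Qed.

Lemma pairing_decM i a : pairing (d i *: e i) (decM a) = (a 0 (lshift n i))%:~R.
Proof.
rewrite pairing_sumr (bigD1 i) //= pairingZr pairing_fvec eqxx mulr1 big1 ?addr0 // => j ji.
by rewrite pairingZr pairing_fvec eq_sym (negPf ji) mulr0.
Qed.

Lemma pairing_decN i a : pairing (decN a) (dual_basis e i) = (a 0 (rshift n i))%:~R.
Proof.
rewrite pairing_suml (bigD1 i) //= pairingZl pairing_dual eqxx mulr1 big1 ?addr0 // => j ji.
by rewrite pairingZl pairing_dual (negPf ji) mulr0.
Qed.

Lemma dec_lat a : tlatMo G (decM a, decN a).
Proof.
split; first by apply/latMoP => i; rewrite pairing_decM rpred_int.
by apply/latNP => i; rewrite pairing_decN rpred_int.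
Qed.

Lemma decK a : tcoord G e (decM a, decN a) = a.
Proof.
apply/rowP => i; rewrite -(splitK i); case: (fintype.split i) => j /=.
  by rewrite row_mxEl mxE pairing_decM intrKfloor.
by rewrite row_mxEr mxE pairing_decN intrKfloor.
Qed.

Lemma tcoordK l : tlatMo G l -> (decM (tcoord G e l), decN (tcoord G e l)) = l.
Proof.
case: l => m x [/= /latMoP hm /latNP hx]; congr pair.
  rewrite [RHS]dual_expandM; apply: eq_bigr => i _.
  rewrite row_mxEl mxE (floorK (hm i)) pairingZl scalerA; congr (_ *: _).
  by rewrite mulrAC mulfV ?d_neq0 ?mul1r.
rewrite [RHS]dual_expandN; apply: eq_bigr => i _.
by rewrite row_mxEr mxE (floorK (hx i)).
Qed.

Lemma decM_delta_l i : decM (delta_mx 0 (lshift n i)) = fvec G e i.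
Proof.
rewrite /decM (bigD1 i) //= mxE !eqxx scale1r big1 ?addr0 // => j ji.
by rewrite mxE eqxx (inj_eq (@lshift_inj _ _)) (negPf ji) scale0r.
Qed.

Lemma decM_delta_r i : decM (delta_mx 0 (rshift n i)) = 0.
Proof. by rewrite /decM big1 // => j _; rewrite mxE eqxx eq_lrshift scale0r. Qed.

Lemma decN_delta_l i : decN (delta_mx 0 (lshift n i)) = 0.
Proof. by rewrite /decN big1 // => j _; rewrite mxE eqxx eq_rlshift scale0r. Qed.

Lemma decN_delta_r i : decN (delta_mx 0 (rshift n i)) = e i.
Proof.
rewrite /decN (bigD1 i) //= mxE !eqxx scale1r big1 ?addr0 // => j ji.
by rewrite mxE eqxx (inj_eq (@rshift_inj _ _)) (negPf ji) scale0r.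
Qed.

Lemma tbasisE i : tbasis G e i = (decM (delta_mx 0 i), decN (delta_mx 0 i)).
Proof.
rewrite -[i]splitK /tbasis unsplitK; case: (fintype.split i) => j /=.
  by rewrite decM_delta_l decN_delta_l.
by rewrite decM_delta_r decN_delta_r.
Qed.

Lemma tcoord_basis i : tcoord G e (tbasis G e i) = delta_mx 0 i.
Proof. by rewrite tbasisE decK. Qed.

Lemma decMD a b : decM (a + b) = decM a + decM b.
Proof. by rewrite -big_split; apply: eq_bigr => i _; rewrite mxE intrD scalerDl. Qed.

Lemma decND a b : decN (a + b) = decN a + decN b.
Proof. by rewrite -big_split; apply: eq_bigr => i _; rewrite mxE intrD scalerDl. Qed.

Lemma coordMo_im : coordMo G e @` latMo G = [set: 'rV[int]_n].
Proof.
apply/seteqP; split=> // a _; exists (decM (row_mx a 0)); first by case: (dec_lat (row_mx a 0)).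
have := congr1 lsubmx (decK (row_mx a 0)); by rewrite /tcoord !row_mxKl.
Qed.

End Seed.

Section PosPart.
Implicit Types x y : rat.

Lemma pos_part_posn (z : int) : pos_part z%:~R = (posn z)%:~R.
Proof.
rewrite /pos_part /posn; case: z => m; first by rewrite max_l // ler0z.
by rewrite max_r // lerz0.
Qed.

Lemma pos_partM c x : 0 <= c -> pos_part (c * x) = c * pos_part x.
Proof. by move=> c0; rewrite /pos_part maxr_pMr // mulr0. Qed.

Lemma pos_part0 : pos_part 0 = 0.
Proof. by rewrite /pos_part maxxx. Qed.

Lemma pos_part_int x : x \is a Num.int -> pos_part x \is a Num.int.
Proof. by move=> xi; rewrite -(floorK xi) pos_part_posn rpred_int. Qed.

End PosPart.

Section Forms.
Variables (n : nat) (G : fixed_data n).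
Implicit Types (e : 'I_n -> 'rV[rat]_n) (x y : 'rV[rat]_n).
Local Notation d := (d G).
Local Notation nform := (nform G).

Lemma nform_pairing x y : nform x y = pairing y (x *m gram G)^T.
Proof. by rewrite /Defs.nform /pairing -[in RHS](trmxK y) -trmx_mul !mxE. Qed.

Lemma nformDl x x' y : nform (x + x') y = nform x y + nform x' y.
Proof. by rewrite /Defs.nform !mulmxDl mxE. Qed.
Lemma nformZl c x y : nform (c *: x) y = c * nform x y.
Proof. by rewrite /Defs.nform -!scalemxAl mxE. Qed.
Lemma nformNl x y : nform (- x) y = - nform x y.
Proof. by rewrite /Defs.nform !mulNmx mxE. Qed.
Lemma nformDr x x' y : nform y (x + x') = nform y x + nform y x'.
Proof. by rewrite 3!(form_skew G y) nformDl opprD. Qed.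
Lemma nformZr c x y : nform y (c *: x) = c * nform y x.
Proof. by rewrite 2!(form_skew G y) nformZl mulrN. Qed.
Lemma nformNr x y : nform y (- x) = - nform y x.
Proof. by rewrite 2!(form_skew G y) nformNl. Qed.
Lemma nformxx x : nform x x = 0.
Proof. by have := form_skew G x x; lra. Qed.

Lemma eps_ii e i : eps G e i i = 0. Proof. by rewrite /eps nformxx mul0r. Qed.

Lemma eps_mutate e i j k : eps G (mutate G e i) j k =
  eps G e j k + (pos_part (eps G e j i) - (2 * (j == i))%N%:R) * eps G e i k
  + (pos_part (- eps G e i k) - (2 * (k == i))%N%:R) * eps G e j i.
Proof.
(* Skew-symmetry gives [d_k eps_ki = - d_i eps_ik], and positive parts commute with positive
   factors. *)
have comm : pos_part (eps G e k i) * (nform (e j) (e i) * d k) = pos_part (- eps G e i k) * eps G e j i.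
  have A : d k * pos_part (eps G e k i) = d i * pos_part (- eps G e i k).
    rewrite -!pos_partM ?ler0n //; congr pos_part.
    by rewrite /eps (form_skew G (e i)); ring.
  transitivity (nform (e j) (e i) * (d k * pos_part (eps G e k i))); first by ring.
  by rewrite A /eps; ring.
rewrite /mutate /eps -!/(eps G e _ _).
have [->|ji] := eqVneq j i; have [->|ki] := eqVneq k i;
  rewrite ?nformDl ?nformDr ?nformNl ?nformNr ?nformZl ?nformZr ?nformxx ?eps_ii.
- by rewrite !(mulr0, mul0r, oppr0, addr0).
- by rewrite /eps pos_part0 /=; ring.
- by rewrite oppr0 pos_part0 /eps /=; ring.
by rewrite /= muln0 !subr0 -comm /eps; ring.
Qed.

End Forms.

(** * Exchange matrices and c-vectors along paths *)

Section Paths.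
Variables (n : nat) (G : fixed_data n) (e0 : 'I_n -> 'rV[rat]_n).
Hypothesis he : is_seed G e0.
Local Notation d := (d G).
Local Notation nform := (nform G).
Local Notation eps := (eps G).
Local Notation tform := (tform G).
Local Notation te w := (tseed_at e0 w).
Local Notation J := {j : 'I_n | j \in uf G}.
Implicit Types (w : vertex G) (j k l : J) (i : 'I_n).

Definition seed_at w : 'I_n -> 'rV[rat]_n := foldl (mutate G) e0 (path_of w).

Lemma path_of_rcons w j : path_of (rcons w j) = rcons (path_of w) (val j).
Proof. exact: map_rcons. Qed.

Lemma seed_at_rcons w j : seed_at (rcons w j) = mutate G (seed_at w) (val j).
Proof. by rewrite /seed_at path_of_rcons foldl_rcons. Qed.

Lemma tseed_at_rcons w j : te (rcons w j) = tmutate G (te w) (val j).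
Proof. by rewrite /tseed_at path_of_rcons foldl_rcons. Qed.

Lemma tform_fst x y : tform (x, 0) (y, 0) = nform x y.
Proof. by rewrite /Defs.tform /= !pairing0r addr0 subr0. Qed.

Lemma tseed_at_inl w i : te w (inl i) = (seed_at w i, 0).
Proof.
elim/last_ind: w i => [|w j IH] i //.
rewrite tseed_at_rcons seed_at_rcons /tmutate /mutate !IH tform_fst.
have -> : (inl i == inl (val j) :> 'I_n + 'I_n) = (i == val j) by [].
case: eqP => _; congr pair; rewrite ?oppr0 //=.
by rewrite scaler0 addr0.
Qed.

Lemma tseed_at_inr_rcons w j i : te (rcons w j) (inr i) =
  te w (inr i) + pos_part (tform (te w (inr i)) (te w (inl (val j))) * d (val j)) *: te w (inl (val j)).
Proof. by rewrite tseed_at_rcons. Qed.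

Lemma seed_at_lat w j : latNuf G (seed_at w (val j)) /\ latNo G (d (val j) *: seed_at w (val j)).
Proof.
have [_ bu bo] := he.
elim/last_ind: w j => [|w l IH] j.
  by split; [apply: (lattice_basis_mem bu (valP j)) | apply: (lattice_basis_mem bo); rewrite inE].
have [h1 h2] := IH j; have [h3 h4] := IH l.
rewrite seed_at_rcons /mutate; case: eqP => [->|_].
  rewrite scalerN -[X in latNuf _ X]mulrN1z -[X in latNo _ X]mulrN1z; split; first exact: (lattice_basisMz bu).
  exact: (lattice_basisMz bo).
have ei : eps (seed_at w) (val j) (val l) \is a Num.int.
  by rewrite /Defs.eps mulrC -nformZr form_int_uf.
have ei' : pos_part (- eps (seed_at w) (val l) (val j)) \is a Num.int.
  by rewrite pos_part_int // rpredN /Defs.eps mulrC -nformZr form_int_uf.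
split.
  apply: (lattice_basisD bu) => //; rewrite -(floorK (pos_part_int ei)) scaler_int.
  exact: (lattice_basisMz bu).
rewrite scalerDr; apply: (lattice_basisD bo) => //.
have -> : d (val j) *: (pos_part (eps (seed_at w) (val j) (val l)) *: seed_at w (val l)) =
    pos_part (- eps (seed_at w) (val l) (val j)) *: (d (val l) *: seed_at w (val l)).
  rewrite !scalerA; congr (_ *: _); rewrite [RHS]mulrC -!pos_partM ?ler0n //; congr pos_part.
  by rewrite /Defs.eps (form_skew G (seed_at w (val l))); ring.
rewrite -(floorK ei') scaler_int; exact: (lattice_basisMz bo).
Qed.

Lemma eps_int w j k : eps (seed_at w) (val j) (val k) \is a Num.int.
Proof.
have [h1 _] := seed_at_lat w j; have [_ h2] := seed_at_lat w k.
by rewrite /Defs.eps mulrC -nformZr form_int_uf.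
Qed.

(** The product [delta j * d_j] does not depend on [j], so [delta] is an integral replacement for
    the symmetrizer [1 / d_j]. *)
Definition delta j : nat := \prod_(i | i != val j) dmul G i.

Lemma delta_gt0 j : (0 < delta j)%N.
Proof. by rewrite prodn_gt0 // => i; rewrite dmul_gt0. Qed.

Lemma delta_d j : (delta j)%:R * d (val j) = (\prod_i dmul G i)%:R.
Proof. by rewrite [in RHS](bigD1 (val j)) //= mulnC natrM. Qed.

(* The indices are swapped: [exch k j] is eps_jk. *)
Definition exch : J -> J -> int := fun k j => Num.floor (eps e0 (val j) (val k)).

Lemma exchE k j : (exch k j)%:~R = eps e0 (val j) (val k).
Proof. exact: (floorK (eps_int [::] j k)). Qed.

Lemma exch_skew : skewsym delta exch.
Proof.
move=> k j; rewrite /omega; apply/eqP; rewrite -(eqr_int rat); apply/eqP.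
rewrite rmorphN !rmorphM /= !exchE -!pmulrn /Defs.eps (form_skew G (e0 (val k))).
have := delta_d k; have := delta_d j => <-.
have dj := d_neq0 G (val j); have dk := d_neq0 G (val k); move=> h.
transitivity (nform (e0 (val j)) (e0 (val k)) * ((delta k)%:R * d (val k))); first by ring.
by rewrite h; ring.
Qed.

Lemma nmatE w k j : (nmat exch w k j)%:~R = eps (seed_at w) (val j) (val k).
Proof.
elim/last_ind: w k j => [|w i IH] k j; first exact: exchE.
rewrite nmat_rcons seed_at_rcons eps_mutate /mut !(rmorphD, rmorphM, rmorphN) /= !IH.
by rewrite -!pos_part_posn ?rmorphN /= !IH -!pmulrn !val_eqE.
Qed.

(** The principal part of the extended exchange matrix. It satisfies the c-vector recursion
    ([ctil_rcons]) and starts from the identity. *)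
Definition ctil w k i : rat := d i * tform (te w (inl (val k))) (te w (inr i)).

Lemma tform_inl (x p : 'rV_n) (f : 'cV_n) : tform (x, 0) (p, f) = nform x p + pairing x f.
Proof. by rewrite /Defs.tform /= pairing0r subr0. Qed.

Lemma tform_inr (x p : 'rV_n) (f : 'cV_n) : tform (p, f) (x, 0) = - (nform x p + pairing x f).
Proof. by rewrite /Defs.tform /= pairing0r addr0 (form_skew G p) opprD. Qed.

Lemma ctil_pos w l i :
  d i * pos_part (tform (te w (inr i)) (te w (inl (val l))) * d (val l)) =
  d (val l) * pos_part (- ctil w l i).
Proof.
rewrite -!pos_partM ?ler0n //; congr pos_part; rewrite /ctil tseed_at_inl.
by case: (te w (inr i)) => p f; rewrite tform_inl tform_inr; ring.
Qed.

Lemma ctil_rcons w l k i : ctil (rcons w l) k i =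
  if k == l then - ctil w l i
  else ctil w k i + pos_part (eps (seed_at w) (val k) (val l)) * ctil w l i
       + pos_part (- ctil w l i) * eps (seed_at w) (val k) (val l).
Proof.
rewrite [LHS]/ctil tseed_at_inr_rcons !tseed_at_inl seed_at_rcons.
have := ctil_pos w l i; rewrite tseed_at_inl; set t := pos_part _ => ht.
rewrite /ctil !tseed_at_inl in ht *; case: (te w (inr i)) ht => p f ht.
have -> : (p, f) + t *: (seed_at w (val l), 0) = (p + t *: seed_at w (val l), f) :> _ * _.
  by congr pair; rewrite /= scaler0 addr0.
rewrite !tform_inl in ht *; rewrite /mutate val_eqE; case: eqP => _.
  by rewrite nformDr nformZr !nformNl nformxx pairingNl; ring.
set q := pos_part (eps _ _ _); set s := pos_part _ in ht *.
rewrite !(nformDr, nformDl, nformZl, nformZr, nformxx, pairingDl, pairingZl).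
transitivity (d i * t * nform (seed_at w (val k)) (seed_at w (val l)) + d i *
  (nform (seed_at w (val k)) p + pairing (seed_at w (val k)) f + q *
   (nform (seed_at w (val l)) p + pairing (seed_at w (val l)) f))); first by ring.
by rewrite ht /Defs.eps; ring.
Qed.

Lemma ctil_nil k i : ctil [::] k i = (val k == i)%:R.
Proof.
rewrite /ctil /= tform_inl -[e0 (val k)]scale1r nformZl.
rewrite nform_pairing pairing0l mulr0 add0r pairingZl mul1r.
rewrite pairingZr (pairing_dual he); case: eqP => _; last by rewrite !mulr0.
by rewrite mulr1 mulfV ?d_neq0.
Qed.

(** Sign coherence is proved for coordinates in the unfrozen indices; this extends it to all [i]. *)
Lemma ctil_frozen w k i : i \notin uf G -> ctil w k i = 0.
Proof.
move=> iu; elim/last_ind: w k => [|w l IH] k.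
  by rewrite ctil_nil; case: eqP => // ki; case/negP: iu; rewrite -ki; apply: valP.
by rewrite ctil_rcons !IH oppr0 pos_part0 mulr0 mul0r !addr0 if_same.
Qed.

Lemma ctilE w k j : ctil w k (val j) = (cvec exch w k j)%:~R.
Proof.
elim/last_ind: w k => [|w l IH] k.
  by rewrite ctil_nil /cvec /= ffunE mul1r val_eqE eq_sym.
rewrite ctil_rcons cvec_rcons /cmut; case: eqP => _; first by rewrite ffunE rmorphN /= IH.
rewrite !ffunE scaleVE !(rmorphD, rmorphM) /= -!pos_part_posn rmorphN /= !IH !nmatE.
by ring.
Qed.

Theorem ctil_sign w k : [/\ forall i, ctil w k i \is a Num.int, exists i, ctil w k i != 0 &
  (forall i, 0 <= ctil w k i) \/ (forall i, ctil w k i <= 0)].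
Proof.
have [c0 cs] := @sign_coherence _ delta delta_gt0 exch w exch_skew k.
have [j hj] : exists j, cvec exch w k j != 0.
  apply: contrapT => h; move/eqP: c0; apply; apply/ffunP => j; rewrite ffunE.
  by apply/eqP; apply/negPn/negP => cj; apply: h; exists j.
have ci i : i \in uf G -> exists j : J, ctil w k i = (cvec exch w k j)%:~R.
  by move=> iu; exists (exist _ i iu); rewrite -ctilE.
split.
- move=> i; have [/ci[j' ->]|/ctil_frozen ->] := boolP (i \in uf G); rewrite ?rpred_int //.
- by exists (val j); rewrite ctilE intr_eq0.
case: cs => cs; [left | right] => i; (have [/ci[j' ->]|/ctil_frozen -> //] := boolP (i \in uf G)).
  by rewrite ler0z.
by rewrite lerz0.
Qed.

End Paths.

(** * Charts *)

Section NonVanishing.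
Variables (k : fieldType) (r : nat).
Hypothesis hk : [pchar k]%R =i pred0.

(** At the point with all coordinates 1 it takes the value 2, nonzero in characteristic 0. *)
Lemma one_lmonom_neq0 (v : 'rV[int]_r) : 1 + lmonom k v != 0 :> ratfun k r.
Proof.
pose phi := mmap (@idfun k) (fun _ : 'I_r => 1 : k).
have [|d1 e1] := @pdom_lmonom k r k idfun (fun=> 1) v; first by move=> i; rewrite oner_neq0 orbT.
have [d2 e2] := pdom1 phi; have [d3 e3] := pdomD d2 d1.
apply/eqP => h; have := (pdom0 phi).2; rewrite -h e3 e2 e1 big1 => [|i _]; last exact: exp1rz.
by move/eqP; rewrite -mulr2n; apply/negP; move/pcharf0P: hk => ->.
Qed.

End NonVanishing.

Section Charts.
Variables (n : nat) (G : fixed_data n) (e0 : 'I_n -> 'rV[rat]_n).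
Hypothesis he : is_seed G e0.
Local Notation d := (d G).
Local Notation te w := (tseed_at e0 w).
Local Notation J := {j : 'I_n | j \in uf G}.
Local Notation seed_at := (seed_at e0).
Local Notation decM := (decM G e0).
Local Notation decN := (decN e0).
Local Notation ctil := (ctil e0).
Implicit Types (w : vertex G) (l : J) (i j : 'I_n) (a b : 'rV[int]_(n + n)).

Lemma tpairingDl u u' m : tpairing (u + u') m = tpairing (n := n) u m + tpairing u' m.
Proof. by rewrite /tpairing /= pairingDl pairingDr addrACA. Qed.

Lemma tpairingZl c u m : tpairing (c *: u) m = c * tpairing (n := n) u m.
Proof. by rewrite /tpairing /= pairingZl pairingZr mulrDr. Qed.

(** The order of the character [a] along the [i]-th boundary divisor of the chart; the factor [d i]
    normalizes [X_i] to order 1. *)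
Definition facet w i a : rat := d i * tpairing (te w (inr i)) (decM a, decN a).

Lemma facetD w i a b : facet w i (a + b) = facet w i a + facet w i b.
Proof.
rewrite /facet -mulrDr; congr (_ * _).
by rewrite /tpairing /= decMD decND pairingDl pairingDr addrACA.
Qed.

Lemma facet0 w i : facet w i 0 = 0.
Proof. by apply: (addrI (facet w i 0)); rewrite -facetD !addr0. Qed.

Lemma facetN w i a : facet w i (- a) = - facet w i a.
Proof. by apply/eqP; rewrite -addr_eq0 -facetD addNr facet0. Qed.

Lemma facetMz w i a (z : int) : facet w i (a *~ z) = z%:~R * facet w i a.
Proof.
have P m : facet w i (a *+ m) = m%:R * facet w i a.
  elim: m => [|m IH]; first by rewrite mulr0n facet0 mul0r.
  by rewrite mulrS facetD IH mulrS mulrDl mul1r.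
case: z => m; first by rewrite -pmulrn P.
by rewrite NegzE !mulrNz facetN -pmulrn P mulNr.
Qed.

Lemma facet_nil i a : facet [::] i a = (a 0 (rshift n i))%:~R.
Proof.
rewrite /facet /tpairing /= pairing0l add0r pairingZr (pairing_decN he) mulrA.
by rewrite mulfV ?d_neq0 // mul1r.
Qed.

(** Through [hval] this is the linear form [<d_l e_l, m>], up to sign the exponent of the binomial
    in the mutation formula. *)
Definition shift_var w l (i : 'I_(n + n)) : int :=
  Num.floor (pairing (d (val l) *: seed_at w (val l)) (tbasis G e0 i).1).

Local Notation shift w l := (hval (shift_var w l)).

Lemma shift_pairing w l a : (shift w l a)%:~R = pairing (d (val l) *: seed_at w (val l)) (decM a).
Proof.
have [_ h] := seed_at_lat he w l.
rewrite /hval big_split_ord /= [X in _ + X]big1 => [|i _]; last first.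
  by rewrite /shift_var tbasisE decM_delta_r pairing0r floor0 mulr0.
rewrite addr0 rmorph_sum pairing_sumr; apply: eq_bigr => i _.
rewrite rmorphM /= pairingZr /shift_var tbasisE decM_delta_l; congr (_ * _); apply: floorK.
by have [+ _] := dec_lat he (delta_mx 0 (lshift n i)); rewrite /= decM_delta_l; apply.
Qed.

Lemma facet_rcons w l i a :
  facet (rcons w l) i a = facet w i a + pos_part (- ctil w l i) * (shift w l a)%:~R.
Proof.
rewrite /facet tseed_at_inr_rcons tpairingDl tpairingZl mulrDr; congr (_ + _).
rewrite mulrA ctil_pos shift_pairing pairingZl tseed_at_inl /tpairing /= pairing0r addr0.
by ring.
Qed.

Lemma shift_rshift w l j : shift w l (delta_mx 0 (rshift n j)) = 0.
Proof.
apply/eqP; rewrite -(eqr_int rat); apply/eqP.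
by rewrite shift_pairing decM_delta_r pairing0r.
Qed.

Lemma facet_rshift w i j : facet w i (delta_mx 0 (rshift n j)) = (i == j)%:R.
Proof.
elim/last_ind: w => [|w l IH]; last by rewrite facet_rcons shift_rshift mulr0 addr0.
by rewrite facet_nil mxE eqxx (inj_eq (@rshift_inj _ _)); case: eqP.
Qed.

Definition exchvec w l : 'rV[int]_(n + n) :=
  tcoord G e0 (vvec G (seed_at w) (val l), seed_at w (val l)).

Lemma dec_exchvec w l :
  (decM (exchvec w l), decN (exchvec w l)) = (vvec G (seed_at w) (val l), seed_at w (val l)).
Proof.
apply: (tcoordK he); have [h _] := seed_at_lat he w l; split; last exact: latNuf_sub.
by move=> x hx; rewrite /= /vvec -nform_pairing; apply: form_int_uf.
Qed.

(** The link between geometry and combinatorics: the binomial's monomial has the c-vector as its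
    orders along the boundary. *)
Lemma facet_exchvec w l i : facet w i (exchvec w l) = ctil w l i.
Proof.
rewrite /facet dec_exchvec /ctil tseed_at_inl; case: (te w (inr i)) => p f.
by rewrite tform_inl /tpairing /= nform_pairing.
Qed.

Lemma shift_exchvec w l : shift w l (exchvec w l) = 0.
Proof.
apply/eqP; rewrite -(eqr_int rat); apply/eqP; rewrite shift_pairing.
have [-> _] := dec_exchvec w l.
by rewrite pairingZl -nform_pairing nformxx mulr0.
Qed.

Definition chart_cone w : set 'rV[int]_(n + n) := [set a | forall i, 0 <= facet w i a].

Lemma chart_coneE w : tcoord G e0 @` (tlatMo G `&` dual_cone (sigma e0 w)) = chart_cone w.
Proof.
apply/seteqP; split=> [_ [l [hl dl] <-] i|a ha].
  rewrite /facet (tcoordK he hl) mulr_ge0 ?ler0n //; apply: dl.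
  exists (fun j => (j == i)%:R); split; first by move=> j; rewrite ler0n.
  rewrite (bigD1 i) //= eqxx scale1r big1 ?addr0 // => j /negPf ->.
  by rewrite scale0r.
exists (decM a, decN a); last exact: (decK he).
split; first exact: (dec_lat he).
move=> _ [c [c0 ->]].
elim/big_rec: _ => [|i u _ IH]; first by rewrite /tpairing pairing0l pairing0r addr0.
rewrite tpairingDl tpairingZl addr_ge0 // mulr_ge0 //.
by have := ha i; rewrite /facet pmulr_rge0 // d_gt0.
Qed.

Lemma chart_cone0 w : chart_cone w 0. Proof. by move=> i; rewrite facet0. Qed.

Lemma chart_coneD w a b : chart_cone w a -> chart_cone w b -> chart_cone w (a + b).
Proof. by move=> ha hb i; rewrite facetD addr_ge0. Qed.

End Charts.

Section Gluing.
Variables (k : fieldType) (n : nat) (G : fixed_data n) (e0 : 'I_n -> 'rV[rat]_n).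
Hypothesis hk : [pchar k]%R =i pred0.
Hypothesis he : is_seed G e0.
Local Notation d := (d G).
Local Notation J := {j : 'I_n | j \in uf G}.
Local Notation seed_at := (seed_at e0).
Local Notation ctil := (ctil e0).
Local Notation facet := (facet e0).
Local Notation shift w l := (hval (shift_var e0 w l)).
Local Notation exchvec := (exchvec e0).
Local Notation cone := (chart_cone e0).
Local Notation K := (ratfun k (n + n)).
Local Notation A w := (toric_ring e0 w : set K).
Local Notation lm := (lmonom k).
Local Notation xr j := (xvar k (rshift n j)).
Local Notation theta w := (path_pull G e0 e0 (path_of w) : K -> K).
Implicit Types (w : vertex G) (l : J) (i j : 'I_n) (a b : 'rV[int]_(n + n)).

Lemma toric_ringE w : A w = monoid_alg (k := k) (cone w).
Proof. by rewrite /toric_ring chart_coneE. Qed.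

Lemma toric_subring w : subring_set (A w).
Proof.
rewrite toric_ringE; apply: monoid_alg_subring; first exact: chart_cone0.
exact: chart_coneD.
Qed.

Lemma toric_xr w j : A w (xr j).
Proof.
rewrite toric_ringE -lmonom_delta; apply: monoid_alg_lmonom => i.
by rewrite facet_rshift // ler0n.
Qed.

Definition mauto w l : int -> K -> K := mutauto (exchvec w l) (shift_var e0 w l).

Section OneMutation.
Variables (w : vertex G) (l : J).
Local Notation v := (exchvec w l).
Local Notation h := (shift w l).
Local Notation g := (1 + lm v : K).
Let hv : h v = 0 := shift_exchvec he w l.
Let g0 : g != 0 := one_lmonom_neq0 hk v.
Local Notation mauto := (mauto w l).

Lemma mautoD s : {morph mauto s : x y / x + y}.
Proof. exact: (mutautoD hv g0). Qed.
Lemma mautoM s : {morph mauto s : x y / x * y}.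
Proof. exact: (mutautoM hv g0). Qed.
Lemma mauto_const s c : mauto s (rconst (n + n) c) = rconst (n + n) c.
Proof. exact: (mutauto_const hv g0). Qed.
Lemma mauto_lmonom s a : mauto s (lm a) = lm a * g ^ (s * h a).
Proof. exact: (mutauto_lmonom hv g0). Qed.
Lemma mautoK s : cancel (mauto s) (mauto (- s)).
Proof. exact: (mutautoK hv g0). Qed.
Lemma mauto1 s : mauto s 1 = 1.
Proof. by rewrite -(rmorph1 (@rconst k (n + n))) mauto_const. Qed.
Lemma mauto_xr s j : mauto s (xr j) = xr j.
Proof. by rewrite -lmonom_delta mauto_lmonom shift_rshift // mulr0 expr0z mulr1. Qed.

Lemma mu_pullE : mu_pull G e0 (seed_at w) (val l) = mauto (-1) :> (K -> K).
Proof.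
rewrite /mu_pull /mauto /mutauto; congr ratfun_subst; apply: funext => i.
rewrite /mu_character /character /mutvar tcoord_basis // lmonom_delta.
by rewrite mulN1r.
Qed.

(* [sg] is the tropical sign of the c-vector of [l]; the mutation is an
   isomorphism where [1 + z^(sg v)] does not vanish. *)
Lemma mutation_iso_sign (sg : bool) :
  (forall i, 0 <= (-1) ^+ sg * ctil w l i) ->
  local_iso (A (rcons w l)) (A w) (mauto 1) (mauto (-1)) (1 + lm (v *~ (-1) ^+ sg)).
Proof.
move=> cs; set u := v *~ _; set g' : K := 1 + lm u.
have hu : h u = 0 by rewrite hvalMz hv mulr0.
have g'0 : g' != 0 := one_lmonom_neq0 hk u.
have cpos i : pos_part (- ctil w l i) = if sg then - ctil w l i else 0.
  have := cs i; case: (sg); rewrite ?expr0 ?expr1 ?mulN1r ?mul1r => c0.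
    by rewrite /pos_part max_l.
  by rewrite /pos_part max_r // oppr_le0.
have fE i a : facet (rcons w l) i a = facet w i a - (if sg then (h a)%:~R else 0) * ctil w l i.
  rewrite facet_rcons // cpos; case: (sg); last by rewrite !mul0r oppr0.
  by rewrite mulNr mulrC.
have fu i : 0 <= facet w i u by rewrite facetMz facet_exchvec // rmorphXn /= rmorphN1; apply: cs.
have fu' i : 0 <= facet (rcons w l) i u by rewrite fE hu if_same mul0r subr0.
(* For negative tropical sign [1 + z^v = z^v (1 + z^-v)]; the extracted monomial is moved into the
   exponents by [tau], so only powers of [g'] remain. *)
have gE : g = lm (if sg then v else 0) * g'.
  rewrite /g' /u; case: (sg); last by rewrite expr0 mulr1z lmonom0 mul1r.
  by rewrite expr1 mulrN1z mulrDr mulr1 -lmonomD subrr lmonom0 addrC.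
pose tau (s : int) a := a + (if sg then v else 0) *~ (s * h a).
have mE s a : mauto s (lm a) = lm (tau s a) * g' ^ (s * h a).
  rewrite mauto_lmonom gE expfzMl mulrA -lmonomXz -lmonomD.
  by rewrite /tau; case: (sg).
have SR (x : vertex G) : cone x u -> monoid_alg (k := k) (cone x) g'.
  move=> ux; apply: monoid_algD; last exact: monoid_alg_lmonom.
  by rewrite -(rmorph1 (@rconst k (n + n))); apply/monoid_alg_const/chart_cone0.
have im (x y : vertex G) (s : int) : cone y u -> (forall a, cone x a -> cone y (tau s a)) ->
    forall f, A x f -> exists N, A y (mauto s f * g' ^+ N).
  move=> uy txy f; rewrite !toric_ringE => Af.
  exact: (monoid_alg_image (@chart_cone0 _ _ _ y) (@chart_coneD _ _ _ y) (mautoD s) (mautoM s)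
    (mauto_const s) (mE s) txy g'0 (SR y uy) Af).
have tf i s a : facet w i (tau s a) = facet w i a + (if sg then (s * h a)%:~R * ctil w l i else 0).
  rewrite facetD facetMz; case: (sg); rewrite ?facet_exchvec //.
  by rewrite facet0 mulr0.
have th s a : h (tau s a) = h a.
  rewrite /tau hvalD hvalMz; case: (sg); first by rewrite hv mulr0 addr0.
  by rewrite -(mulr0z v) hvalMz mul0r mulr0 addr0.
split; try exact: toric_subring; try exact: mautoD; try exact: mautoM; try exact: mautoK.
- by rewrite mautoD mauto1 mE hu mulr0 expr0z mulr1 /tau hu mulr0 mulr0z addr0.
- by rewrite toric_ringE; apply: SR.
- by rewrite toric_ringE; apply: SR.
- apply: im => // a ca i; rewrite fE tf th; have := ca i; case: (sg); rewrite ?mul1r; lra.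
apply: im => // a ca i; rewrite tf; have := ca i; rewrite fE; case: (sg); rewrite ?mulN1r ?rmorphN /=; lra.
Qed.

Lemma mutation_iso : exists g', local_iso (A (rcons w l)) (A w) (mauto 1) (mauto (-1)) g' /\
  forall p : spec (A (rcons w l)), (forall j, ideal p (xr j)) -> ~ ideal p g'.
Proof.
have [ci [i0 ci0] cs] := ctil_sign he w l.
have [sg hsg] : exists sg : bool, forall i, 0 <= (-1) ^+ sg * ctil w l i.
  case: cs => cs; [exists false | exists true] => i; first by rewrite expr0 mul1r.
  by rewrite expr1 mulN1r oppr_ge0.
exists (1 + lm (v *~ (-1) ^+ sg)); split; first exact: mutation_iso_sign.
set u := v *~ _ => p hp pg.
have fu i : facet (rcons w l) i u = (-1) ^+ sg * ctil w l i.
  rewrite facet_rcons // hvalMz hv mulr0 mulr0 addr0 facetMz facet_exchvec //.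
  by rewrite rmorphXn /= rmorphN1.
(* The order of [z^u] along the divisor [i0] is a nonzero nonnegative integer, hence at least 1, and
   one factor [X_i0] can be split off inside the ring. *)
have Au : A (rcons w l) (lm (u - delta_mx 0 (rshift n i0))).
  rewrite toric_ringE; apply: monoid_alg_lmonom => i.
  rewrite facetD facetN facet_rshift // fu subr_ge0; case: eqP => [->|_]; last exact: hsg.
  have : (-1) ^+ sg * ctil w l i0 \is a Num.int by rewrite rpredM ?rpredX ?rpredN ?rpred1.
  move=> /floorK h0; rewrite -h0 -[X in X <= _]/(1%:~R) ler_int.
  have : Num.floor ((-1) ^+ sg * ctil w l i0) != 0.
    by rewrite -(intr_eq0 rat) h0 mulf_neq0 ?signr_eq0.
  have : 0 <= Num.floor ((-1) ^+ sg * ctil w l i0) by rewrite floor_ge0.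
  lia.
have pu : ideal p (lm u).
  rewrite -(subrK (delta_mx 0 (rshift n i0)) u) lmonomD lmonom_delta.
  by apply: primeMl => //; apply: hp.
apply: (prime1 (p := p)); rewrite -(addrK (lm u) 1); apply: primeD => //.
exact: (primeN (toric_subring _)).
Qed.

End OneMutation.

(** The recursion defining [path_pull] starts at the root, whereas the inductions over charts remove
    the last edge. *)
Lemma path_pull_rcons (e : 'I_n -> 'rV[rat]_n) (s : seq 'I_n) j (f : K) :
  path_pull G e0 e (rcons s j) f = path_pull G e0 e s (mu_pull G e0 (foldl (mutate G) e s) j f).
Proof. by elim: s e => [|i s IH] e //=; rewrite IH. Qed.

Lemma theta_rcons w l (f : K) : theta (rcons w l) f = theta w (mauto w l (-1) f).
Proof. by rewrite path_of_rcons path_pull_rcons mu_pullE. Qed.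

Lemma thetaV w (f : K) : theta w f^-1 = (theta w f)^-1.
Proof.
elim/last_ind: w f => [|w l IH] f //; rewrite !theta_rcons -IH; congr (theta w _).
have [g' [li _]] := mutation_iso w l; exact: (psiV (local_iso_sym li)).
Qed.

Lemma theta_xr w j : theta w (xr j) = xr j.
Proof. by elim/last_ind: w => [|w l IH] //; rewrite theta_rcons mauto_xr. Qed.

Lemma central_root w (p : spec (A w)) : (forall j, ideal p (xr j)) ->
  exists p0 : spec (A [::]), (forall j, ideal p0 (xr j)) /\
    glued (A := fun w => A w) (fun w => theta w) (existT _ w p) (existT _ [::] p0).
Proof.
elim/last_ind: w p => [|w l IH] p hp.
  exists p; split=> //; apply: glued_refl; exact: toric_subring.
have [g' [li ng]] := mutation_iso w l; have ngp := ng p hp.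
have [|p0 [h0 gl]] := IH (push li ngp).
  move=> j; rewrite (pushP li ngp (N := 0%N)); last 2 first.
  - exact: toric_xr.
  - by rewrite mauto_xr expr0 mulr1; apply: toric_xr.
  by rewrite mauto_xr expr0 mulr1.
exists p0; split=> //; apply: (glued_trans toric_subring _ gl).
apply: (glued_push (theta := fun w => theta w)).
by move=> f; rewrite theta_rcons mautoK.
Qed.

Lemma cone_nil : cone ([::] : vertex G) = @effective n.
Proof.
apply/seteqP; split=> a ha i; have := ha i; first by rewrite facet_nil // ler0z.
by rewrite facet_nil // ler0z.
Qed.

Lemma Xfun_xr j : Xfun G k e0 j = xr j :> K.
Proof.
rewrite /Xfun /character -lmonom_delta -(tcoord_basis he); congr (lmonom k (tcoord _ _ _)).
by rewrite /tbasis (unsplitK (inr j)).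
Qed.

End Gluing.

Theorem theorem0p9 (k : fieldType) (hk : [pchar k]%R =i pred0)
    (n : nat) (G : fixed_data n) (e : 'I_n -> 'rV[rat]_n)
    (he : is_seed G e) (hv : forall i, i \in uf G -> vvec G e i != 0) :
  exists iota : smap (torus G k e) (Aprin_bar G k e),
    is_fibre (Xfun G k e) (@origin k n) iota.
Proof.
have -> : Xfun G k e = fun j => xvar k (rshift n j) by apply: funext => j; apply: (Xfun_xr k he).
have T0 : monoid_alg (k := k) (coordMo G e @` latMo G) = monoid_alg (k := k) [set: 'rV[int]_n].
  by rewrite (coordMo_im he).
have A0 : toric_ring e ([::] : vertex G) = monoid_alg (k := k) (@effective n).
  by rewrite (toric_ringE _ he) (cone_nil he).
eexists; apply: (central_fibre (w0 := [::]) (sigma := @residue k n)).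
- exact: toric_subring.
- by rewrite T0; apply: monoid_alg_subring.
- by [].
- exact: thetaV.
- exact: theta_xr.
- exact: toric_xr.
- by move=> j; apply: xvar_neq0.
- by move=> c; rewrite A0; apply: monoid_alg_const; apply: eff0.
- by move=> a; rewrite A0 T0; apply: residue_im.
- by move=> a b; rewrite A0; apply: residue_add.
- by move=> a b; rewrite A0; apply: residue_mul.
- exact: residue_const.
- by move=> t; rewrite A0 T0; apply: residue_surj.
- by move=> a; rewrite A0; apply: residue_ker.
- exact: residue_xvar.
- by move=> a b; rewrite A0; apply: residue_div.
exact: central_root.
Qed.
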